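(* Let $\Delta>1$ be a fundamental discriminant, let $p$ be a prime not dividing $\Delta$, and let $m,n$ be non-negative integers with $n>0$. For a negative discriminant $-d$, write $d=p^{2u}d'$ where $p^2\nmid d'$ and $u\ge0$. Then, with $\ell=\min(\mathrm{ord}_p(n),m)$, $$\sum_{t=0}^{\ell}p^{t}\,Tr_{\Delta,d}\bigl(J_{p^mn/p^{2t}}\bigr)=\begin{cases}\displaystyle\sum_{t=0}^{m}p^{m-t}\,Tr_{\Delta,p^{2u-2m+4t}d'}(J_n),&\text{if }0\le m<u,\\[2ex]\displaystyle\sum_{t=0}^{m-u}\Bigl(\frac{-d'}{p}\Bigr)^{m-u-t}p^{u}\,Tr_{\Delta,p^{2t}d'}(J_n)+\sum_{t=1}^{u}p^{u-t}\,Tr_{\Delta,p^{2m-2u+4t}d'}(J_n),&\text{if }m\ge u.\end{cases}$$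
   Context: A negative discriminant is a negative integer congruent to $0$ or $1$ mod $4$. $(\frac{\cdot}{p})$ is the Kronecker symbol, with $0^0=1$. Let $\Gamma=\mathrm{SL}_2(\mathbb Z)$ and $\bar\Gamma=\Gamma/\{\pm I\}$. For a positive integer $d$, let $\mathcal Q_{d\Delta}$ be the set of positive definite integral binary quadratic forms $Q=[a,b,c]=aX^2+bXY+cY^2$ of discriminant $b^2-4ac=-d\Delta$, with the usual action of $\Gamma$; $\alpha_Q$ is the root of $Q(\tau,1)=0$ in the upper half-plane and $\bar\Gamma_Q$ is the stabilizer of $Q$ in $\bar\Gamma$. The genus character is $\chi_\Delta(Q)=(\frac{\Delta}{\nu})$ if $\Delta\mid b^2-4ac$, $(b^2-4ac)/\Delta$ is a square mod $4$ and $\gcd(a,b,c,\Delta)=1$, where $\nu$ is any integer prime to $\Delta$ represented by $Q$; and $\chi_\Delta(Q)=0$ otherwise. For a weakly holomorphic modular function $f$ on $\Gamma$, the twisted trace of singular moduli is $$Tr_{\Delta,d}(f)=\sum_{Q\in\mathcal Q_{d\Delta}/\bar\Gamma}\frac{\chi_\Delta(Q)}{|\bar\Gamma_Q|}f(\alpha_Q)$$ (an empty sum being $0$). For $n\ge1$, $J_n=(j-744)|T(n)$ with $T(n)$ the normalized Hecke operator and $j=q^{-1}+744+196884q+\cdots$ the elliptic modular function, $q=e^{2\pi i\tau}$; equivalently $J_n$ is the unique polynomial in $j$ with $q$-expansion $J_n=q^{-n}+O(q)$.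
   Formalization: In the case m ≥ u the first sum (over 0 ≤ t ≤ m−u) is replaced by 0 when −d' is not a discriminant (only possible for p=2); as printed the formula fails there, e.g. Δ=5, p=2, d=4, n=1, m=2. *)

(* Defs.v *)
From HB Require Import structures.
From mathcomp Require Import all_boot all_order all_algebra.
From mathcomp Require Import finmap.
From mathcomp Require Import all_classical all_reals all_analysis.
From mathcomp Require Import complex.
From mathcomp.analysis.showcase Require summability.

Set Implicit Arguments.
Unset Strict Implicit.
Unset Printing Implicit Defensive.

Import Order.TTheory GRing.Theory Num.Theory.
Import numFieldNormedType.Exports.

Local Open Scope classical_set_scope.
Local Open Scope ring_scope.

Definition is_discriminant (D : int) : bool :=
  (D %% 4)%Z \in [:: 0; 1].

Definition squarefree (D : int) : Prop :=
  forall q : nat, prime q -> ~~ ((q ^ 2)%N%:Z %| D)%Z.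

Definition fundamental_discriminant (D : int) : Prop :=
  ((D %% 4)%Z = 1 /\ squarefree D) \/
  (exists2 D0 : int, D = 4 * D0 &
     (D0 %% 4)%Z \in [:: 2; 3] /\ squarefree D0).

(* The Legendre symbol for an odd prime q, and the usual supplement at 2. *)
Definition kronecker_prime (a : int) (q : nat) : int :=
  if q == 2%N then
    if (2 %| a)%Z then 0
    else if (a %% 8)%Z \in [:: 1; 7] then 1 else -1
  else
    if (q%:Z %| a)%Z then 0
    else if [exists x : 'I_q, (a == (x ^ 2)%N%:Z %[mod q])%Z] then 1 else -1.

(* (a/0) is 1 for a = 1, -1 and 0 otherwise, and (a/-1) is -1 exactly when
   a < 0. *)
Definition kronecker (a n : int) : int :=
  if n == 0 then (if `|a|%N == 1%N then 1 else 0)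
  else (if (n < 0) && (a < 0) then -1 else 1) *
       \prod_(q <- primes `|n|%N) kronecker_prime a q ^+ logn q `|n|%N.

Record bqf := BQF { qa : int; qb : int; qc : int }.

HB.instance Definition _ := gen_eqMixin bqf.
HB.instance Definition _ := gen_choiceMixin bqf.

Definition bqf_disc (Q : bqf) : int := qb Q ^+ 2 - 4 * qa Q * qc Q.

Definition bqf_eval (Q : bqf) (x y : int) : int :=
  qa Q * x ^+ 2 + qb Q * x * y + qc Q * y ^+ 2.

Definition posdef (Q : bqf) : Prop :=
  forall x y : int, (x, y) != (0, 0) -> 0 < bqf_eval Q x y.

(* The set Q_{d Delta} of the forms of discriminant - d * Delta. *)
Definition forms (D : int) (d : nat) : set bqf :=
  [set Q | posdef Q /\ bqf_disc Q = - (d%:Z * D)].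

Definition SL2Z : set 'M[int]_2 := [set g | \det g = 1].

(* (Q o g)(X, Y) = Q(g00 X + g01 Y, g10 X + g11 Y) *)
Definition bqf_act (Q : bqf) (g : 'M[int]_2) : bqf :=
  let: (x, y, z, t) := (g 0 0, g 0 1, g 1 0, g 1 1) in
  BQF (bqf_eval Q x z)
      (2 * qa Q * x * y + qb Q * (x * t + y * z) + 2 * qc Q * z * t)
      (bqf_eval Q y t).

Definition bqf_class (Q : bqf) : set bqf := [set bqf_act Q g | g in SL2Z].

(* The stabilizer in SL2(Z)/{1, -1}, whose elements are the pairs {g, -g}. *)
Definition bqf_stab (Q : bqf) : set (set 'M[int]_2) :=
  [set [set g; - g] | g in [set g | SL2Z g /\ bqf_act Q g = Q]].

Definition chi (D : int) (Q : bqf) : int :=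
  if `[< [/\ (D %| bqf_disc Q)%Z,
             exists x : int, ((bqf_disc Q %/ D)%Z = x ^+ 2 %[mod 4])%Z
           & gcdz (qa Q) (gcdz (qb Q) (gcdz (qc Q) D)) = 1] >]
  then kronecker D (xget 1 [set nu : int | coprimez nu D /\
                              exists x y : int, bqf_eval Q x y = nu])
  else 0.

Section TwistedTraces.
Variable R : realType.
Local Notation C := R[i].

Definition alpha (Q : bqf) : C :=
  xget 0 [set z : C | 0 < complex.Im z /\
    (qa Q)%:~R * z ^+ 2 + (qb Q)%:~R * z + (qc Q)%:~R = 0].

(* The summand does not depend on the representative of the class when f is
   SL2(Z)-invariant. *)
Definition Tr (D : int) (d : nat) (f : C -> C) : C :=
  \sum_(X \in [set bqf_class Q | Q in forms D d])
    let Q := xget (BQF 1 0 1) X in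
    (chi D Q)%:~R / (#|` fset_set (bqf_stab Q)|)%:R * f (alpha Q).

(* Unordered sum over the lattice; the term (0, 0) vanishes because
   0^-1 = 0. *)
Definition eisenstein (k : nat) (z : C) : C :=
  @summability.sum (int * int)%type C C^o
    (fun cd => (cd.1%:~R * z + cd.2%:~R) ^- k).

(* The elliptic modular function 1728 g2^3 / (g2^3 - 27 g3^2), with
   q-expansion q^-1 + 744 + 196884 q + ... *)
Definition jinv (z : C) : C :=
  let g2 := 60 * eisenstein 4 z in
  let g3 := 140 * eisenstein 6 z in
  1728 * g2 ^+ 3 / (g2 ^+ 3 - 27 * g3 ^+ 2).

(* The Hecke operator in weight 0, normalized so that it sends
   q^-1 + O(q) to q^-n + O(q). *)
Definition hecke (n : nat) (f : C -> C) (z : C) : C :=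
  \sum_(e <- divisors n) \sum_(b < e) f (((n %/ e)%:R * z + b%:R) / e%:R).

Definition J (n : nat) : C -> C := hecke n (fun z => jinv z - 744).

End TwistedTraces.

(* Main.v *)
Require Import Defs.
From HB Require Import structures.
From mathcomp Require Import all_boot all_order all_algebra all_field cyclic.
From mathcomp Require Import finmap.
From mathcomp Require Import all_classical all_reals all_analysis.
From mathcomp Require Import complex.
From mathcomp Require Import zify ring.
From mathcomp.analysis.showcase Require summability.

Set Implicit Arguments.
Unset Strict Implicit.
Unset Printing Implicit Defensive.

Import Order.TTheory GRing.Theory Num.Theory.
Import numFieldNormedType.Exports.
Local Open Scope ring_scope.

(** Write T(n) for the Hecke operators, J_n = (j - 744) | T(n), and a_k for the
twisted trace of J_n at p^(2k) d'.  The identity is formal once two facts about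
Hecke operators are known; the first one needs f to be periodic, the second one
needs f to be invariant under SL2(Z).

- Composition ([hecke_relation]): T(p) T(n) f = T(p n) f + p T(n / p) f, the last
  term being 0 when p does not divide n.  Hence the functions
  L_m = sum_t p^t J_(p^m n / p^(2t)), whose traces form the left-hand side, satisfy
  T(p) L_0 = L_1 and T(p) L_(m+1) = L_(m+2) + p L_m ([hecke_comb_rec]), so that
  L_m is J_n | T(p^m).

- Traces ([Tr_hecke]): when - d is a discriminant,
  Tr_d (T(p) f) = Tr_(p^2 d) f + (-d / p) Tr_d f + p Tr_(d / p^2) f.
  A matrix m of determinant p with Q m = Q' is, through the adjugate, the same
  thing as a matrix m' of determinant p with Q' m' = p^2 Q.  Counting these
  matrices in both ways, with weights given by the orders of the stabilizers
  ([coset_sum], [hom_count_adj]), rewrites Tr_d (T(p) f) as a sum over the forms Q'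
  of discriminant - p^2 d D, each weighted by the number of right cosets of matrices
  m' of determinant p for which Q' m' is divisible by p^2.  That number is
  1 + [p | Q'] (-dD / p) + [p^2 | Q'] p ([count_sublattices]), and
  chi (p Q) = (D / p) chi Q turns (-dD / p) into (-d / p).

Let A_m(k) be the trace of L_m at p^(2k) d'.  Both facts together give
A_(m+2)(k) + p A_m(k) = A_(m+1)(k+1) + eps_k A_(m+1)(k) + p A_(m+1)(k-1), where
eps_k is the symbol (-p^(2k) d' / p), which is 0 for k > 0, and the last term is
absent for k = 0.  (If - d' is not a discriminant, then A_m(0) = 0 for all m and only
k > 0 is considered.)  This determines everything from A_0(k) = a_k, and the
right-hand side R_m(k) of the theorem solves it because
R_(m+1)(k+1) = p R_m(k) + a_(m+k+2) ([trace_rhsS], [trace_rhs_unique]).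

Three inputs are needed on the way.

- The character chi does not depend on the value of Q used to define it.  The
  product N of two values of Q satisfies 4 N = x^2 + d D y^2, and quadratic
  reciprocity, obtained from Gauss sums in positive characteristic, shows that
  (D / N) = 1 for such N ([kronecker_norm]).

- Class numbers and stabilizers are finite, by reduction of definite forms.

- The function j is invariant ([jinv_modular]).  This does not require convergence
  of the Eisenstein series: reindexing and rescaling are compatible with the limit
  of the partial sums even when that limit does not exist, since it is then 0. *)

(** * Residues modulo primes and Euler's criterion *)

Lemma finField_prim_root (K : finFieldType) (n : nat) :
  (n %| #|K|.-1)%N -> exists z : K, n.-primitive_root z.
Proof.
move=> n_dvd; set m := #|K|.-1.
have m_gt0 : (0 < m)%N by rewrite /m -subn1 subn_gt0 finNzRing_gt1.
have [||z _ z_prim] := hasP (has_prim_root m_gt0 _ (enum_uniq (predC1 (0 : K))) _); last by exists (z ^+ (m %/ n)); apply: dvdn_prim_root.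
- apply/allP => x; rewrite mem_enum !inE => x_neq0.
  apply/unity_rootP; apply: (mulIf x_neq0).
  by rewrite -exprSr prednK ?expf_card ?mul1r // ltnW // finNzRing_gt1.
- by rewrite -cardE cardC1.
Qed.

(** The field with l ^ totient n elements works, since n divides
l ^ totient n - 1 by Euler's theorem. *)
Lemma exists_prim_root_pchar (l n : nat) : prime l -> coprime l n -> (0 < n)%N ->
  exists K : finFieldType, exists2 z : K, l \in [pchar K] & n.-primitive_root z.
Proof.
move=> l_pr co_ln n_gt0.
have [K charK cardK] := pPrimePowerField l_pr (etrans (totient_gt0 n) n_gt0).
have [|z z_prim] := @finField_prim_root K n; last by exists K; exists z.
rewrite cardK -subn1 -eqn_mod_dvd; last by rewrite expn_gt0 prime_gt0.
by apply/eqP; rewrite Euler_exp_totient.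
Qed.

Lemma kronecker_prime_bound (a : int) (q : nat) : `|kronecker_prime a q| <= 1.
Proof. by rewrite /kronecker_prime; case: (q == 2%N); case: ifP => // _; case: ifP. Qed.

Lemma kronecker_prime_eq0 (a : int) (q : nat) :
  (kronecker_prime a q == 0) = (q%:Z %| a)%Z.
Proof.
rewrite /kronecker_prime; case: (q =P 2%N) => [->|_].
  by case: ifP => // _; case: ifP.
by case: ifP => // _; case: ifP.
Qed.

(** Let b be the class of a, assumed nonzero.  The square of
b ^ ((q - 1) / 2) is 1.  If the power itself is 1, then
the exponent of b with respect to a primitive root is even, so b is a square. *)
Lemma euler_criterion (a : int) (q : nat) : prime q -> odd q ->
  (q%:Z %| kronecker_prime a q - a ^+ q.-1./2)%Z.
Proof.
move=> q_pr q_odd.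
have charF := pchar_Fp q_pr.
have cardF := card_Fp q_pr.
have q_gt2 : (2 < q)%N by case: q q_pr q_odd {charF cardF} => [|[|[|]]].
set h := q.-1./2.
have hE : (h + h = q.-1)%N by rewrite /h; lia.
rewrite (dvdz_pcharf charF) rmorphB rmorphXn /= subr_eq0; set b : 'F_q := a%:~R.
rewrite /kronecker_prime (gtn_eqF q_gt2).
rewrite (dvdz_pcharf charF) -/b; have [b0|b_neq0] := eqVneq b 0.
  have h_gt0 : (0 < h)%N by rewrite /h; lia.
  by rewrite b0 expr0n gtn_eqF.
have fermat (c : 'F_q) : c != 0 -> c ^+ q.-1 = 1.
  move=> c_neq0; apply: (mulIf c_neq0); rewrite -exprSr prednK ?prime_gt0 // mul1r.
  by rewrite -[in X in c ^+ X]cardF expf_card.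
have bX := fermat b b_neq0.
have bXh : (b ^+ h == 1) || (b ^+ h == -1).
  by rewrite -eqf_sqr expr1n -exprM muln2 -addnn hE bX.
case: ifP => [/existsP[x]|nsq].
  rewrite eqz_mod_dvd (dvdz_pcharf charF) rmorphB /= -/b subr_eq0 => /eqP bE.
  rewrite -pmulrn natrX in bE.
  rewrite bE -exprM mul2n -addnn hE fermat ?rmorph1 //.
  by apply: contra_neq b_neq0 => x0; rewrite bE x0 expr0n.
case/orP: bXh => [/eqP bh1|/eqP->]; last by rewrite rmorphN rmorph1.
have [|z z_prim] := @finField_prim_root 'F_q q.-1; first by rewrite cardF.
have [[i /= _] bz] := prim_rootP z_prim bX.
move: bh1; rewrite bz -exprM => /eqP; rewrite -(prim_order_dvd z_prim) -hE addnn -muln2 mulnC.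
rewrite dvdn_pmul2r ?dvdn2; last by case: (h) hE => //; lia.
move=> i_even; move/negbT/negP: nsq; case; apply/existsP.
pose y : 'F_q := z ^+ i./2.
have ylt : (y < q)%N by rewrite -[X in (_ < X)%N](Fp_cast q_pr) ltn_ord.
exists (Ordinal ylt); rewrite eqz_mod_dvd (dvdz_pcharf charF) rmorphB /= -/b bz subr_eq0.
rewrite -pmulrn natrX natr_Zp /y -exprM muln2.
by rewrite even_halfK.
Qed.

Lemma dvdz_small_eq0 (q : nat) (s : int) : (q%:Z %| s)%Z -> `|s| < q%:Z -> s = 0.
Proof.
move=> q_dvd s_lt; apply/eqP; apply: contraTT q_dvd => s_neq0.
rewrite dvdzE; apply/negP => /dvdn_leq; lia.
Qed.

Lemma kronecker_prime2_mod (a : int) :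
  kronecker_prime a 2 = kronecker_prime (a %% 8)%Z 2.
Proof.
rewrite /kronecker_prime /= modz_mod; congr (if _ then _ else _).
by apply/idP/idP; lia.
Qed.

(** For odd q the two sides agree modulo q by Euler's criterion, and they
are too small to differ; for q = 2 only the residues modulo 8 matter. *)
Lemma kronecker_primeM (a b : int) (q : nat) : prime q ->
  kronecker_prime (a * b) q = kronecker_prime a q * kronecker_prime b q.
Proof.
move=> q_pr; have [->|q_odd] := even_prime q_pr.
  rewrite kronecker_prime2_mod -modzMm (kronecker_prime2_mod a) (kronecker_prime2_mod b).
  have : 0 <= (a %% 8)%Z < 8 by lia.
  have : 0 <= (b %% 8)%Z < 8 by lia.
  case: (a %% 8)%Z (b %% 8)%Z => [m|m] [n|n] //.
  by do 8 (case: m => [|m]; first by do 8 (case: n => [|n]; first by []) => //) => //.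
have q_gt2 : (2 < q)%N by case: q q_pr q_odd => [|[|[|]]].
apply/eqP; rewrite -subr_eq0; apply/eqP; apply: (@dvdz_small_eq0 q).
  rewrite (dvdz_pcharf (pchar_Fp q_pr)) rmorphB rmorphM /= subr_eq0.
  have euler c := euler_criterion c q_pr q_odd.
  move: (euler a) (euler b) (euler (a * b)).
  rewrite !(dvdz_pcharf (pchar_Fp q_pr)) !rmorphB !rmorphXn !subr_eq0 /=.
  by move=> /eqP-> /eqP-> /eqP->; rewrite -exprMn -rmorphM.
have := kronecker_prime_bound a q; have := kronecker_prime_bound b q.
have := kronecker_prime_bound (a * b) q.
move: (kronecker_prime _ _) (kronecker_prime _ _) (kronecker_prime _ _) => x y z; nia.
Qed.

Lemma kronecker_prime_mod (a b : int) (q : nat) : odd q ->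
  (q%:Z %| a - b)%Z -> kronecker_prime a q = kronecker_prime b q.
Proof.
move=> q_odd q_dvd; rewrite /kronecker_prime; case: (q =P 2%N) q_odd => [->//|_ _].
have ab : (a %% q = b %% q)%Z by apply/eqP; rewrite eqz_mod_dvd.
by rewrite !(sameP dvdz_mod0P eqP) ab.
Qed.

Lemma kronecker_prime_sqr (a : int) (q : nat) : prime q ->
  ~~ (q%:Z %| a)%Z -> kronecker_prime (a ^+ 2) q = 1.
Proof.
move=> q_pr q_ndvd; rewrite expr2 kronecker_primeM // -expr2.
move: q_ndvd; rewrite -kronecker_prime_eq0.
have := kronecker_prime_bound a q.
move: (kronecker_prime _ _) => x; nia.
Qed.

(** Identities between symbols are proved in a field of odd characteristic
and come back to the integers through this lemma. *)
Lemma pchar_intr_inj (K : nzRingType) (l : nat) (s t : int) :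
  l \in [pchar K] -> (2 < l)%N -> `|s| <= 1 -> `|t| <= 1 ->
  s%:~R = t%:~R :> K -> s = t.
Proof.
move=> charK l_gt2 s1 t1 /eqP; rewrite -subr_eq0 -rmorphB -(dvdz_pcharf charK) => l_dvd.
by apply/eqP; rewrite -subr_eq0; apply/eqP/(dvdz_small_eq0 l_dvd); lia.
Qed.

Lemma euler_in_pchar (K : nzRingType) (l : nat) (a : int) :
  l \in [pchar K] -> odd l ->
  (a%:~R : K) ^+ l.-1./2 = (kronecker_prime a l)%:~R.
Proof.
move=> charK l_odd; have l_pr := pcharf_prime charK.
have := euler_criterion a l_pr l_odd; rewrite (dvdz_pcharf charK).
by rewrite rmorphB rmorphXn subr_eq0 /= => /eqP.
Qed.

(** If z is a primitive eighth root of unity in characteristic q, then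
t = z + z ^- 1 is a square root of 2.  Hence (2 / q) = t ^ (q - 1), and
t ^ q = z ^ q + z ^- q can be compared with t using q modulo 8. *)
Lemma kronecker_prime_2_odd (q : nat) : prime q -> odd q ->
  kronecker_prime 2 q = kronecker_prime q%:Z 2.
Proof.
move=> q_pr q_odd; have q_gt2 : (2 < q)%N by case: q q_pr q_odd => [|[|[|]]].
have co_q8 : coprime q 8 by rewrite (coprime_pexpr _ 2 (isT : 0 < 3)%N) coprimen2.
have [K [z charK z_prim]] := exists_prim_root_pchar q_pr co_q8 isT.
have z4 : z ^+ 4 = -1.
  have := prim_expr_order z_prim; rewrite -[8%N]/(4 * 2)%N exprM.
  move=> /eqP; rewrite sqrf_eq1 -(prim_order_dvd z_prim) /=.
  by move/eqP.
(* z ^+ 7 is the inverse of z *)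
pose t := z + z ^+ 7.
have z8 := prim_expr_order z_prim.
have t2 : t ^+ 2 = 2%:~R.
  have -> : t ^+ 2 = z ^+ 2 * (1 + z ^+ 8 * z ^+ 4) + 2 * z ^+ 8 by rewrite /t; ring.
  by rewrite z8 z4; ring.
have two_neq0 : (2%:~R : K) != 0 by rewrite -(dvdz_pcharf charK) dvdzE /= gtnNdvd.
have t_neq0 : t != 0 by apply: contra_neq two_neq0 => t0; rewrite -t2 t0 expr0n.
apply: (pchar_intr_inj charK q_gt2); rewrite ?kronecker_prime_bound //.
rewrite -(euler_in_pchar _ charK q_odd) -t2 -exprM.
apply: (mulIf t_neq0).
have -> : (2 * q.-1./2 = q.-1)%N by lia.
rewrite -exprSr prednK ?prime_gt0 // -(pFrobenius_autE charK) rmorphD rmorphXn /= !pFrobenius_autE.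
rewrite -exprM.
rewrite -(prim_expr_mod z_prim) -(prim_expr_mod z_prim (q * 7)).
rewrite -modnMml kronecker_prime2_mod modz_nat.
have : odd (q %% 8) by lia.
have : (q %% 8 < 8)%N by lia.
have z12 (k : nat) : z ^+ (k + 4) = - z ^+ k by rewrite exprD z4 mulrN1.
move: (q %% 8)%N => [|[|[|[|[|[|[|[|r]]]]]]]] // _ _; rewrite /kronecker_prime /= /t.
- by rewrite mul1r.
- by rewrite (z12 3) (z12 1); ring.
- by rewrite (z12 3) (z12 1); ring.
- by rewrite mul1r addrC.
Qed.

(** * Gauss sums and quadratic reciprocity *)

Section GaussSum.

Variables (q : nat) (K : fieldType) (z : K).
Hypotheses (q_pr : prime q) (q_odd : odd q) (z_prim : q.-primitive_root z).

Let chi (x : 'F_q) : K := (kronecker_prime (x : nat) q)%:~R.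
Let e (x : 'F_q) : K := z ^+ x.

Lemma val_FpD (x y : 'F_q) : (x + y : 'F_q) = ((x + y)%N %% q)%N :> nat.
Proof. exact: (congr1 (modn (x + y)) (Fp_cast q_pr)). Qed.

Lemma val_FpM (x y : 'F_q) : (x * y : 'F_q) = ((x * y)%N %% q)%N :> nat.
Proof. exact: (congr1 (modn (x * y)) (Fp_cast q_pr)). Qed.

Lemma gauss_additive (x y : 'F_q) : e (x + y) = e x * e y.
Proof. by rewrite /e val_FpD prim_expr_mod // exprD. Qed.

Lemma gauss_char_nat (n : nat) : chi n%:R = (kronecker_prime n q)%:~R.
Proof.
congr (_%:~R); apply: kronecker_prime_mod => //.
by rewrite val_Fp_nat // -eqz_mod_dvd -modz_nat modz_mod.
Qed.

Lemma gauss_charM (x y : 'F_q) : chi (x * y) = chi x * chi y.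
Proof.
rewrite -[x]natr_Zp -[y]natr_Zp -natrM !gauss_char_nat -rmorphM /=.
by rewrite -kronecker_primeM // PoszM.
Qed.

Lemma gauss_char0 : chi 0 = 0.
Proof.
rewrite /chi; suff -> : kronecker_prime (0 : 'F_q) q = 0 by [].
by apply/eqP; rewrite kronecker_prime_eq0 dvdz0.
Qed.

Lemma gauss_char_sqr (x : 'F_q) : x != 0 -> chi x * chi x = 1.
Proof.
move=> x_neq0; rewrite /chi -rmorphM -kronecker_primeM //= -expr2 kronecker_prime_sqr //.
by rewrite (dvdz_pcharf (pchar_Fp q_pr)) -pmulrn natr_Zp.
Qed.

Lemma gauss_charN1 : chi (-1) = (kronecker_prime (-1) q)%:~R.
Proof.
have -> : -1 = (q.-1)%:R :> 'F_q.
  by apply/eqP; rewrite eq_sym -addr_eq0 natr1 prednK ?prime_gt0 // pchar_Fp_0.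
rewrite gauss_char_nat; congr (_%:~R); apply: kronecker_prime_mod => //.
by rewrite opprK -[1]/(1%:Z) -PoszD addn1 prednK ?prime_gt0.
Qed.

Lemma sum_gauss_additive (a : 'F_q) :
  \sum_(x : 'F_q) e (x * a) = if a == 0 then q%:R else 0.
Proof.
have [->|a_neq0] := eqVneq a 0.
  under eq_bigr do rewrite mulr0 /e expr0.
  by rewrite sumr_const card_Fp.
have reindexed : \sum_x e (x * a) = e a * \sum_x e (x * a).
  rewrite [LHS](reindex (+%R 1)) /=; last by apply: onW_bij; by exists (+%R (-1)) => t; [rewrite addKr|rewrite addNKr].
  by rewrite mulr_sumr; apply: eq_bigr => x _; rewrite mulrDl mul1r gauss_additive.
have /eqP : (1 - e a) * \sum_x e (x * a) = 0.
  by rewrite mulrBl mul1r -reindexed subrr.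
rewrite mulf_eq0 subr_eq0 => /orP[/eqP ea1|/eqP->//].
move: a_neq0; rewrite -[a]natr_Zp -(dvdn_pcharf (pchar_Fp q_pr)) (prim_order_dvd z_prim).
by rewrite -/(e a) -ea1 eqxx.
Qed.

(** Multiplying the index by a primitive root, which is a nonresidue,
changes the sign of the sum. *)
Lemma sum_gauss_char : (2%:R : K) != 0 -> \sum_(x : 'F_q) chi x = 0.
Proof.
move=> two_neq0.
have q_gt2 : (2 < q)%N by case: q q_pr q_odd => [|[|[|]]].
have [|r r_prim] := @finField_prim_root 'F_q q.-1; first by rewrite card_Fp.
have charF := pchar_Fp q_pr.
have r_neq0 : r != 0.
  apply/eqP => r0; have := prim_expr_order r_prim.
  by rewrite r0 expr0n gtn_eqF /=; [move/eqP; rewrite eq_sym oner_eq0|lia].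
have chi_r : chi r = -1.
  rewrite /chi; suff -> : kronecker_prime (r : nat) q = -1 by [].
  have : kronecker_prime (r : nat) q ^+ 2 == 1.
    rewrite expr2 -kronecker_primeM // -expr2 kronecker_prime_sqr //.
    by rewrite (dvdz_pcharf charF) -pmulrn natr_Zp.
  rewrite sqrf_eq1 => /orP[/eqP kr1|/eqP//].
  have : r ^+ q.-1./2 = 1.
    by rewrite -[r]natr_Zp pmulrn (euler_in_pchar _ charF q_odd) kr1.
  by move/eqP; rewrite -(prim_order_dvd r_prim) => /dvdn_leq; lia.
have : chi r * \sum_x chi x = \sum_x chi x.
  rewrite mulr_sumr [RHS](reindex ( *%R r)) /=.
    by apply: eq_bigr => x _; rewrite gauss_charM.
  by apply: onW_bij; exists ( *%R r^-1) => x; [rewrite mulKf|rewrite mulVKf].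
rewrite chi_r mulN1r => /eqP; rewrite eq_sym -addr_eq0 -mulr2n -mulr_natl mulf_eq0 (negPf two_neq0).
by move/eqP.
Qed.

(** After the substitution y = x * t in the double sum, summing over all
x gives 0 except for t = -1; the correction at x = 0 is
the sum of chi, which is 0. *)
Lemma sqr_gauss_sum : (2%:R : K) != 0 ->
  (\sum_(x : 'F_q) chi x * e x) ^+ 2 = (kronecker_prime (-1) q * q%:Z)%:~R.
Proof.
move=> two_neq0; rewrite expr2 mulr_suml.
transitivity (\sum_(x : 'F_q | x != 0) \sum_(t : 'F_q) chi t * e (x * (1 + t))).
  rewrite [LHS](bigD1 0) //= gauss_char0 !mul0r add0r; apply: eq_bigr => x x_neq0.
  rewrite mulr_sumr (reindex ( *%R x)) /=; last first.
    by apply: onW_bij; exists ( *%R x^-1) => t; [rewrite mulKf|rewrite mulVKf].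
  apply: eq_bigr => t _; rewrite gauss_charM mulrDr mulr1 gauss_additive.
  by rewrite -[RHS]mul1r -(gauss_char_sqr x_neq0); ring.
rewrite exchange_big /=.
transitivity (\sum_(t : 'F_q) (chi t * (if 1 + t == 0 then q%:R else 0) - chi t)).
  apply: eq_bigr => t _; rewrite -mulr_sumr -sum_gauss_additive [in RHS](bigD1 0) //=.
  by rewrite mul0r /e expr0; ring.
rewrite sumrB sum_gauss_char // subr0 (bigD1 (-1)) //= subrr eqxx gauss_charN1 big1 ?addr0.
  by rewrite rmorphM /= -pmulrn.
move=> t tN1; case: eqP => [/eqP|_]; last by rewrite mulr0.
by rewrite addrC addr_eq0 (negPf tN1).
Qed.

(** The Frobenius map fixes the values of chi, which are integers, and
multiplies the argument of the additive character by l. *)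
Lemma gauss_sum_frobenius (l : nat) : l \in [pchar K] -> l != q ->
  (\sum_(x : 'F_q) chi x * e x) ^+ l
  = (kronecker_prime l q)%:~R * \sum_(x : 'F_q) chi x * e x.
Proof.
move=> charK l_neq_q; have l_pr := pcharf_prime charK.
have lF_neq0 : (l%:R : 'F_q) != 0.
  by rewrite -(dvdn_pcharf (pchar_Fp q_pr)) dvdn_prime2 // eq_sym.
rewrite -(pFrobenius_autE charK) rmorph_sum mulr_sumr [RHS](reindex ( *%R (l%:R : 'F_q))) /=.
  apply: eq_bigr => x _; rewrite rmorphM /= pFrobenius_aut_int pFrobenius_autE -/(chi x).
  rewrite gauss_charM mulrA -gauss_char_nat mulrA gauss_char_sqr // mul1r; congr (_ * _).
  by rewrite /e val_FpM prim_expr_mod // val_Fp_nat // mulnC exprM -!exprM -[RHS](prim_expr_mod z_prim) modnMmr (prim_expr_mod z_prim).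
by apply: onW_bij; exists ( *%R l%:R^-1) => t; [rewrite mulKf|rewrite mulVKf].
Qed.

End GaussSum.

Lemma kronecker_primeN1 (q : nat) : prime q -> odd q ->
  kronecker_prime (-1) q = (-1) ^+ q.-1./2.
Proof.
move=> q_pr q_odd; have q_gt2 : (2 < q)%N by case: q q_pr q_odd => [|[|[|]]].
apply: (pchar_intr_inj (pchar_Fp q_pr) q_gt2); rewrite ?kronecker_prime_bound ?normrX ?normrN1 ?expr1n //.
by rewrite -(euler_in_pchar _ (pchar_Fp q_pr)) // rmorphXn.
Qed.

(** In characteristic p the Gauss sum g satisfies g ^ p = (p / q) g and
g ^ 2 = (-1 / q) q; Euler's criterion evaluates g ^ (p - 1) from the second
identity. *)
Lemma quadratic_reciprocity (p q : nat) : prime p -> prime q -> odd p -> odd q ->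
  p != q ->
  kronecker_prime p q * kronecker_prime q p = (-1) ^+ (p.-1./2 * q.-1./2).
Proof.
move=> p_pr q_pr p_odd q_odd p_neq_q.
have p_gt2 : (2 < p)%N by case: p p_pr p_odd {p_neq_q} => [|[|[|]]].
have q_gt2 : (2 < q)%N by case: q q_pr q_odd {p_neq_q} => [|[|[|]]].
have [|K [z charK z_prim]] := @exists_prim_root_pchar p q p_pr _ (prime_gt0 q_pr).
  by rewrite prime_coprime // dvdn_prime2.
have two_neq0 : (2%:R : K) != 0 by rewrite -(dvdn_pcharf charK) gtnNdvd.
have := gauss_sum_frobenius q_pr q_odd z_prim charK p_neq_q.
have := sqr_gauss_sum q_pr q_odd z_prim two_neq0.
set g := \sum_(x : 'F_q) _ => g2 gp.
have g_neq0 : g != 0.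
  apply/eqP => g0; move/eqP: g2; rewrite g0 expr0n eq_sym -(dvdz_pcharf charK) /=.
  rewrite kronecker_primeN1 // dvdzE abszMsign /= dvdn_prime2 //.
  by rewrite (negPf p_neq_q).
have : kronecker_prime ((-1) ^+ q.-1./2 * q%:Z) p = kronecker_prime p q.
  apply: (pchar_intr_inj charK p_gt2); rewrite ?kronecker_prime_bound //.
  rewrite -(euler_in_pchar _ charK p_odd) -kronecker_primeN1 // -g2 -exprM.
  apply: (mulIf g_neq0); rewrite -gp -exprSr; congr (_ ^+ _); lia.
have kpX k : kronecker_prime ((-1) ^+ k) p = (-1) ^+ (p.-1./2 * k).
  elim: k => [|k IHk]; last first.
    by rewrite exprS kronecker_primeM // IHk kronecker_primeN1 // mulnS exprD.
    have := @kronecker_prime_sqr 1 p p_pr; rewrite expr1n muln0 !expr0; apply.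
  by rewrite dvdz1 gtn_eqF // prime_gt1.
rewrite kronecker_primeM // kpX => <-; rewrite -mulrA -kronecker_primeM // -expr2 kronecker_prime_sqr ?mulr1 //.
by rewrite dvdzE /= dvdn_prime2.
Qed.

(** * The Kronecker symbol *)

Lemma kronecker_natE (a : int) (n : nat) : (0 < n)%N ->
  kronecker a n = \prod_(q <- primes n) kronecker_prime a q ^+ logn q n.
Proof. by case: n => // n _; rewrite /kronecker /= mul1r. Qed.

Lemma kronecker1 (a : int) : kronecker a 1 = 1.
Proof. by rewrite (kronecker_natE a (n := 1)) // big_nil. Qed.

Lemma kronecker_primeE (a : int) (p : nat) : prime p ->
  kronecker a p = kronecker_prime a p.
Proof.
move=> p_pr; rewrite kronecker_natE ?prime_gt0 // primes_prime // big_seq1.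
by rewrite logn_prime // eqxx.
Qed.

(** Both factors are written as products over the primes of m * n, where
the additional primes have exponent 0. *)
Lemma kroneckerMr (a : int) (m n : nat) : (0 < m)%N -> (0 < n)%N ->
  kronecker a (m * n)%N = kronecker a m * kronecker a n.
Proof.
move=> m_gt0 n_gt0.
have extend k l : (0 < k)%N -> (0 < l)%N -> kronecker a k =
    \prod_(q <- primes (k * l)) kronecker_prime a q ^+ logn q k.
  move=> k_gt0 l_gt0; rewrite kronecker_natE //.
  transitivity (\prod_(q <- [seq q <- primes (k * l) | q \in primes k])
    kronecker_prime a q ^+ logn q k).
    apply/perm_big/uniq_perm; rewrite ?filter_uniq ?primes_uniq // => q.
    by rewrite mem_filter primesM //; case: (q \in primes k).
  rewrite big_filter big_mkcond /=; apply: eq_bigr => q _.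
  by case: ifPn => //; rewrite -logn_gt0 lt0n negbK => /eqP->.
rewrite (extend m n) // (extend n m) // (mulnC n m) kronecker_natE ?muln_gt0 ?m_gt0 //.
by rewrite -big_split; apply: eq_bigr => q _; rewrite lognM // exprD.
Qed.

Lemma kroneckerMl (a b : int) (n : nat) : (0 < n)%N ->
  kronecker (a * b) n = kronecker a n * kronecker b n.
Proof.
move=> n_gt0; rewrite !kronecker_natE // -big_split /=.
rewrite big_seq [RHS]big_seq; apply: eq_bigr => q.
by rewrite mem_primes => /andP[q_pr _]; rewrite kronecker_primeM // exprMn.
Qed.

Lemma prime_mul_ind (P : nat -> Prop) :
  P 1 -> (forall p n, prime p -> (0 < n)%N -> P n -> P (p * n)%N) ->
  forall n, (0 < n)%N -> P n.
Proof.
move=> P1 PM n; have [k] := ubnP n; elim: k n => // k IHk n n_lt n_gt0.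
have [n_gt1|] := ltnP 1 n; last by case: n n_gt0 {n_lt} => [|[|]].
have pdvd := pdiv_dvd n; rewrite -(divnK pdvd) mulnC.
have q_gt0 : (0 < n %/ pdiv n)%N by rewrite divn_gt0 ?pdiv_gt0 //; exact: dvdn_leq.
apply: PM => //; first exact: pdiv_prime.
apply: IHk => //; rewrite ltnS in n_lt; apply: leq_trans n_lt; apply: ltn_Pdiv => //.
exact/prime_gt1/pdiv_prime.
Qed.

Lemma kronecker_sqr (a : int) (n : nat) : (0 < n)%N -> coprimez a n ->
  kronecker (a ^+ 2) n = 1.
Proof.
move=> n_gt0 co_an; rewrite kronecker_natE // big_seq big1 // => q.
rewrite mem_primes => /and3P[q_pr _ q_dvd]; rewrite kronecker_prime_sqr ?expr1n //.
apply/negP => q_dvda; have : (q%:Z %| gcdz a n)%Z by rewrite dvdz_gcd q_dvda.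
by rewrite (eqP co_an) dvdz1 gtn_eqF // prime_gt1.
Qed.

Lemma kronecker_quadratic_residue (a x : int) (n : nat) :
  odd n -> coprimez a n -> (a = x ^+ 2 %[mod n])%Z -> kronecker a n = 1.
Proof.
move=> n_odd co_an /eqP; rewrite eqz_mod_dvd => n_dvd.
have n_gt0 : (0 < n)%N by case: n n_odd {co_an n_dvd}.
have q_odd q : (q %| n)%N -> odd q by move=> /dvdnP[k nE]; move: n_odd; rewrite nE oddM => /andP[].
have -> : kronecker a n = kronecker (x ^+ 2) n.
  rewrite !kronecker_natE // big_seq [RHS]big_seq; apply: eq_bigr => q.
  rewrite mem_primes => /and3P[q_pr _ q_dvd]; congr (_ ^+ _).
  apply: kronecker_prime_mod; first exact: q_odd.
  by apply: dvdz_trans n_dvd.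
apply: kronecker_sqr => //; rewrite -(coprimez_pexpl _ _ (isT : 0 < 2)%N) /coprimez.
have -> : gcdz (x ^+ 2) n = gcdz a n by rewrite -gcdz_modl -[RHS]gcdz_modl; congr (gcdz _ _); apply/esym/eqP; rewrite eqz_mod_dvd.
exact: co_an.
Qed.

(** For odd M and N this is (-1) ^ ((M - 1) / 2 * ((N - 1) / 2)). *)
Definition reciprocity_sign (M N : nat) : int :=
  (-1) ^+ ((M %% 4 == 3) && (N %% 4 == 3))%N.

Definition reciprocity_law (M N : nat) : Prop :=
  kronecker M N * kronecker N M = reciprocity_sign M N.

Lemma reciprocity_signC (M N : nat) : reciprocity_sign M N = reciprocity_sign N M.
Proof. by rewrite /reciprocity_sign andbC. Qed.

Lemma reciprocity_signM (M1 M2 N : nat) : odd M1 -> odd M2 ->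
  reciprocity_sign (M1 * M2) N = reciprocity_sign M1 N * reciprocity_sign M2 N.
Proof.
move=> M1_odd M2_odd; rewrite /reciprocity_sign.
have -> : (M1 * M2 %% 4 == 3)%N = (M1 %% 4 == 3)%N (+) (M2 %% 4 == 3)%N.
  rewrite -modnMm; have : odd (M1 %% 4) by lia.
  have : odd (M2 %% 4) by lia.
  have := ltn_pmod M1 (isT : 0 < 4)%N; have := ltn_pmod M2 (isT : 0 < 4)%N.
  by case: (M1 %% 4)%N (M2 %% 4)%N => [|[|[|[|?]]]] [|[|[|[|?]]]].
by case: (M1 %% 4 == 3)%N; case: (M2 %% 4 == 3)%N; case: (N %% 4 == 3)%N.
Qed.

Lemma reciprocity_lawC (M N : nat) : reciprocity_law M N -> reciprocity_law N M.
Proof. by rewrite /reciprocity_law mulrC reciprocity_signC. Qed.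

(** Both symbols and the sign are multiplicative in M, so the law reduces
to primes. *)
Lemma reciprocity_lawM (M1 M2 N : nat) : odd M1 -> odd M2 -> odd N ->
  reciprocity_law M1 N -> reciprocity_law M2 N -> reciprocity_law (M1 * M2) N.
Proof.
move=> M1_odd M2_odd N_odd R1 R2; rewrite /reciprocity_law reciprocity_signM // -R1 -R2.
by rewrite kroneckerMr ?odd_gt0 // PoszM kroneckerMl ?odd_gt0 //; ring.
Qed.

Lemma kronecker_1l (n : nat) : (0 < n)%N -> kronecker 1 n = 1.
Proof. by move=> n_gt0; rewrite -(expr1n _ 2) kronecker_sqr // /coprimez gcd1z. Qed.

Lemma reciprocity_law_of_primes (N : nat) : (0 < N)%N -> odd N ->
  forall M, (0 < M)%N -> (forall p, prime p -> odd p -> (p %| M)%N -> reciprocity_law p N) ->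
  odd M -> reciprocity_law M N.
Proof.
move=> N_gt0 N_odd; apply: prime_mul_ind => [|p n p_pr n_gt0 IHn] law_p.
  by rewrite /reciprocity_law /reciprocity_sign kronecker_1l // kronecker1.
rewrite oddM => /andP[p_odd n_odd]; apply: reciprocity_lawM => //.
  by apply: law_p => //; rewrite dvdn_mulr.
by apply: IHn => // q q_pr q_odd q_dvd; apply: law_p => //; rewrite dvdn_mull.
Qed.

Lemma jacobi_reciprocity (M N : nat) : odd M -> odd N -> coprime M N ->
  reciprocity_law M N.
Proof.
move=> M_odd N_odd co_MN.
apply: reciprocity_law_of_primes; rewrite ?odd_gt0 // => p p_pr p_odd p_dvd.
apply/reciprocity_lawC.
apply: reciprocity_law_of_primes; rewrite ?odd_gt0 // => q q_pr q_odd q_dvd.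
rewrite /reciprocity_law !kronecker_primeE // quadratic_reciprocity //; last first.
  apply: contraTneq co_MN => qp; rewrite -qp in p_dvd.
  apply/negP => /eqP co; have : (q %| gcdn M N)%N by rewrite dvdn_gcd p_dvd.
  by rewrite co dvdn1 gtn_eqF // prime_gt1.
rewrite /reciprocity_sign -signr_odd oddM; congr (_ ^+ (_ && _)); lia.
Qed.

Lemma kronecker_2_reciprocity (M : nat) : odd M -> kronecker M 2%N = kronecker 2 M.
Proof.
move=> M_odd; have := odd_gt0 M_odd => M_gt0; move: M M_gt0 M_odd; apply: prime_mul_ind => [|p n p_pr n_gt0 IHn].
  by rewrite kronecker1 kronecker_1l.
rewrite oddM => /andP[p_odd n_odd].
rewrite (kroneckerMr 2) ?(prime_gt0 p_pr) // PoszM kroneckerMl // IHn //; congr (_ * _).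
rewrite kronecker_primeE //.
by rewrite (kronecker_primeE _ p_pr) kronecker_prime_2_odd.
Qed.

(** The sign is trivial for D = 1 modulo 4, and N may be even because the
law for the prime 2 has no sign at all. *)
Lemma kronecker_reciprocity1 (D N : nat) : (D %% 4 = 1)%N -> (0 < N)%N ->
  coprime D N -> kronecker D N = kronecker N D.
Proof.
move=> D1; have D_odd : odd D by lia.
have D_gt0 := odd_gt0 D_odd.
move: N; apply: prime_mul_ind => [|p n p_pr n_gt0 IHn].
  by rewrite kronecker1 kronecker_1l.
rewrite coprimeMr => /andP[co_p co_n]; rewrite (kroneckerMr D) ?(prime_gt0 p_pr) // PoszM kroneckerMl // IHn //.
congr (_ * _); have [->|p_odd] := even_prime p_pr; first exact: kronecker_2_reciprocity.
have := jacobi_reciprocity D_odd p_odd co_p.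
rewrite /reciprocity_law /reciprocity_sign D1 /= expr0.
have : kronecker p D ^+ 2 = 1.
  by rewrite expr2 -kroneckerMl // -expr2 kronecker_sqr // coprimezE /= coprime_sym.
move: (kronecker _ _) (kronecker _ _) => x y y2 xy.
by rewrite -[x]mulr1 -y2 expr2 mulrA xy mul1r.
Qed.

(** For an odd divisor M of D, 4 N is a square modulo M, so (N / M) = 1 and
reciprocity makes (M / N) a mere sign.  This settles odd D.  If D = 4 D0, the norm
equation restricts N modulo 4 for odd D0, where the sign is then 1, and modulo 8
for D0 = 2 D1, where the sign cancels (2 / N). *)
Lemma kronecker_norm (D : int) (N : nat) (e x y : int) :
  fundamental_discriminant D -> 1 < D -> (0 < N)%N -> coprimez N D ->
  ((- e) %% 4)%Z \in [:: 0; 1] ->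
  4 * N%:Z = x ^+ 2 + e * D * y ^+ 2 ->
  kronecker D N = 1.
Proof.
case: D => // D fD D_gt1 N_gt0 co_ND e01 normN.
have N_mod (M : nat) : odd M -> (M %| D)%N -> kronecker N M = 1.
  move=> M_odd M_dvd; have M_gt0 := odd_gt0 M_odd.
  have co2M : coprimez 2 M by rewrite coprimezE /= coprime2n.
  have coNM : coprimez N M.
    rewrite coprimezE /=; apply: coprime_dvdr M_dvd _.
    by move: co_ND; rewrite coprimezE.
  transitivity (kronecker (2 ^+ 2 * N%:Z) M).
    by rewrite kroneckerMl // kronecker_sqr // mul1r.
  apply: (kronecker_quadratic_residue (x := x)) => //.
    by rewrite coprimezMl coprimezXl //; exact/andP.
  apply/eqP; rewrite eqz_mod_dvd (_ : 2 ^+ 2 = 4) // normN addrC addKr.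
  by apply/dvdz_mulr/dvdz_mull; rewrite dvdzE.
case: fD => [[D1 _]|[[D0|//] DE [D0_23 _]]].
  rewrite kronecker_reciprocity1 //; first by apply: N_mod => //; lia.
    by apply/eqP; lia.
  by move: co_ND; rewrite coprimezE coprime_sym.
have [x' xE] : exists x', x = 2 * x'.
  exists (x %/ 2)%Z.
  suff : ((x ^+ 2) %% 2 = 0)%Z.
    have : (x %% 2 = 0 \/ x %% 2 = 1)%Z by lia.
    by case=> x2; rewrite expr2 -modzMm x2 //; lia.
  have -> : x ^+ 2 = 2 * (2 * N%:Z - 2 * e * D0 * y ^+ 2) by move: normN; rewrite DE; lia.
  by rewrite mulrC modzMl.
have N_odd : odd N.
  apply: contraTT co_ND => N_even; apply/negP => /eqP co.
  have : (2 %| gcdz N D)%Z by rewrite dvdz_gcd DE; lia.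
  by rewrite co.
have co2N : coprimez 2 N by rewrite coprimezE /= coprime2n.
have {}normN : N%:Z = x' ^+ 2 + e * D0 * y ^+ 2.
  move: normN; rewrite xE DE; lia.
have e4 : (e %% 4 = 0 \/ e %% 4 = 3)%Z by move: e01; rewrite !inE; lia.
have sqr4 (a : int) : (a ^+ 2 %% 4 = 0 \/ a ^+ 2 %% 4 = 1)%Z.
  rewrite expr2 -modzMm; have : 0 <= (a %% 4)%Z < 4 by lia.
  by case: (a %% 4)%Z => [[|[|[|[|]]]]|] // _; auto.
have of_reciprocity (M : nat) : odd M -> (M %| D)%N -> kronecker M N = reciprocity_sign M N.
  move=> M_odd M_dvd; rewrite -jacobi_reciprocity ?N_mod ?mulr1 //.
  by rewrite coprime_sym; apply: coprime_dvdr M_dvd _; move: co_ND; rewrite coprimezE.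
have -> : kronecker D N = kronecker D0 N.
  by rewrite DE kroneckerMl // (_ : 4 = 2 ^+ 2) // kronecker_sqr // mul1r.
have yD (M : int) : ((e * M * y ^+ 2)%R %% 4)%Z = (((e %% 4)%Z * (M %% 4)%Z * (y ^+ 2 %% 4)%Z)%R %% 4)%Z.
  by rewrite modzMmr -[RHS]modzMml modzMm modzMml.
have D0_dvd : (D0 %| D)%N by case: DE => ->; rewrite dvdn_mull.
move: D0_23; rewrite !inE => /orP[/eqP D02|/eqP D03]; last first.
  have N1 : (N %% 4 = 1)%N.
    have := yD D0; rewrite D03; have := sqr4 x'.
    by case: e4 => ->; case: (sqr4 y) => -> /=; lia.
  by rewrite of_reciprocity ?/reciprocity_sign ?N1 ?andbF //; lia.
have [D1 D1E] : exists D1 : nat, D0 = (2 * D1)%N by exists (D0 %/ 2)%N; lia.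
have D1_odd : odd D1 by lia.
have D1_dvd : (D1 %| D)%N by apply: dvdn_trans D0_dvd; rewrite D1E dvdn_mull.
have x'1 : (x' ^+ 2 %% 8 = 1)%Z.
  have x'_odd : (x' %% 2 = 1)%Z.
    apply/eqP; apply: contraTT N_odd => x'_even.
    have {}x'_even : (2 %| x')%Z by lia.
    have : (2 %| N%:Z)%Z; last by lia.
    by rewrite normN D1E PoszM; apply: rpredD; [rewrite expr2 dvdz_mulr|apply/dvdz_mulr/dvdz_mull/dvdz_mulr].
  rewrite expr2 -modzMm; have : 0 <= (x' %% 8)%Z < 8 by lia.
  have : ((x' %% 8)%Z %% 2)%Z = 1 by lia.
  by case: (x' %% 8)%Z => [[|[|[|[|[|[|[|[|]]]]]]]]|].
(* N = x' ^ 2 + 2 w with x' odd, so that w modulo 4 gives N modulo 8 *)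
have w4 : let w := ((e * D1 * y ^+ 2) %% 4)%Z in
    w = 0 \/ w = 3 /\ (D1 %% 4 = 1)%N \/ w = 1 /\ (D1 %% 4 = 3)%N.
  rewrite yD modz_nat; have : (D1 %% 4 = 1 \/ D1 %% 4 = 3)%N by move: D1_odd; clear; lia.
  by case=> ->; case: e4 => ->; case: (sqr4 y) => ->; auto.
have {x'1} N8 : (N %% 8 = 1 \/ N %% 8 = 7 /\ D1 %% 4 = 1 \/ N %% 8 = 3 /\ D1 %% 4 = 3)%N.
  have : N%:Z = x' ^+ 2 + 2 * (e * D1 * y ^+ 2) by rewrite normN D1E PoszM; ring.
  move: (e * D1 * y ^+ 2) (x' ^+ 2) x'1 w4 => w x2 x1 /= w4 NE {normN yD sqr4 e4 of_reciprocity N_mod}.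
  case: w4 => [w4|[[w4 D14]|[w4 D14]]]; [left|right; left|right; right]; lia.
rewrite D1E PoszM (_ : 2%N%:Z = 2) // kroneckerMl // of_reciprocity // -(kronecker_2_reciprocity N_odd).
rewrite (@kronecker_primeE N 2) // kronecker_prime2_mod modz_nat /reciprocity_sign.
have -> : (N %% 4 = (N %% 8) %% 4)%N by rewrite modn_dvdm.
by case: N8 => [->|[[-> ->]|[-> ->]]] //; rewrite andbF.
Qed.

(** * Binary quadratic forms under two by two matrices *)

Definition mx2 (R : Type) (x y z t : R) : 'M[R]_2 :=
  \matrix_(i < 2, j < 2)
    if i == 0 :> nat then (if j == 0 :> nat then x else y)
    else (if j == 0 :> nat then z else t).

Lemma mx2E (R : Type) (x y z t : R) :
  (mx2 x y z t 0 0 = x) * (mx2 x y z t 0 1 = y) *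
  (mx2 x y z t 1 0 = z) * (mx2 x y z t 1 1 = t).
Proof. by rewrite !mxE. Qed.

Lemma mx2P (R : Type) (g h : 'M[R]_2) :
  g 0 0 = h 0 0 -> g 0 1 = h 0 1 -> g 1 0 = h 1 0 -> g 1 1 = h 1 1 -> g = h.
Proof.
move=> e00 e01 e10 e11; apply/matrixP => i j.
case: i => [[|[|//]] ilt]; case: j => [[|[|//]] jlt].
- by rewrite (_ : Ordinal ilt = 0) 1?(_ : Ordinal jlt = 0) //; apply/val_inj.
- by rewrite (_ : Ordinal ilt = 0) 1?(_ : Ordinal jlt = 1) //; apply/val_inj.
- by rewrite (_ : Ordinal ilt = 1) 1?(_ : Ordinal jlt = 0) //; apply/val_inj.
- by rewrite (_ : Ordinal ilt = 1) 1?(_ : Ordinal jlt = 1) //; apply/val_inj.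
Qed.

Lemma det_mx2 (R : comNzRingType) (g : 'M[R]_2) :
  \det g = g 0 0 * g 1 1 - g 0 1 * g 1 0.
Proof.
rewrite (expand_det_row _ 0) !big_ord_recl big_ord0 /cofactor !det_mx11 !mxE /=.
rewrite (_ : lift 0 0 = 1) 1?(_ : lift 1 0 = 0); try exact/val_inj.
by rewrite expr0 expr1; ring.
Qed.

Lemma mulmx2E (R : comNzRingType) (g h : 'M[R]_2) i j :
  (g *m h) i j = g i 0 * h 0 j + g i 1 * h 1 j.
Proof.
rewrite mxE !big_ord_recl big_ord0 addr0; congr (_ + g i _ * h _ j); exact/val_inj.
Qed.

Lemma bqfP (P Q : bqf) : qa P = qa Q -> qb P = qb Q -> qc P = qc Q -> P = Q.
Proof. by case: P => ? ? ?; case: Q => ? ? ? /= -> -> ->. Qed.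

Lemma bqf_eval_act (Q : bqf) (g : 'M[int]_2) (x y : int) :
  bqf_eval (bqf_act Q g) x y =
  bqf_eval Q (g 0 0 * x + g 0 1 * y) (g 1 0 * x + g 1 1 * y).
Proof. by rewrite /bqf_act /bqf_eval /=; ring. Qed.

Lemma bqf_actM (Q : bqf) (g h : 'M[int]_2) :
  bqf_act (bqf_act Q g) h = bqf_act Q (g *m h).
Proof. by apply: bqfP; rewrite /bqf_act /bqf_eval /= !mulmx2E; ring. Qed.

Lemma bqf_disc_act (Q : bqf) (g : 'M[int]_2) :
  bqf_disc (bqf_act Q g) = \det g ^+ 2 * bqf_disc Q.
Proof. by rewrite det_mx2 /bqf_act /bqf_disc /bqf_eval /=; ring. Qed.

Definition bqf_scale (k : int) (Q : bqf) : bqf := BQF (k * qa Q) (k * qb Q) (k * qc Q).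

Lemma bqf_act_scale (k : int) (Q : bqf) (g : 'M[int]_2) :
  bqf_act (bqf_scale k Q) g = bqf_scale k (bqf_act Q g).
Proof. by apply: bqfP; rewrite /bqf_act /bqf_scale /bqf_eval /=; ring. Qed.

Lemma bqf_eval_scale (k : int) (Q : bqf) (x y : int) :
  bqf_eval (bqf_scale k Q) x y = k * bqf_eval Q x y.
Proof. by rewrite /bqf_scale /bqf_eval /=; ring. Qed.

Lemma bqf_disc_scale (k : int) (Q : bqf) :
  bqf_disc (bqf_scale k Q) = k ^+ 2 * bqf_disc Q.
Proof. by rewrite /bqf_scale /bqf_disc /=; ring. Qed.

Lemma bqf_scale_inj (k : int) : k != 0 -> injective (bqf_scale k).
Proof.
by move=> k_neq0 P Q [/(mulfI k_neq0) ? /(mulfI k_neq0) ? /(mulfI k_neq0) ?]; apply: bqfP.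
Qed.

Lemma bqf_act_scalar (Q : bqf) (k : int) : bqf_act Q k%:M = bqf_scale (k ^+ 2) Q.
Proof. by apply: bqfP; rewrite /bqf_act /bqf_eval !mxE /=; ring. Qed.

Lemma bqf_act1 (Q : bqf) : bqf_act Q 1%:M = Q.
Proof. by rewrite bqf_act_scalar; apply: bqfP; rewrite /= expr1n mul1r. Qed.

Lemma bqf_actN (Q : bqf) (g : 'M[int]_2) : bqf_act Q (- g) = bqf_act Q g.
Proof. by apply: bqfP; rewrite /bqf_act /bqf_eval !mxE /=; ring. Qed.

Lemma posdef_act (Q : bqf) (g : 'M[int]_2) : \det g != 0 ->
  posdef Q -> posdef (bqf_act Q g).
Proof.
move=> detg posQ x y xy_neq0; rewrite bqf_eval_act; apply: posQ.
apply: contra_neq xy_neq0 => -[e0 e1]; rewrite det_mx2 in detg.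
congr (_, _); apply: (mulfI detg); rewrite mulr0.
  transitivity (g 1 1 * (g 0 0 * x + g 0 1 * y) - g 0 1 * (g 1 0 * x + g 1 1 * y)); first by ring.
  by rewrite e0 e1 !mulr0 subr0.
transitivity (g 0 0 * (g 1 0 * x + g 1 1 * y) - g 1 0 * (g 0 0 * x + g 0 1 * y)); first by ring.
by rewrite e0 e1 !mulr0 subr0.
Qed.

Lemma posdef_scale (k : int) (Q : bqf) : 0 < k -> posdef (bqf_scale k Q) <-> posdef Q.
Proof.
move=> k_gt0; split=> posQ x y xy_neq0; have := posQ x y xy_neq0.
  by rewrite bqf_eval_scale pmulr_rgt0.
by rewrite bqf_eval_scale pmulr_rgt0.
Qed.

Definition adj2 (g : 'M[int]_2) : 'M[int]_2 := mx2 (g 1 1) (- g 0 1) (- g 1 0) (g 0 0).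

Lemma mul_mx_adj2 (g : 'M[int]_2) : g *m adj2 g = (\det g)%:M.
Proof. by apply: mx2P; rewrite mulmx2E !mx2E det_mx2 !mxE /=; ring. Qed.

Lemma mul_adj2_mx (g : 'M[int]_2) : adj2 g *m g = (\det g)%:M.
Proof. by apply: mx2P; rewrite mulmx2E !mx2E det_mx2 !mxE /=; ring. Qed.

Lemma det_adj2 (g : 'M[int]_2) : \det (adj2 g) = \det g.
Proof. by rewrite !det_mx2 !mx2E; ring. Qed.

Lemma adj2K : involutive adj2.
Proof. by move=> g; apply: mx2P; rewrite !mx2E ?opprK. Qed.

Lemma adj2M (g h : 'M[int]_2) : adj2 (g *m h) = adj2 h *m adj2 g.
Proof. by apply: mx2P; rewrite !mx2E !mulmx2E !mx2E; ring. Qed.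

(** * The genus character *)

Lemma Posz_sqr (k : nat) : (k ^ 2)%N%:Z = k%:Z ^+ 2.
Proof. by rewrite -mulnn PoszM. Qed.

(** Multiplicativity of norms: the first term on the right is the square
of the polar form, the second one contains the determinant of the two vectors. *)
Lemma bqf_evalM (Q : bqf) (x y x' y' : int) :
  4 * (bqf_eval Q x y * bqf_eval Q x' y') =
  (2 * qa Q * x * x' + qb Q * (x * y' + x' * y) + 2 * qc Q * y * y') ^+ 2
  - bqf_disc Q * (x * y' - x' * y) ^+ 2.
Proof. by rewrite /bqf_eval /bqf_disc; ring. Qed.

Lemma coprimez_of_primes (m n : int) :
  (forall q, prime q -> (q%:Z %| m)%Z -> (q%:Z %| n)%Z -> False) -> coprimez m n.
Proof.
move=> no_prime; rewrite coprimezE; apply/eqP; set g := gcdn _ _.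
have [g1|g_neq1] := eqVneq g 1%N; first by [].
have [q q_pr q_dvd] : exists2 q, prime q & (q %| g)%N.
  have [g0|g_neq0] := eqVneq g 0%N; first by exists 2%N; rewrite ?g0.
  by exists (pdiv g); [apply: pdiv_prime; lia|apply: pdiv_dvd].
by case: (no_prime q q_pr); rewrite dvdzE; apply: dvdn_trans q_dvd _; rewrite ?dvdn_gcdl ?dvdn_gcdr.
Qed.

Lemma Euclidz_dvdM (q : nat) (m n : int) : prime q ->
  (q%:Z %| m * n)%Z = (q%:Z %| m)%Z || (q%:Z %| n)%Z.
Proof. by move=> q_pr; rewrite !dvdzE abszM Euclid_dvdM. Qed.

Lemma Euclidz_dvdX (q : nat) (m : int) (k : nat) : prime q -> (0 < k)%N ->
  (q%:Z %| m ^+ k)%Z = (q%:Z %| m)%Z.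
Proof. by move=> q_pr k_gt0; rewrite !dvdzE abszX Euclid_dvdX // k_gt0 andbT. Qed.

Definition represents_coprime (D : int) (Q : bqf) : Prop :=
  exists x y : int, coprimez (bqf_eval Q x y) D.

(** Take for x the product of the primes of D that divide a but not c,
and for y the product of those that do not divide a.  At each prime of D exactly one
of the terms a x ^ 2, b x y, c y ^ 2 is a unit. *)
Lemma represents_coprime_gcd (D : int) (Q : bqf) : D != 0 ->
  gcdz (qa Q) (gcdz (qb Q) (gcdz (qc Q) D)) = 1 -> represents_coprime D Q.
Proof.
move=> D_neq0 gcd1.
pose prod_of (P : pred nat) : nat := \prod_(q <- primes `|D|%N | P q) q.
have prod_of_dvd P q : prime q -> (q%:Z %| D)%Z -> (q%:Z %| (prod_of P)%:Z)%Z = P q.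
  move=> q_pr q_dvd; rewrite dvdzE /= /prod_of Euclid_dvd_prod //.
  rewrite big_has_cond; apply/hasP/idP => [[r]|Pq].
    rewrite mem_primes => /and3P[r_pr _ _] /andP[Pr].
    by rewrite dvdn_prime2 // => /eqP->.
  exists q; last by rewrite /= dvdnn andbT.
  by rewrite mem_primes q_pr absz_gt0 D_neq0.
pose x := prod_of [pred q | (q%:Z %| qa Q)%Z && ~~ (q%:Z %| qc Q)%Z].
pose y := prod_of [pred q | ~~ (q%:Z %| qa Q)%Z].
exists x%:Z, y%:Z; apply: coprimez_of_primes => q q_pr q_dvd q_D.
have := prod_of_dvd _ q q_pr q_D; rewrite -/x -/y => dvd.
have q_x : (q%:Z %| x%:Z)%Z = (q%:Z %| qa Q)%Z && ~~ (q%:Z %| qc Q)%Z by rewrite dvd.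
have q_y : (q%:Z %| y%:Z)%Z = ~~ (q%:Z %| qa Q)%Z by rewrite dvd.
(* At a prime q of D, the three cases are q not dividing a, q dividing a but
   not c, and q dividing a and c but not b. *)
have q_not_all : [&& (q%:Z %| qa Q)%Z, (q%:Z %| qb Q)%Z & (q%:Z %| qc Q)%Z] -> False.
  move=> /and3P[qA qB qC].
  have : (q%:Z %| gcdz (qa Q) (gcdz (qb Q) (gcdz (qc Q) D)))%Z by rewrite !dvdz_gcd qA qB qC.
  by rewrite gcd1 dvdz1 gtn_eqF // prime_gt1.
have dvdDl (m n : int) : (q%:Z %| m)%Z -> (q%:Z %| m + n)%Z = (q%:Z %| n)%Z by apply: rpredDl.
have dvdDr (m n : int) : (q%:Z %| n)%Z -> (q%:Z %| m + n)%Z = (q%:Z %| m)%Z by apply: rpredDr.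
have qM := fun m n => Euclidz_dvdM m n q_pr.
have qX m : (q%:Z %| m ^+ 2)%Z = (q%:Z %| m)%Z by rewrite Euclidz_dvdX.
move: q_dvd; rewrite /bqf_eval.
have [qA|qA] := boolP (q%:Z %| qa Q)%Z.
  rewrite qA /= in q_x q_y q_not_all.
  have [qC|qC] := boolP (q%:Z %| qc Q)%Z.
    rewrite qC in q_x q_not_all; rewrite dvdDr ?dvdDl ?qM ?qA ?qC //.
    by rewrite q_x q_y !orbF => qB; apply: q_not_all; rewrite qB.
  rewrite qC /= in q_x.
  by rewrite dvdDl ?dvdDl ?qM ?qX ?qA ?q_x ?q_y ?(negPf qC) ?orbT.
rewrite (negPf qA) /= in q_x q_y.
by rewrite dvdDr ?dvdDr ?qM ?qX ?q_x ?q_y ?(negPf qA) ?orbT.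
Qed.

Lemma represents_coprime_gcd1 (D : int) (Q : bqf) :
  represents_coprime D Q -> gcdz (qa Q) (gcdz (qb Q) (gcdz (qc Q) D)) = 1.
Proof.
move=> [x [y /eqP co]]; set g := gcdz _ _.
have [gA gBCD] : (g %| qa Q)%Z /\ (g %| gcdz (qb Q) (gcdz (qc Q) D))%Z.
  by rewrite dvdz_gcdl dvdz_gcdr.
move: gBCD; rewrite !dvdz_gcd => /and3P[gB gC gD].
have : (g %| gcdz (bqf_eval Q x y) D)%Z.
  by rewrite dvdz_gcd gD andbT /bqf_eval !rpredD // -?mulrA ?dvdz_mulr.
by rewrite co dvdz1 => /eqP g1; rewrite -[LHS]/g -[g]gez0_abs ?g1.
Qed.

Lemma is_discriminant_sqr (k n : int) : is_discriminant n -> is_discriminant (k ^+ 2 * n).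
Proof.
rewrite /is_discriminant -modzMm expr2 -(modzMm k k).
have : 0 <= (k %% 4)%Z < 4 by lia.
have : 0 <= (n %% 4)%Z < 4 by lia.
by case: (n %% 4)%Z => [[|[|[|[|]]]]|] // _; case: (k %% 4)%Z => [[|[|[|[|]]]]|].
Qed.

Lemma forms_act (D : int) (d : nat) (Q : bqf) (g : 'M[int]_2) (k : nat) :
  (0 < k)%N -> \det g = k%:Z -> forms D d Q -> forms D (k ^ 2 * d) (bqf_act Q g).
Proof.
move=> k_gt0 detg [posQ discQ]; split.
  by apply: posdef_act => //; rewrite detg; lia.
by rewrite bqf_disc_act detg discQ PoszM Posz_sqr !mulrN mulrA.
Qed.

Section GenusCharacter.

Variables (D : int) (hD : fundamental_discriminant D) (hD1 : 1 < D).

Lemma forms_chi_cond (d : nat) (Q : bqf) : forms D d Q ->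
  (D %| bqf_disc Q)%Z /\ (bqf_disc Q %/ D)%Z = - d%:Z.
Proof.
move=> [_ ->]; rewrite -mulNr; split; first exact: dvdz_mull.
by rewrite mulzK //; lia.
Qed.

Lemma coprime_eval_gt0 (Q : bqf) (x y : int) : posdef Q ->
  coprimez (bqf_eval Q x y) D -> 0 < bqf_eval Q x y.
Proof.
move=> posQ co; apply: posQ; apply: contraTneq co => -[-> ->].
rewrite /bqf_eval !expr2 !mulr0 !addr0 coprimezE /coprime absz0 gcd0n; lia.
Qed.

(** The product of two values of Q prime to D is a norm in the sense of
[kronecker_norm], so the symbol does not depend on the value chosen by chi. *)
Lemma chi_represents (d : nat) (Q : bqf) (x y : int) :
  is_discriminant (- d%:Z) -> forms D d Q -> coprimez (bqf_eval Q x y) D ->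
  chi D Q = kronecker D (bqf_eval Q x y).
Proof.
move=> d_disc FQ co; have [D_dvd quo] := forms_chi_cond FQ.
have rep : represents_coprime D Q by exists x, y.
rewrite /chi asboolT; last first.
  split=> //; last exact: represents_coprime_gcd1.
  rewrite quo; move: d_disc; rewrite /is_discriminant !inE => /orP[/eqP d4|/eqP d4].
    by exists 0; rewrite d4.
  by exists 1; rewrite d4.
set nu := xget _ _.
have [co_nu [x' [y' nuE]]] : coprimez nu D /\ exists x y : int, bqf_eval Q x y = nu.
  by apply: (@xgetPex _ 1 [set nu : int | coprimez nu D /\ exists x y : int, bqf_eval Q x y = nu]%classic); exists (bqf_eval Q x y); split=> //; exists x, y.
have nu_gt0 : 0 < nu by rewrite -nuE (coprime_eval_gt0 FQ.1) // nuE.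
have ev_gt0 := coprime_eval_gt0 FQ.1 co.
move: (bqf_evalM Q x y x' y'); rewrite nuE FQ.2.
case: nu co_nu nu_gt0 {nuE} => // m co_m m_gt0.
case: (bqf_eval Q x y) co ev_gt0 => // n co_n n_gt0; rewrite -PoszM mulNr opprK => nm.
have co_nm : coprimez (n * m)%N D.
  by move: co_m co_n; rewrite !coprimezE /= coprimeMl => -> ->.
have := kronecker_norm hD hD1 _ co_nm _ nm; rewrite muln_gt0 (n_gt0 : (0 < n)%N) (m_gt0 : (0 < m)%N).
move=> /(_ isT) /(_ d_disc); rewrite kroneckerMr // => nm1.
have : kronecker D n ^+ 2 = 1.
  by rewrite expr2 -kroneckerMl // -expr2 kronecker_sqr // coprimezE coprime_sym -coprimezE.
move=> n2; rewrite -[LHS]mul1r -n2 expr2 -mulrA nm1 mulr1 //.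
Qed.

Lemma chi_not_represents (Q : bqf) : ~ represents_coprime D Q -> chi D Q = 0.
Proof.
move=> nrep; rewrite /chi asboolF // => -[_ _ gcd1]; apply: nrep.
by apply: represents_coprime_gcd => //; lia.
Qed.

Lemma chi_not_discriminant (d : nat) (Q : bqf) :
  ~~ is_discriminant (- d%:Z) -> forms D d Q -> chi D Q = 0.
Proof.
move=> nd FQ; have [_ quo] := forms_chi_cond FQ.
rewrite /chi asboolF // => -[_ [x]]; rewrite quo => dx _; case/negP: nd.
rewrite /is_discriminant dx -[_ ^+ 2]mulr1; exact: (@is_discriminant_sqr x 1).
Qed.

Lemma represents_coprime_act (Q : bqf) (g : 'M[int]_2) :
  represents_coprime D (bqf_act Q g) -> represents_coprime D Q.
Proof. by case=> x [y]; rewrite bqf_eval_act => co; eexists; eexists; exact: co. Qed.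

Lemma represents_coprime_scale (k : int) (Q : bqf) : coprimez k D ->
  represents_coprime D (bqf_scale k Q) <-> represents_coprime D Q.
Proof.
move=> co_k; split=> -[x [y co]]; exists x, y; move: co.
  by rewrite bqf_eval_scale coprimezMl => /andP[].
by rewrite bqf_eval_scale coprimezMl co_k.
Qed.

(** Values of the transformed form are values of Q.  Conversely the adjugate
of g leads from it back to k ^ 2 Q, so that one form represents an integer prime to D
as soon as the other does. *)
Lemma chi_act (d : nat) (Q : bqf) (g : 'M[int]_2) (k : nat) :
  is_discriminant (- d%:Z) -> (0 < k)%N -> coprimez k D -> \det g = k%:Z ->
  forms D d Q -> chi D (bqf_act Q g) = chi D Q.
Proof.
move=> d_disc k_gt0 co_k detg FQ.
have FQg := forms_act k_gt0 detg FQ.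
have [[x [y co]]|nrep] := pselect (represents_coprime D (bqf_act Q g)).
  rewrite (chi_represents _ FQg co); last first.
    by rewrite PoszM -mulrN Posz_sqr; apply: is_discriminant_sqr.
  by rewrite bqf_eval_act in co *; rewrite (chi_represents d_disc FQ co).
rewrite !chi_not_represents // => repQ; apply: nrep.
apply: (@represents_coprime_act _ (adj2 g)).
rewrite bqf_actM mul_mx_adj2 detg bqf_act_scalar represents_coprime_scale //.
by rewrite coprimezXl.
Qed.

Lemma chi_scale (d : nat) (Q : bqf) (k : nat) :
  is_discriminant (- d%:Z) -> (0 < k)%N -> coprimez k D ->
  forms D d Q -> chi D (bqf_scale k Q) = kronecker D k * chi D Q.
Proof.
move=> d_disc k_gt0 co_k FQ.
have [[x [y co]]|nrep] := pselect (represents_coprime D Q); last first.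
  by rewrite !chi_not_represents ?mulr0 // represents_coprime_scale.
have FkQ : forms D (k ^ 2 * d) (bqf_scale k Q).
  split; first by apply/posdef_scale; [lia|case: FQ].
  by rewrite bqf_disc_scale FQ.2 PoszM Posz_sqr !mulrN mulrA.
have cok : coprimez (bqf_eval (bqf_scale k Q) x y) D by rewrite bqf_eval_scale coprimezMl co_k.
rewrite (chi_represents _ FkQ cok); last first.
  by rewrite PoszM -mulrN Posz_sqr; apply: is_discriminant_sqr.
rewrite (chi_represents d_disc FQ co) bqf_eval_scale.
have ev_gt0 := coprime_eval_gt0 FQ.1 co.
by case: (bqf_eval Q x y) ev_gt0 => // n n_gt0; rewrite -PoszM kroneckerMr.
Qed.

End GenusCharacter.

(** * Reduction of definite forms and finiteness *)
Local Open Scope classical_set_scope.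

Lemma finite_int_bounded (B : int) : finite_set [set x : int | `|x| <= B].
Proof.
apply: (@sub_finite_set _ _ ((Posz @` `I_(`|B|%N.+1)) `|` ((fun n => - n%:Z) @` `I_(`|B|%N.+1)))).
  move=> [n|n] /= nB; [left; exists n => //|right; exists n.+1 => //] => /=; lia.
by rewrite finite_setU; split; apply: finite_image; exact: finite_II.
Qed.

Lemma finite_mx2_bounded (B : int) :
  finite_set [set g : 'M[int]_2 | [/\ `|g 0 0| <= B, `|g 0 1| <= B, `|g 1 0| <= B & `|g 1 1| <= B]].
Proof.
pose I := [set x : int | `|x| <= B].
apply: (@sub_finite_set _ _ ((fun v : int * int * (int * int) => mx2 v.1.1 v.1.2 v.2.1 v.2.2) @`
   ((I `*` I) `*` (I `*` I)))).
  move=> g [g00 g01 g10 g11]; exists (g 0 0, g 0 1, (g 1 0, g 1 1)) => //=.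
  by apply: mx2P; rewrite !mx2E.
by apply: finite_image; do !apply: finite_setX; exact: finite_int_bounded.
Qed.

Lemma finite_bqf_bounded (B : int) :
  finite_set [set Q : bqf | [/\ `|qa Q| <= B, `|qb Q| <= B & `|qc Q| <= B]].
Proof.
pose I := [set x : int | `|x| <= B].
apply: (@sub_finite_set _ _ ((fun v : int * int * int => BQF v.1.1 v.1.2 v.2) @` ((I `*` I) `*` I))).
  by move=> [a b c] [/= ? ? ?]; exists (a, b, c).
by apply: finite_image; do !apply: finite_setX; exact: finite_int_bounded.
Qed.

Lemma posdef_qa (Q : bqf) : posdef Q -> 0 < qa Q.
Proof.
by move=> /(_ 1 0 isT); rewrite /bqf_eval !expr2; lia.
Qed.

Lemma posdef_qc (Q : bqf) : posdef Q -> 0 < qc Q.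
Proof.
by move=> /(_ 0 1 isT); rewrite /bqf_eval !expr2; lia.
Qed.

Lemma posdef_disc (Q : bqf) : posdef Q -> bqf_disc Q < 0.
Proof.
move=> posQ; have a_gt0 := posdef_qa posQ.
have := posQ (- qb Q) (2 * qa Q); rewrite /bqf_eval /bqf_disc.
have -> : (- qb Q, 2 * qa Q) != (0, 0) by apply/eqP => -[_]; lia.
by move=> /(_ isT); nia.
Qed.

(** Complete the square, using that minus the discriminant is at least 1. *)
Lemma posdef_eval_bound (Q : bqf) (x y : int) : posdef Q ->
  `|x| <= 4 * qc Q * bqf_eval Q x y /\ `|y| <= 4 * qa Q * bqf_eval Q x y.
Proof.
move=> posQ; have := posdef_disc posQ.
have cQ : 4 * qc Q * bqf_eval Q x y = (2 * qc Q * y + qb Q * x) ^+ 2 - bqf_disc Q * x ^+ 2.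
  by rewrite /bqf_eval /bqf_disc; ring.
have aQ : 4 * qa Q * bqf_eval Q x y = (2 * qa Q * x + qb Q * y) ^+ 2 - bqf_disc Q * y ^+ 2.
  by rewrite /bqf_eval /bqf_disc; ring.
rewrite cQ aQ; move: (_ * y + _) (_ * x + _) (bqf_disc Q) => u v e e_lt0.
have := sqr_ge0 u; have := sqr_ge0 v; split; nia.
Qed.

(** The columns of g are vectors where Q takes the outer coefficients of Q' as
values, and a definite form takes each value finitely often. *)
Lemma finite_hom (Q Q' : bqf) : posdef Q -> finite_set [set g | bqf_act Q g = Q'].
Proof.
move=> posQ; pose B := 4 * (qa Q + qc Q) * (`|qa Q'| + `|qc Q'|).
apply: sub_finite_set (finite_mx2_bounded B) => g /= gQ.
have := posdef_qa posQ; have := posdef_qc posQ => c_gt0 a_gt0.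
have [b1 b2] := posdef_eval_bound (g 0 0) (g 1 0) posQ.
have [b3 b4] := posdef_eval_bound (g 0 1) (g 1 1) posQ.
have eA : bqf_eval Q (g 0 0) (g 1 0) = qa Q' by rewrite -gQ.
have eC : bqf_eval Q (g 0 1) (g 1 1) = qc Q' by rewrite -gQ.
have le_B k w : 0 < k -> k <= qa Q + qc Q -> w <= `|qa Q'| + `|qc Q'| -> 4 * k * w <= B.
  move=> k_gt0 k_le w_le; apply: le_trans (ler_wpM2l (_ : 0 <= 4 * k) w_le) _; first by lia.
  by apply: ler_wpM2r; [rewrite addr_ge0|lia].
by split; [move: b1|move: b3|move: b2|move: b4] => /le_trans; apply; apply: le_B; lia.
Qed.

Lemma SL2Z_1 : SL2Z 1%:M. Proof. by rewrite /SL2Z /= det1. Qed.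

Lemma SL2Z_M (g h : 'M[int]_2) : SL2Z g -> SL2Z h -> SL2Z (g *m h).
Proof. by rewrite /SL2Z /= det_mulmx => -> ->; rewrite mulr1. Qed.

Lemma SL2Z_adj (g : 'M[int]_2) : SL2Z g -> SL2Z (adj2 g).
Proof. by rewrite /SL2Z /= det_adj2. Qed.

Lemma SL2Z_adjK (g : 'M[int]_2) : SL2Z g -> adj2 g *m g = 1%:M.
Proof. by rewrite /SL2Z /= mul_adj2_mx => ->. Qed.

Lemma SL2Z_Kadj (g : 'M[int]_2) : SL2Z g -> g *m adj2 g = 1%:M.
Proof. by rewrite /SL2Z /= mul_mx_adj2 => ->. Qed.

Lemma bqf_class_refl (Q : bqf) : bqf_class Q Q.
Proof. by exists 1%:M; [exact: SL2Z_1|rewrite bqf_act1]. Qed.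

Lemma bqf_class_sym (Q Q' : bqf) : bqf_class Q Q' -> bqf_class Q' Q.
Proof.
move=> [g Gg <-]; exists (adj2 g); first exact: SL2Z_adj.
by rewrite bqf_actM SL2Z_Kadj // bqf_act1.
Qed.

Lemma bqf_class_trans (Q1 Q2 Q3 : bqf) :
  bqf_class Q1 Q2 -> bqf_class Q2 Q3 -> bqf_class Q1 Q3.
Proof.
by move=> [g Gg <-] [h Gh <-]; exists (g *m h); [exact: SL2Z_M|rewrite bqf_actM].
Qed.

Lemma bqf_class_eq (Q Q' : bqf) : bqf_class Q Q' -> bqf_class Q = bqf_class Q'.
Proof.
move=> QQ'; apply/seteqP; split=> Q''; apply: bqf_class_trans => //.
exact: bqf_class_sym.
Qed.

(** The inversion lowers a when c < a, and a translation lowers |b| when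
a < |b|; so induct on a + |b|. *)
Lemma bqf_reduction (Q : bqf) : posdef Q ->
  exists2 Q', bqf_class Q Q' & `|qb Q'| <= qa Q' <= qc Q'.
Proof.
have [n] := ubnP (`|qa Q| + `|qb Q|)%N; elim: n Q => // n IHn Q Q_lt posQ.
have a_gt0 := posdef_qa posQ; have c_gt0 := posdef_qc posQ.
have step g : SL2Z g -> (`|qa (bqf_act Q g)| + `|qb (bqf_act Q g)| < `|qa Q| + `|qb Q|)%N ->
    exists2 Q', bqf_class Q Q' & `|qb Q'| <= qa Q' <= qc Q'.
  move=> Gg lt; have lt_n : (`|qa (bqf_act Q g)| + `|qb (bqf_act Q g)| < n)%N.
    by apply: leq_trans lt _; rewrite -ltnS.
  have posQg : posdef (bqf_act Q g) by apply: posdef_act => //; rewrite (Gg : \det g = 1).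
  have [Q' QQ' red] := IHn _ lt_n posQg.
  by exists Q' => //; apply: bqf_class_trans QQ'; exists g.
have [ca|ac] := ltP (qc Q) (qa Q).
  apply: (step (mx2 0 (-1) 1 0)); first by rewrite /SL2Z /= det_mx2 !mx2E.
  rewrite /bqf_act /bqf_eval !mx2E /= !expr2; lia.
have [ab|ba] := ltP (qa Q) `|qb Q|; last by exists Q; [exact: bqf_class_refl|rewrite ba].
have [b_ge0|b_lt0] := leP 0 (qb Q).
  apply: (step (mx2 1 (-1) 0 1)); first by rewrite /SL2Z /= det_mx2 !mx2E.
  rewrite /bqf_act /bqf_eval !mx2E /= !expr2; lia.
apply: (step (mx2 1 1 0 1)); first by rewrite /SL2Z /= det_mx2 !mx2E.
rewrite /bqf_act /bqf_eval !mx2E /= !expr2; lia.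
Qed.

(** A reduced form has b ^ 2 <= a c, hence 3 a c is at most minus the
discriminant. *)
Lemma finite_classes (D : int) (d : nat) : 0 < D -> (0 < d)%N ->
  finite_set [set bqf_class Q | Q in forms D d].
Proof.
move=> D_gt0 d_gt0.
pose B := d%:Z * D.
apply: (@sub_finite_set _ _ (bqf_class @` [set Q : bqf | [/\ `|qa Q| <= B, `|qb Q| <= B & `|qc Q| <= B]])).
  move=> X [Q [posQ discQ] <-]; have [Q' QQ' red] := bqf_reduction posQ.
  exists Q'; last by rewrite (bqf_class_eq QQ').
  have : bqf_disc Q' = - B by case: QQ' => g Gg <-; rewrite bqf_disc_act (Gg : \det g = 1) expr1n mul1r.
  rewrite /bqf_disc; case: Q' red {QQ'} => a b c /= /andP[ba ac] disc.
  have B_gt0 : 0 < B by rewrite mulr_gt0.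
  have a_gt0 : 0 < a.
    have : 0 <= a by lia.
    rewrite le_eqVlt => /orP[/eqP a0|//]; move: disc B_gt0.
    have -> : b = 0 by lia.
    by rewrite -a0; lia.
  have b2 : b ^+ 2 <= a * c.
    apply: (@le_trans _ _ (a * a)); last by rewrite ler_wpM2l // ltW.
    by rewrite -[b ^+ 2]ger0_norm ?sqr_ge0 // normrX expr2 ler_pM.
  have cac : c <= a * c by rewrite -[X in X <= _]mul1r ler_wpM2r //; lia.
  have {disc} acB : a * c <= B by move: disc b2; rewrite -mulrA; lia.
  by split; lia.
by apply: finite_image; exact: finite_bqf_bounded.
Qed.

(** * Weighted counting of classes of forms *)

(** For M = SL2Z and Q = Q' this is the order of the stabilizer in SL2(Z), and not
in its quotient by -1. *)
Definition hom_count (M : set 'M[int]_2) (Q Q' : bqf) : nat :=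
  #|` fset_set [set g | M g /\ bqf_act Q g = Q']|.

Notation aut_count Q := (hom_count SL2Z Q Q).

Lemma finite_homM (M : set 'M[int]_2) (Q Q' : bqf) : posdef Q ->
  finite_set [set g | M g /\ bqf_act Q g = Q'].
Proof. by move=> posQ; apply: sub_finite_set (finite_hom Q' posQ) => g []. Qed.

Lemma card_fset_set_image (T U : choiceType) (f : T -> U) (A : set T) :
  finite_set A -> injective f -> #|` fset_set (f @` A)| = #|` fset_set A|.
Proof. by move=> finA f_inj; rewrite fset_set_image // card_imfset. Qed.

Lemma mulmx_det_inj (g : 'M[int]_2) : \det g != 0 -> injective (fun h : 'M[int]_2 => g *m h).
Proof.
move=> detg h1 h2 /(congr1 (mulmx (adj2 g))); rewrite !mulmxA mul_adj2_mx !mul_scalar_mx.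
move/matrixP => e; apply/matrixP => i j; have := e i j.
by rewrite !mxE => /(mulfI detg).
Qed.

Lemma hom_count_equiv (Q Q' : bqf) : posdef Q -> bqf_class Q Q' ->
  hom_count SL2Z Q Q' = aut_count Q'.
Proof.
move=> posQ [g0 Gg0 gQ]; rewrite /hom_count.
have posQ' : posdef Q' by rewrite -gQ; apply: posdef_act => //; rewrite (Gg0 : \det g0 = 1).
rewrite -(@card_fset_set_image _ _ (mulmx g0) [set g | SL2Z g /\ bqf_act Q' g = Q']); first last.
- by apply: mulmx_det_inj; rewrite (Gg0 : \det g0 = 1).
- exact: finite_homM.
congr (#|` fset_set _|); apply/seteqP; split=> g /=.
  move=> [Gg QgQ']; exists (adj2 g0 *m g); last by rewrite mulmxA SL2Z_Kadj // mul1mx.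
  split; first by apply: SL2Z_M => //; apply: SL2Z_adj.
  by rewrite -bqf_actM (_ : bqf_act Q' _ = Q) // -gQ bqf_actM SL2Z_Kadj // bqf_act1.
move=> [h [Gh hQ'] <-]; split; first exact: SL2Z_M.
by rewrite -bqf_actM gQ.
Qed.

Lemma hom_count_not_equiv (Q Q' : bqf) : ~ bqf_class Q Q' -> hom_count SL2Z Q Q' = 0%N.
Proof.
move=> nQQ'; rewrite /hom_count (_ : [set g | _] = set0) ?fset_set0 ?cardfs0 //.
by apply/seteqP; split=> // g [Gg gQ]; case: nQQ'; exists g.
Qed.

Lemma aut_count_gt0 (Q : bqf) : posdef Q -> (0 < aut_count Q)%N.
Proof.
move=> posQ; rewrite cardfs_gt0; apply/fset0Pn; exists 1%:M.
rewrite in_fset_set ?inE; last exact: finite_homM.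
by split; [exact: SL2Z_1|rewrite bqf_act1].
Qed.

Lemma aut_count_class (Q Q' : bqf) : posdef Q -> bqf_class Q Q' -> aut_count Q = aut_count Q'.
Proof.
move=> posQ QQ'; have := QQ'; move=> [g0 Gg0 gQ]; rewrite -(hom_count_equiv posQ QQ').
have posQ' : posdef Q' by rewrite -gQ; apply: posdef_act => //; rewrite (Gg0 : \det g0 = 1).
rewrite /hom_count.
rewrite -(@card_fset_set_image _ _ (mulmxr g0) [set g | SL2Z g /\ bqf_act Q g = Q]); first last.
- move=> h1 h2 /= /(congr1 (mulmxr (adj2 g0))) /=; rewrite -!mulmxA.
  by rewrite SL2Z_Kadj // !mulmx1.
- exact: finite_homM.
congr (#|` fset_set _|); apply/seteqP; split=> g /=.
  move=> [h [Gh hQ] <-]; split; first exact: SL2Z_M.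
  by rewrite -bqf_actM hQ.
move=> [Gg QgQ']; exists (g *m adj2 g0); last by rewrite -mulmxA SL2Z_adjK // mulmx1.
split; first by apply: SL2Z_M => //; apply: SL2Z_adj.
by rewrite -bqf_actM QgQ' -gQ bqf_actM SL2Z_Kadj // bqf_act1.
Qed.

Lemma aut_count_scale (k : int) (Q : bqf) : k != 0 -> aut_count (bqf_scale k Q) = aut_count Q.
Proof.
move=> k_neq0; rewrite /hom_count; congr (#|` fset_set _|); apply/seteqP; split=> g /= [Gg].
  by rewrite bqf_act_scale => /(bqf_scale_inj k_neq0).
by rewrite bqf_act_scale => ->.
Qed.

(** The fibres of g |-> {g, -g} have two elements, since g = -g would force
g = 0. *)
Lemma aut_count_stab (Q : bqf) : posdef Q ->
  aut_count Q = (2 * #|` fset_set (bqf_stab Q)|)%N.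
Proof.
move=> posQ; rewrite /hom_count /bqf_stab; set A := [set g | _].
have finA : finite_set A by exact: finite_homM.
pose f (g : 'M[int]_2) : set 'M[int]_2 := [set g; - g].
rewrite fset_set_image // -/f.
have AN g : g \in fset_set A -> - g \in fset_set A.
  rewrite !in_fset_set // !inE => -[Gg gQ]; split; last by rewrite bqf_actN.
  by move: Gg; rewrite /SL2Z /= !det_mx2 !mxE => <-; ring.
have f_eq g h : (f g == f h) = (g == h) || (g == - h).
  apply/eqP/orP => [fgh|[/eqP->//|/eqP->]].
    have : f g g by left.
    by rewrite fgh => -[->|->]; [left|right].
  by rewrite /f opprK setUC.
have neqN g : g \in fset_set A -> g != - g.
  rewrite in_fset_set // inE => -[Gg _]; apply/eqP => gN.
  move: Gg; rewrite /SL2Z /= det_mx2.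
  have e i j : g i j = 0 by have := congr1 (fun h : 'M[int]_2 => h i j) gN; rewrite /= !mxE; move: (g i j) => x; lia.
  by rewrite !e.
rewrite -!sum1_size big_distrr /=.
have -> : (\sum_(g <- fset_set A) 1 =
    \sum_(g <- fset_set A) \sum_(X <- f @` fset_set A) (X == f g))%N%fset.
  rewrite big_seq [RHS]big_seq; apply: eq_bigr => g gA.
  rewrite (bigD1_seq (f g)) ?fset_uniq //=; last by apply/imfsetP; exists g.
  by rewrite eqxx big1 ?addn0 // => X /negPf->.
rewrite exchange_big /= big_seq [RHS]big_seq; apply: eq_bigr => X.
move=> /imfsetP[/= g gA ->].
have sum_pred1 h : h \in fset_set A -> (\sum_(i <- fset_set A) (i == h) = 1)%N.
  move=> hA; rewrite (bigD1_seq h) ?fset_uniq //= eqxx big1 // => i /negPf->.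
  by [].
transitivity (\sum_(i <- fset_set A) ((i == g) + (i == - g)))%N; last first.
  by rewrite big_split /= !sum_pred1 // AN.
apply: eq_bigr => h _ /=; rewrite f_eq [g == h]eq_sym -eqr_oppLR [- g == h]eq_sym.
by case: (h =P g) => [->|//]; rewrite (negPf (neqN g gA)).
Qed.

(** Representatives are kept in a list, so that sums over classes become
ordinary finite sums that can be exchanged and reindexed. *)
Record bqf_transversal (Y : set bqf) (s : seq bqf) : Prop := BqfTransversal {
  bqf_transversal_sub : forall Q, Q \in s -> Y Q;
  bqf_transversal_uniq : uniq s;
  bqf_transversal_inj : forall Q Q', Q \in s -> Q' \in s -> bqf_class Q Q' -> Q = Q';
  bqf_transversal_surj : forall Q, Y Q -> exists2 Q', Q' \in s & bqf_class Q Q' }.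

Lemma bqf_transversal_scale (Y : set bqf) (s : seq bqf) (k : int) : k != 0 ->
  bqf_transversal Y s -> bqf_transversal (bqf_scale k @` Y) (map (bqf_scale k) s).
Proof.
move=> k_neq0 [s_sub s_uniq s_inj s_surj].
have class_scale Q Q' : bqf_class (bqf_scale k Q) (bqf_scale k Q') -> bqf_class Q Q'.
  by move=> [g Gg]; rewrite bqf_act_scale => /(bqf_scale_inj k_neq0); exists g.
split.
- by move=> _ /mapP[Q Qs ->]; exists Q => //; apply: s_sub.
- by rewrite map_inj_uniq //; exact: bqf_scale_inj.
- move=> _ _ /mapP[Q Qs ->] /mapP[Q' Qs' ->] /class_scale QQ'.
  by rewrite (s_inj Q Q').
- move=> _ [Q YQ <-]; have [Q' Q's [g Gg gQ]] := s_surj Q YQ.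
  exists (bqf_scale k Q'); first exact: map_f.
  by exists g => //; rewrite bqf_act_scale gQ.
Qed.

Section Sums.
Variable F : numFieldType.

Definition class_invariant (Y : set bqf) (h : bqf -> F) : Prop :=
  forall Q Q', Y Q -> bqf_class Q Q' -> h Q = h Q'.

(** Writing h Q as a sum over all representatives is what allows the
order of two sums over classes to be exchanged. *)
Lemma bqf_transversal_sum1 (Y : set bqf) (s : seq bqf) (h : bqf -> F) (Q : bqf) :
  bqf_transversal Y s -> class_invariant Y h -> Y Q ->
  \sum_(Q' <- s) (if `[< bqf_class Q Q' >] then h Q' else 0) = h Q.
Proof.
move=> [s_sub s_uniq s_inj s_surj] h_inv YQ.
have [Q1 Q1s QQ1] := s_surj Q YQ.
rewrite (bigD1_seq Q1) //= asboolT // big_seq_cond big1 ?addr0; first exact/esym/h_inv.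
move=> Q' /andP[Q's Q'neq]; rewrite asboolF // => QQ'.
by move/eqP: Q'neq; apply; apply: s_inj => //; apply: bqf_class_trans QQ1; exact: bqf_class_sym.
Qed.

Lemma bqf_transversal_sum0 (Y : set bqf) (s : seq bqf) (h : bqf -> F) (Q : bqf) :
  bqf_transversal Y s -> (forall Q Q', Y Q -> bqf_class Q Q' -> Y Q') -> ~ Y Q ->
  \sum_(Q' <- s) (if `[< bqf_class Q Q' >] then h Q' else 0) = 0.
Proof.
move=> [s_sub s_uniq s_inj s_surj] Y_inv nYQ.
rewrite big_seq big1 // => Q' Q's; rewrite asboolF // => QQ'; apply: nYQ.
by apply: Y_inv (s_sub _ Q's) _; exact: bqf_class_sym.
Qed.

Lemma bqf_transversal_sum_eq (Y : set bqf) (s s' : seq bqf) (h : bqf -> F) :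
  bqf_transversal Y s -> bqf_transversal Y s' -> class_invariant Y h ->
  \sum_(Q <- s) h Q = \sum_(Q <- s') h Q.
Proof.
move=> ts ts' h_inv.
transitivity (\sum_(Q <- s) \sum_(Q' <- s') (if `[< bqf_class Q Q' >] then h Q' else 0)).
  rewrite big_seq [RHS]big_seq; apply: eq_bigr => Q Qs.
  by rewrite (bqf_transversal_sum1 ts') //; exact: (bqf_transversal_sub ts).
rewrite exchange_big /= big_seq [RHS]big_seq; apply: eq_bigr => Q' Q's.
have YQ' := bqf_transversal_sub ts' Q's.
rewrite -[RHS](bqf_transversal_sum1 ts h_inv YQ') big_seq [RHS]big_seq; apply: eq_bigr => Q Qs.
have -> : `[< bqf_class Q Q' >] = `[< bqf_class Q' Q >].
  by apply/asboolP/asboolP => ?; exact: bqf_class_sym.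
by case: asboolP => // /h_inv ->.
Qed.

Record coset_reps (M : set 'M[int]_2) (hs : seq 'M[int]_2) : Prop := CosetReps {
  coset_reps_sub : forall m, m \in hs -> M m;
  coset_reps_uniq : uniq hs;
  coset_reps_inj : forall m m' g g', m \in hs -> m' \in hs -> SL2Z g -> SL2Z g' ->
    m *m g = m' *m g' -> m = m';
  coset_reps_surj : forall m, M m -> exists2 m', m' \in hs & exists2 g, SL2Z g & m = m' *m g;
  coset_reps_closed : forall m g, M m -> SL2Z g -> M (m *m g);
  coset_reps_det : forall m, M m -> \det m != 0 }.

Lemma hom_count_cosets (M : set 'M[int]_2) (hs : seq 'M[int]_2) (Q Q' : bqf) :
  coset_reps M hs -> posdef Q ->
  hom_count M Q Q' = (\sum_(m <- hs) hom_count SL2Z (bqf_act Q m) Q')%N.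
Proof.
move=> [hs_sub hs_uniq hs_inj hs_surj M_closed M_det] posQ.
rewrite {1}/hom_count; set A := [set g | _].
have finA : finite_set A by exact: finite_homM.
pose coset m : set 'M[int]_2 := [set m *m g | g in SL2Z].
transitivity (\sum_(x <- fset_set A) \sum_(m <- hs) `[< coset m x >])%N.
  rewrite -sum1_size big_seq [RHS]big_seq; apply: eq_bigr => x.
  rewrite in_fset_set // inE => -[Mx Qx].
  have [m mhs [g Gg xE]] := hs_surj x Mx.
  rewrite (bigD1_seq m) //= asboolT; last by exists g.
  rewrite big_seq_cond big1 // => m' /andP[m'hs m'm]; rewrite asboolF // => -[g' Gg' xE'].
  by move/eqP: m'm; apply; apply: (hs_inj _ _ g' g) => //; rewrite xE'.
rewrite exchange_big /= big_seq [RHS]big_seq; apply: eq_bigr => m mhs.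
have Mm := hs_sub m mhs.
have finC : finite_set (A `&` coset m) by apply: finite_setI; left.
transitivity #|` fset_set (A `&` coset m)|.
  transitivity (size [seq x <- fset_set A | `[< coset m x >]]).
    by rewrite -sum1_size big_filter [RHS]big_mkcond; apply: eq_bigr => x _; case: asboolP.
  apply/perm_size/uniq_perm; rewrite ?filter_uniq ?fset_uniq // => x.
  rewrite mem_filter (in_fset_set finA) (in_fset_set finC).
  by apply/andP/idP => [[/asboolP mx /set_mem Ax]|/set_mem[Ax mx]];
    [apply/mem_set|split; [apply/asboolP|apply/mem_set]].
rewrite /hom_count.
have posQm : posdef (bqf_act Q m) by apply: posdef_act => //; exact: M_det.
rewrite -(@card_fset_set_image _ _ (mulmx m) [set g | SL2Z g /\ bqf_act (bqf_act Q m) g = Q']); first last.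
- by apply: mulmx_det_inj; exact: M_det.
- exact: finite_homM.
congr (#|` fset_set _|); apply/seteqP; split=> x /=.
  by move=> [[Mx Qx] [g Gg xE]]; exists g => //; split=> //; rewrite bqf_actM xE.
move=> [g [Gg QgQ'] <-]; split; last by exists g.
by split; [exact: M_closed|rewrite -bqf_actM].
Qed.

(** A coset m SL2(Z) with Q m equivalent to Q' contains exactly aut_count Q'
matrices that carry Q to Q'; dividing by this number counts the coset once. *)
Lemma coset_sum (M : set 'M[int]_2) (hs : seq 'M[int]_2) (Y : set bqf) (s : seq bqf)
    (h : bqf -> F) (Q : bqf) :
  coset_reps M hs -> bqf_transversal Y s -> (forall Q Q', Y Q -> bqf_class Q Q' -> Y Q') ->
  (forall Q, Y Q -> posdef Q) -> class_invariant Y h -> posdef Q ->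
  \sum_(m <- hs) (if `[< Y (bqf_act Q m) >] then h (bqf_act Q m) else 0) =
  \sum_(Q' <- s) (hom_count M Q Q')%:R / (aut_count Q')%:R * h Q'.
Proof.
move=> hsM ts Y_inv Y_pos h_inv posQ.
transitivity (\sum_(m <- hs) \sum_(Q' <- s) (if `[< bqf_class (bqf_act Q m) Q' >] then h Q' else 0)).
  apply: eq_bigr => m _; case: asboolP => [YQm|nYQm]; first by rewrite (bqf_transversal_sum1 ts).
  by rewrite (bqf_transversal_sum0 _ ts).
rewrite exchange_big /= big_seq [RHS]big_seq; apply: eq_bigr => Q' Q's.
rewrite (hom_count_cosets _ hsM) // natr_sum !mulr_suml big_seq [RHS]big_seq.
apply: eq_bigr => m mhs.
have posQm : posdef (bqf_act Q m).
  by apply: posdef_act => //; apply: (coset_reps_det hsM); exact: (coset_reps_sub hsM).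
case: asboolP => [QQ'|nQQ']; last by rewrite hom_count_not_equiv // !mul0r.
rewrite (hom_count_equiv posQm) // divff ?mul1r // pnatr_eq0 -lt0n.
by apply: aut_count_gt0; apply: Y_pos; exact: (bqf_transversal_sub ts).
Qed.

End Sums.

(** * Moebius transformations and roots of forms *)

Section Moebius.
Variable R : realType.
Local Notation C := R[i].

Definition mobius (g : 'M[int]_2) (z : C) : C :=
  ((g 0 0)%:~R * z + (g 0 1)%:~R) / ((g 1 0)%:~R * z + (g 1 1)%:~R).

Lemma intrC (k : int) : (k%:~R : C) = (k%:~R)%:C%C.
Proof. by rewrite rmorph_int. Qed.

Lemma mobius_den_neq0 (g : 'M[int]_2) (z : C) : \det g != 0 -> 0 < complex.Im z ->
  (g 1 0)%:~R * z + (g 1 1)%:~R != 0.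
Proof.
case: z => x y detg /= y_gt0; rewrite !intrC; apply/eqP => /eqP.
rewrite eq_complex /= !mul0r !subr0 !addr0 => /andP[/eqP re /eqP im].
have c0 : g 1 0 = 0.
  by move/eqP: im; rewrite mulf_eq0 (gt_eqF y_gt0) orbF intr_eq0 => /eqP.
move/eqP: re; rewrite c0 mul0r add0r intr_eq0 => /eqP d0.
by case/eqP: detg; rewrite det_mx2 c0 d0 !mulr0 subr0.
Qed.

(** Let w be the image.  The real and imaginary parts of the equation
w (c z + d) = a z + b give Im w * |c z + d| ^ 2 = det g * Im z. *)
Lemma mobius_Im_gt0 (g : 'M[int]_2) (z : C) : 0 < \det g -> 0 < complex.Im z ->
  0 < complex.Im (mobius g z).
Proof.
move=> detg z_gt0; have := mobius_den_neq0 (lt0r_neq0 detg) z_gt0.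
set den := _ + _ => den_neq0; have := divfK den_neq0 ((g 0 0)%:~R * z + (g 0 1)%:~R).
rewrite -/(mobius g z); case: (mobius g z) => u v /=.
move: den_neq0; rewrite /den {den}; case: z z_gt0 => x y /= y_gt0.
rewrite !intrC eq_complex /= !mul0r !subr0 !addr0 negb_and => den_neq0 [].
rewrite /= !mul0r !subr0 !addr0 => re im.
set c : R := (g 1 0)%:~R in re im den_neq0; set d : R := (g 1 1)%:~R in re im den_neq0.
have N_gt0 : 0 < (c * x + d) ^+ 2 + (c * y) ^+ 2.
  rewrite lt0r addr_ge0 ?sqr_ge0 // andbT paddr_eq0 ?sqr_ge0 // !sqrf_eq0 negb_and.
  exact: den_neq0.
have detE : v * ((c * x + d) ^+ 2 + (c * y) ^+ 2) = (\det g)%:~R * y.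
  rewrite det_mx2 rmorphB !rmorphM /= -/c -/d.
  transitivity ((u * (c * y) + v * (c * x + d)) * (c * x + d) -
     (u * (c * x + d) - v * (c * y)) * (c * y)); first by ring.
  by rewrite re im; ring.
by rewrite -(pmulr_lgt0 _ N_gt0) detE mulr_gt0 // ltr0z.
Qed.

Lemma alpha_exists (Q : bqf) : posdef Q -> exists z : C, 0 < complex.Im z /\
  (qa Q)%:~R * z ^+ 2 + (qb Q)%:~R * z + (qc Q)%:~R = 0.
Proof.
move=> posQ; have a_gt0 := posdef_qa posQ; have disc_lt0 := posdef_disc posQ.
pose a : R := (qa Q)%:~R; pose b : R := (qb Q)%:~R; pose c : R := (qc Q)%:~R.
have aR_gt0 : 0 < a by rewrite ltr0z.
pose s : R := Num.sqrt (4 * a * c - b ^+ 2).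
have discE : 4 * a * c - b ^+ 2 = (- bqf_disc Q)%:~R.
  by rewrite /bqf_disc rmorphN rmorphB rmorphXn !rmorphM /= -/a -/b -/c opprB.
have s_gt0 : 0 < s by rewrite sqrtr_gt0 discE ltr0z; lia.
have s2 : s ^+ 2 = 4 * a * c - b ^+ 2 by rewrite sqr_sqrtr // discE ler0z; lia.
exists ((- b / (2 * a)) +i* (s / (2 * a)))%C; split; first by rewrite /= divr_gt0 // mulr_gt0.
rewrite !intrC -/a -/b -/c expr2; apply/eqP; rewrite eq_complex /=.
have a_neq0 := lt0r_neq0 aR_gt0.
apply/andP; split; apply/eqP; last by field.
transitivity ((4 * a * c - b ^+ 2 - s ^+ 2) / (4 * a)); first by field.
by rewrite s2 subrr mul0r.
Qed.

(** Two distinct roots have the real sum - b / a, which is impossible for two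
points of the upper half-plane. *)
Lemma root_unique (Q : bqf) (z w : C) : posdef Q -> 0 < complex.Im z -> 0 < complex.Im w ->
  (qa Q)%:~R * z ^+ 2 + (qb Q)%:~R * z + (qc Q)%:~R = 0 ->
  (qa Q)%:~R * w ^+ 2 + (qb Q)%:~R * w + (qc Q)%:~R = 0 -> z = w.
Proof.
move=> posQ z_gt0 w_gt0 zQ wQ; have a_gt0 := posdef_qa posQ.
have : (z - w) * ((qa Q)%:~R * (z + w) + (qb Q)%:~R) = 0.
  transitivity (((qa Q)%:~R * z ^+ 2 + (qb Q)%:~R * z + (qc Q)%:~R) -
    ((qa Q)%:~R * w ^+ 2 + (qb Q)%:~R * w + (qc Q)%:~R)); first by ring.
  by rewrite zQ wQ subrr.
move/eqP; rewrite mulf_eq0 subr_eq0 => /orP[/eqP//|].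
case: z w z_gt0 w_gt0 {zQ wQ} => [x y] [x' y'] /= y_gt0 y'_gt0.
rewrite !intrC eq_complex /= !mul0r !addr0 => /andP[_].
by rewrite mulf_eq0 intr_eq0 (gt_eqF a_gt0) (gt_eqF (addr_gt0 y_gt0 y'_gt0)).
Qed.

Lemma alphaP (Q : bqf) : posdef Q -> 0 < complex.Im (alpha R Q) /\
  (qa Q)%:~R * alpha R Q ^+ 2 + (qb Q)%:~R * alpha R Q + (qc Q)%:~R = 0.
Proof.
move=> posQ; exact: (@xgetPex _ 0 [set z : C | 0 < complex.Im z /\
    (qa Q)%:~R * z ^+ 2 + (qb Q)%:~R * z + (qc Q)%:~R = 0] (alpha_exists posQ)).
Qed.

Lemma alpha_unique (Q : bqf) (z : C) : posdef Q -> 0 < complex.Im z ->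
  (qa Q)%:~R * z ^+ 2 + (qb Q)%:~R * z + (qc Q)%:~R = 0 -> alpha R Q = z.
Proof.
by move=> posQ z_gt0 zQ; have [? ?] := alphaP posQ; exact: (root_unique posQ).
Qed.

Lemma alpha_scale (k : int) (Q : bqf) : 0 < k -> posdef Q ->
  alpha R (bqf_scale k Q) = alpha R Q.
Proof.
move=> k_gt0 posQ; have [z_gt0 zQ] := alphaP posQ.
apply: alpha_unique => //; first exact/posdef_scale.
rewrite /= !rmorphM /=; move: (alpha R Q) zQ => z zQ.
transitivity (k%:~R * ((qa Q)%:~R * z ^+ 2 + (qb Q)%:~R * z + (qc Q)%:~R)); first by ring.
by rewrite zQ mulr0.
Qed.

(** The inverse of g carries the root of Q to the root of Q o g, and adj2 g is
this inverse up to a scalar. *)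
Lemma alpha_act (Q : bqf) (g : 'M[int]_2) : 0 < \det g -> posdef Q ->
  alpha R (bqf_act Q g) = mobius (adj2 g) (alpha R Q).
Proof.
move=> detg posQ; have [z_gt0 zQ] := alphaP posQ.
have detg' : 0 < \det (adj2 g) by rewrite det_adj2.
apply: alpha_unique.
- by apply: posdef_act => //; rewrite lt0r_neq0.
- exact: mobius_Im_gt0.
have := mobius_den_neq0 (lt0r_neq0 detg') z_gt0.
rewrite /mobius; set den := _ + _ => den_neq0; set w := _ / den.
have wden : w * den = (adj2 g 0 0)%:~R * alpha R Q + (adj2 g 0 1)%:~R by rewrite /w divfK.
apply: (mulIf (expf_neq0 2 den_neq0)); rewrite mul0r.
clearbody w; rewrite /den {den_neq0 den} in wden *.
move: (alpha R Q) zQ wden => z zQ wden.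
rewrite !mx2E !rmorphN /= in wden *.
rewrite !(rmorphD, rmorphM, rmorphXn, rmorph1) /=.
set a : C := (qa Q)%:~R in zQ *; set b : C := (qb Q)%:~R in zQ *; set c : C := (qc Q)%:~R in zQ *.
set X : C := (g 0 0)%:~R in wden *; set Y : C := (g 0 1)%:~R in wden *.
set Z : C := (g 1 0)%:~R in wden *; set T : C := (g 1 1)%:~R in wden *.
move: wden; set v : C := - Z * z + X => wden.
transitivity (a * (X * (w * v) + Y * v) ^+ 2 + b * (X * (w * v) + Y * v) * (Z * (w * v) + T * v)
  + c * (Z * (w * v) + T * v) ^+ 2); first by ring.
rewrite wden /v.
transitivity ((X * T - Y * Z) ^+ 2 * (a * z ^+ 2 + b * z + c)); first by ring.
by rewrite zQ mulr0.
Qed.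

End Moebius.

(** * Hecke operators as sums over cosets *)

(** The adjugates of the matrices with rows (n / e, b) and (0, e) in the
definition of the Hecke operator.  Those represent the cosets SL2(Z) m, whereas
forms, acted upon from the right, need the cosets m SL2(Z). *)
Definition hecke_reps (n : nat) : seq 'M[int]_2 :=
  [seq mx2 e%:Z (- b%:Z) 0 (n %/ e)%N%:Z | e <- divisors n, b <- iota 0 e].

Definition det_eq (n : nat) : set 'M[int]_2 := [set m | \det m = n%:Z].

Lemma hecke_repsP (n : nat) (m : 'M[int]_2) : (0 < n)%N ->
  reflect (exists e b a : nat, [/\ (b < e)%N, (a * e = n)%N & m = mx2 e%:Z (- b%:Z) 0 a%:Z])
          (m \in hecke_reps n).
Proof.
move=> n_gt0; apply: (iffP allpairsPdep) => [[e [b [e_dvd b_lt ->]]]|[e [b [a [b_lt ae ->]]]]].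
  move: e_dvd b_lt; rewrite -dvdn_divisors // mem_iota /= add0n => e_dvd b_lt.
  by exists e, b, (n %/ e)%N; split=> //; rewrite divnK.
exists e, b; rewrite -dvdn_divisors // mem_iota /= add0n b_lt -ae dvdn_mull //; split=> //.
by rewrite mulnK //; case: (e) b_lt.
Qed.

Lemma hecke_reps_inj_row (e b a e' b' a' : nat) (g : 'M[int]_2) : SL2Z g ->
  (0 < a * e)%N -> (0 < a' * e')%N -> (b < e)%N -> (b' < e')%N ->
  mx2 e%:Z (- b%:Z) 0 a%:Z = mx2 e'%:Z (- b'%:Z) 0 a'%:Z *m g ->
  [/\ e = e', b = b' & a = a'].
Proof.
rewrite /SL2Z /= det_mx2 => detg ae_gt0 ae'_gt0 b_lt b'_lt mE.
have := congr1 (fun m : 'M[int]_2 => m 0 0) mE; have := congr1 (fun m : 'M[int]_2 => m 0 1) mE.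
have := congr1 (fun m : 'M[int]_2 => m 1 0) mE; have := congr1 (fun m : 'M[int]_2 => m 1 1) mE.
rewrite !mulmx2E !mx2E => {mE}.
move: (g 0 0) (g 0 1) (g 1 0) (g 1 1) detg => x y z t detg e11 e10 e01 e00.
have z0 : z = 0.
  have /eqP : a'%:Z * z = 0 by rewrite mul0r add0r in e10.
  by rewrite mulf_eq0 => /orP[|/eqP//]; lia.
rewrite z0 in detg e00 e01 e11 e10.
rewrite !mulr0 ?mul0r ?subr0 ?addr0 ?add0r in detg e00 e11.
have x_gt0 : 0 < x by rewrite -(pmulr_rgt0 x (_ : 0 < e'%:Z)) -?e00; lia.
have a'_gt0 : (0 < a')%N by move: ae'_gt0; rewrite muln_gt0 => /andP[].
have a_gt0 : (0 < a)%N by move: ae_gt0; rewrite muln_gt0 => /andP[].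
have t_gt0 : 0 < t by rewrite -(pmulr_rgt0 t (_ : 0 < a'%:Z)) -?e11; lia.
have x1 : x = 1 by nia.
have t1 : t = 1 by nia.
rewrite x1 t1 in e00 e01 e11.
have y0 : y = 0 by nia.
by rewrite y0 in e01; split; lia.
Qed.

(** This is the Hermite normal form: a Bezout relation clears the lower left
entry, and a translation reduces the upper right one modulo e. *)
Lemma hecke_reps_coset (n : nat) : (0 < n)%N -> coset_reps (det_eq n) (hecke_reps n).
Proof.
move=> n_gt0; split.
- move=> m /hecke_repsP-/(_ n_gt0)[e [b [a [b_lt ae ->]]]].
  by rewrite /det_eq /= det_mx2 !mx2E mulr0 subr0 -PoszM mulnC ae.
- apply: allpairs_uniq_dep; first exact: divisors_uniq.
    by move=> e _; exact: iota_uniq.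
  move=> [e b] [e' b'] _ _ /= mE.
  have := congr1 (fun m : 'M[int]_2 => m 0 0) mE; have := congr1 (fun m : 'M[int]_2 => m 0 1) mE.
  by rewrite /= !mx2E => /oppr_inj[->] [->].
- move=> m m' g g' /hecke_repsP-/(_ n_gt0)[e [b [a [b_lt ae ->]]]].
  move=> /hecke_repsP-/(_ n_gt0)[e' [b' [a' [b'_lt ae' ->]]]] Gg Gg' mg.
  have : mx2 e%:Z (- b%:Z) 0 a%:Z = mx2 e'%:Z (- b'%:Z) 0 a'%:Z *m (g' *m adj2 g).
    by rewrite mulmxA -mg -mulmxA SL2Z_Kadj // mulmx1.
  have GG : SL2Z (g' *m adj2 g) by apply: SL2Z_M => //; exact: SL2Z_adj.
  by move=> /(hecke_reps_inj_row GG); rewrite ae ae' => /(_ n_gt0 n_gt0 b_lt b'_lt)[-> -> ->].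
- move=> m detm.
  pose a := gcdz (m 1 0) (m 1 1).
  have a_neq0 : a != 0.
    apply: contraTneq n_gt0 => /eqP; rewrite gcdz_eq0 => /andP[/eqP z0 /eqP t0].
    by move: detm; rewrite /det_eq /= det_mx2 z0 t0 !mulr0 subr0; case: (n).
  have a_gt0 : 0 < a by rewrite lt_def a_neq0.
  have [z' zE] := dvdzP (dvdz_gcdl (m 1 0) (m 1 1)).
  have [t' tE] := dvdzP (dvdz_gcdr (m 1 0) (m 1 1)).
  have [u [v uv]] := Bezoutz (m 1 0) (m 1 1).
  rewrite -/a in zE tE uv.
  have detG : z' * u + t' * v = 1.
    by apply: (mulfI a_neq0); rewrite mulr1 -[RHS]uv zE tE; ring.
  (* the second column of G is the Bezout relation, the first one kills the lower row of m *)
  pose G := mx2 t' u (- z') v.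
  have GG : SL2Z G by rewrite /SL2Z /= det_mx2 !mx2E -[RHS]detG; ring.
  pose e := (m *m G) 0 0; pose k := (m *m G) 0 1.
  have mG : m *m G = mx2 e k 0 a.
    apply: mx2P; rewrite !mx2E // !mulmx2E !mx2E.
      by rewrite zE tE; ring.
    by rewrite -[RHS]uv; ring.
  have ea : e * a = n%:Z.
    have := congr1 determinant mG; rewrite det_mulmx (GG : \det G = 1) mulr1 (detm : \det m = n%:Z).
    by rewrite det_mx2 !mx2E mulr0 subr0.
  have e_gt0 : 0 < e by rewrite -(pmulr_lgt0 _ a_gt0) ea.
  (* translation by U brings the upper right entry into ]- e, 0] *)
  pose U := mx2 1 ((- k) %/ e)%Z 0 1.
  have GU : SL2Z U by rewrite /SL2Z /= det_mx2 !mx2E mulr0 subr0.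
  exists (mx2 e (- ((- k) %% e)%Z) 0 a).
    apply/hecke_repsP => //; exists `|e|%N, `|((- k) %% e)%Z|%N, `|a|%N.
    have r_ge0 : 0 <= ((- k) %% e)%Z by rewrite modz_ge0 ?lt0r_neq0.
    rewrite !gez0_abs ?(ltW e_gt0) ?(ltW a_gt0) //; split=> //.
      by rewrite -ltz_nat !gez0_abs ?(ltW e_gt0) // ltz_pmod.
    by apply/eqP; rewrite -eqz_nat PoszM !gez0_abs ?(ltW e_gt0) ?(ltW a_gt0) // mulrC ea.
  exists (adj2 (G *m U)); first by apply: SL2Z_adj; exact: SL2Z_M.
  have <- : m *m G *m U = mx2 e (- ((- k) %% e)%Z) 0 a.
    rewrite mG; apply: mx2P; rewrite mulmx2E !mx2E ?mulr1 ?mulr0 ?mul0r ?addr0 ?add0r //.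
    have := divz_eq (- k) e; move: ((- k) %/ e)%Z ((- k) %% e)%Z => q r kE.
    have kE' : k = - (q * e + r) by rewrite -kE opprK.
    by rewrite kE'; ring.
  by rewrite -!mulmxA (mulmxA G) SL2Z_Kadj ?mulmx1 //; exact: SL2Z_M.
- move=> m g; rewrite /det_eq /= det_mulmx => -> Gg.
  by rewrite (Gg : \det g = 1) mulr1.
- by move=> m; rewrite /det_eq /= => ->; lia.
Qed.

Lemma coset_reps_sum_eq (V : nmodType) (M : set 'M[int]_2) (hs hs' : seq 'M[int]_2)
    (F : 'M[int]_2 -> V) :
  coset_reps M hs -> coset_reps M hs' ->
  (forall m g, M m -> SL2Z g -> F (m *m g) = F m) ->
  \sum_(m <- hs) F m = \sum_(m <- hs') F m.
Proof.
pose coset (m m' : 'M[int]_2) : bool := `[< exists2 g, SL2Z g & m' = m *m g >].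
(* the relation m' in m SL2(Z); exactly one representative is related to a given matrix *)
have coset_sym (m m' : 'M[int]_2) : coset m m' -> coset m' m.
  move=> /asboolP[g Gg ->]; apply/asboolP; exists (adj2 g); first exact: SL2Z_adj.
  by rewrite -mulmxA SL2Z_Kadj // mulmx1.
move=> hsM hsM' F_inv.
have sum_coset us m : coset_reps M us -> M m ->
    \sum_(u <- us) (if coset u m then F m else 0) = F m.
  move=> usM Mm; have [u0 u0s [g Gg mE]] := coset_reps_surj usM Mm.
  rewrite (bigD1_seq u0) ?(coset_reps_uniq usM) //= ifT; last by apply/asboolP; exists g.
  rewrite big_seq_cond big1 ?addr0 // => u /andP[us' uu0]; case: ifP => // /asboolP[g' Gg' mE'].
  by move/eqP: uu0; case; exact: (coset_reps_inj usM us' u0s Gg' Gg (etrans (esym mE') mE)).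
transitivity (\sum_(m <- hs) \sum_(u <- hs') (if coset u m then F m else 0)).
  rewrite big_seq [RHS]big_seq; apply: eq_bigr => m mhs.
  by rewrite sum_coset //; exact: (coset_reps_sub hsM).
rewrite exchange_big /= big_seq [RHS]big_seq; apply: eq_bigr => u uhs'.
have Mu := coset_reps_sub hsM' uhs'.
rewrite -[RHS](sum_coset hs u hsM Mu); apply: eq_bigr => m _.
have -> : coset m u = coset u m by apply/idP/idP; exact: coset_sym.
by case: ifP => // /asboolP[g Gg ->]; exact: F_inv.
Qed.

Section Hecke.
Variable R : realType.
Local Notation C := R[i].

Definition sl2_invariant (f : C -> C) : Prop :=
  forall g z, SL2Z g -> 0 < complex.Im z -> f (mobius g z) = f z.

Lemma mobiusM (g h : 'M[int]_2) (z : C) : \det g != 0 -> 0 < \det h -> 0 < complex.Im z ->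
  mobius (g *m h) z = mobius g (mobius h z).
Proof.
move=> detg deth z_gt0; have hz_gt0 := mobius_Im_gt0 deth z_gt0.
have dh := mobius_den_neq0 (lt0r_neq0 deth) z_gt0.
have dg := mobius_den_neq0 detg hz_gt0.
have dgh : ((g *m h) 1 0)%:~R * z + ((g *m h) 1 1)%:~R != 0.
  by apply: mobius_den_neq0 => //; rewrite det_mulmx mulf_neq0 // lt0r_neq0.
rewrite [mobius (g *m h)]/mobius [mobius g]/mobius.
move: dg; rewrite /mobius !mulmx2E !(rmorphD, rmorphM) /= in dgh *.
set a : C := (g 0 0)%:~R; set b : C := (g 0 1)%:~R; set c : C := (g 1 0)%:~R; set d : C := (g 1 1)%:~R.
move: dh dgh; rewrite -/c -/d.
set x : C := (h 0 0)%:~R; set y : C := (h 0 1)%:~R; set u : C := (h 1 0)%:~R; set v : C := (h 1 1)%:~R.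
move: a b c d x y u v => a b c d x y u v dh dgh dg.
field; rewrite dh /=; apply: contra_neq dgh => <-; ring.
Qed.

Lemma heckeE (n : nat) (f : C -> C) (z : C) :
  hecke n f z = \sum_(m <- hecke_reps n) f (mobius (adj2 m) z).
Proof.
rewrite /hecke_reps big_allpairs_dep /hecke; apply: eq_bigr => e _.
rewrite (_ : iota 0 e = index_iota 0 e) ?big_mkord; last by rewrite /index_iota subn0.
apply: eq_bigr => b _; rewrite /mobius !mx2E opprK oppr0 mul0r add0r.
by rewrite -!pmulrn.
Qed.

Lemma hecke_alpha (n : nat) (f : C -> C) (Q : bqf) : (0 < n)%N -> posdef Q ->
  hecke n f (alpha R Q) = \sum_(m <- hecke_reps n) f (alpha R (bqf_act Q m)).
Proof.
move=> n_gt0 posQ; rewrite heckeE big_seq [RHS]big_seq; apply: eq_bigr => m mn.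
rewrite alpha_act //; have := coset_reps_sub (hecke_reps_coset n_gt0) mn.
by rewrite /det_eq /= => ->.
Qed.

(** Precomposition with g permutes the cosets. *)
Lemma hecke_invariant (n : nat) (f : C -> C) : (0 < n)%N ->
  sl2_invariant f -> sl2_invariant (hecke n f).
Proof.
move=> n_gt0 f_inv g z Gg z_gt0; rewrite !heckeE.
have hsM := hecke_reps_coset n_gt0.
have det1 h : SL2Z h -> \det h = 1 by [].
transitivity (\sum_(m <- map (mulmx (adj2 g)) (hecke_reps n)) f (mobius (adj2 m) z)).
  rewrite big_map big_seq [RHS]big_seq; apply: eq_bigr => m mn.
  have detm : \det m = n%:Z := coset_reps_sub hsM mn.
  by rewrite adj2M adj2K mobiusM ?det_adj2 ?detm ?(det1 g) //; lia.
apply: (coset_reps_sum_eq _ hsM) => [|m h detm Gh]; last first.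
  rewrite adj2M mobiusM ?det_adj2 ?(det1 h) ?(detm : \det m = n%:Z) //.
  by apply: f_inv; [exact: SL2Z_adj|apply: mobius_Im_gt0 => //; rewrite det_adj2 (detm : \det m = n%:Z)].
have [hs_sub hs_uniq hs_inj hs_surj closed det_neq0] := hsM.
split=> //.
- move=> _ /mapP[m mn ->]; rewrite /det_eq /= det_mulmx det_adj2 (det1 g) // mul1r.
  exact: hs_sub.
- by rewrite map_inj_uniq // => m m'; apply: mulmx_det_inj; rewrite det_adj2 (det1 g).
- move=> _ _ h h' /mapP[m mn ->] /mapP[m' m'n ->] Gh Gh'; rewrite -!mulmxA.
  move=> /(@mulmx_det_inj (adj2 g)); rewrite det_adj2 (det1 g) // => /(_ isT) mh.
  by rewrite (hs_inj m m' h h').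
- move=> m detm; have [|m' m'n [h Gh mE]] := hs_surj (g *m m).
    by rewrite /det_eq /= det_mulmx (det1 g) // mul1r.
  exists (adj2 g *m m'); first exact: map_f.
  by exists h => //; rewrite -mulmxA -mE mulmxA SL2Z_adjK // mul1mx.
Qed.

End Hecke.

(** * Composition of Hecke operators *)

Section PeriodicSums.
Variable V : nmodType.

Lemma sum_periodic_shift (phi : nat -> V) (e k : nat) :
  (forall b, phi (b + e)%N = phi b) -> \sum_(b < e) phi (b + k)%N = \sum_(b < e) phi b.
Proof.
move=> phi_e; elim: k => [|k <-]; first by apply: eq_bigr => b _; rewrite addn0.
case: e phi_e => [|e] phi_e; first by rewrite !big_ord0.
rewrite big_ord_recr [RHS]big_ord_recl /= addrC; congr (_ + _).
  by rewrite addnS -addSn addnC phi_e.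
by apply: eq_bigr => b _; rewrite /bump add1n addnS.
Qed.

Lemma sum_digits (phi : nat -> V) (p e : nat) :
  \sum_(b < e) \sum_(r < p) phi (p * b + r)%N = \sum_(x < p * e) phi x.
Proof.
elim: e => [|e IHe]; first by rewrite muln0 !big_ord0.
rewrite big_ord_recr IHe /= mulnS addnC.
by rewrite big_split_ord.
Qed.

(** For fixed c, a shift of b replaces a * c by its residue modulo p, and
multiplication by a permutes these residues. *)
Lemma sum_residues (phi : nat -> V) (p a e : nat) : prime p -> ~~ (p %| a)%N ->
  (forall x, phi (x + p * e)%N = phi x) ->
  \sum_(c < p) \sum_(b < e) phi (a * c + p * b)%N = \sum_(x < p * e) phi x.
Proof.
move=> p_pr p_a phi_pe; rewrite -sum_digits [RHS]exchange_big /=.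
have p_gt0 := prime_gt0 p_pr.
pose psi r := \sum_(b < e) phi (p * b + r)%N.
transitivity (\sum_(c < p) psi ((a * c) %% p)%N).
  apply: eq_bigr => c _; rewrite {1}(divn_eq (a * c) p); set q := (_ %/ _)%N; set r := (_ %% _)%N.
  rewrite -[RHS](@sum_periodic_shift (fun b => phi (p * b + r)%N) e q); last first.
    by move=> b; rewrite mulnDr addnAC phi_pe.
  by apply: eq_bigr => b _; congr phi; ring.
pose h (c : 'I_p) : 'I_p := Ordinal (ltn_pmod (a * c) p_gt0).
have h_inj : injective h.
  move=> c c' /(congr1 val) /= /eqP; wlog le_cc' : c c' / (c' <= c)%N.
    by move=> H; case/orP: (leq_total c' c) => /H // {}H; rewrite eq_sym => /H ->.
  rewrite eqn_mod_dvd ?leq_mul2l ?le_cc' ?orbT // -mulnBr Euclid_dvdM // (negPf p_a) /=.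
  move=> p_cc'; apply/val_inj/eqP => /=; rewrite eqn_leq le_cc' andbT leqNgt -subn_gt0.
  apply/negP => /dvdn_leq-/(_ _ p_cc'); have := ltn_ord c; lia.
by rewrite [RHS](reindex_inj h_inj).
Qed.

End PeriodicSums.

Lemma divisors_prime (p : nat) : prime p -> perm_eq (divisors p) [:: 1; p]%N.
Proof.
move=> p_pr; have p_gt0 := prime_gt0 p_pr.
apply: uniq_perm; rewrite ?divisors_uniq //= ?inE ?andbT ?ltn_eqF ?prime_gt1 //.
move=> e; rewrite -dvdn_divisors // !inE; have [_ p_div] := primeP p_pr.
by apply/idP/orP => [/p_div/orP//|[/eqP->|/eqP->]]; rewrite ?dvd1n.
Qed.

Lemma divisors_primeM (p n : nat) : prime p -> (0 < n)%N ->
  perm_eq (divisors (p * n))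
    (divisors n ++ [seq (p * e)%N | e <- divisors n & ~~ (p %| n %/ e)%N]).
Proof.
move=> p_pr n_gt0; have p_gt0 := prime_gt0 p_pr.
have pn_gt0 : (0 < p * n)%N by rewrite muln_gt0 p_gt0.
have mul_inj : injective (muln p) by move=> x y /eqP; rewrite eqn_pmul2l // => /eqP.
apply: uniq_perm; rewrite ?divisors_uniq //.
  rewrite cat_uniq divisors_uniq map_inj_uniq // filter_uniq ?divisors_uniq // andbT /=.
  apply/hasPn => _ /mapP[e + ->]; rewrite mem_filter -!dvdn_divisors // => /andP[p_e e_n].
  apply: contra p_e => /dvdnP[k nE]; rewrite nE mulnCA mulnA mulnK; last exact: dvdn_gt0 e_n.
  exact: dvdn_mulr.
move=> E; rewrite mem_cat -!dvdn_divisors //; apply/idP/orP => [E_pn|[E_n|/mapP[e + ->]]]; first last.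
- rewrite mem_filter -dvdn_divisors // => /andP[_ e_n].
  by rewrite dvdn_pmul2l.
- exact: dvdn_mull.
have [E_n|E_n] := boolP (E %| n)%N; [by left|right].
have p_E : (p %| E)%N.
  apply: contraR E_n => p_E; move: E_pn; rewrite Gauss_dvdr //.
  by rewrite coprime_sym prime_coprime.
have [e EE] := dvdnP p_E; rewrite mulnC in EE; rewrite EE in E_n E_pn *.
rewrite dvdn_pmul2l // in E_pn.
apply: map_f; rewrite mem_filter -dvdn_divisors // E_pn andbT.
apply: contra E_n => /dvdnP[k kE]; apply/dvdnP; exists k.
by rewrite mulnA -kE divnK.
Qed.

Section HeckeRelation.
Variables (R : realType) (f : R[i] -> R[i]).
Hypothesis f_periodic : forall z, 0 < complex.Im z -> f (z + 1) = f z.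
Local Notation C := R[i].

Let S (a e : nat) (z : C) : C := \sum_(b < e) f ((a%:R * z + b%:R) / e%:R).

Lemma f_shift (a e x : nat) (z : C) : 0 < complex.Im z -> (0 < a)%N -> (0 < e)%N ->
  f ((a%:R * z + (x + e)%N%:R) / e%:R) = f ((a%:R * z + x%:R) / e%:R).
Proof.
move=> z_gt0 a_gt0 e_gt0; have e_neq0 : (e%:R : C) != 0 by rewrite pnatr_eq0 -lt0n.
rewrite natrD addrA mulrDl divff // f_periodic //.
have -> : (a%:R * z + x%:R) / e%:R = mobius (mx2 a%:Z x%:Z 0 e%:Z) z.
  by rewrite /mobius !mx2E mul0r add0r -!pmulrn.
by apply: mobius_Im_gt0 => //; rewrite det_mx2 !mx2E; lia.
Qed.

(** The matrix with rows (p, 0) and (0, 1) contributes the terms of T(p n) whose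
lower right entry divides n.  For each e, the matrices with rows (1, c) and (0, p)
contribute a remaining term of T(p n) if p does not divide n / e, and p times a term
of T(n / p) if it does. *)
Lemma hecke_relation (p n : nat) (z : C) : prime p -> (0 < n)%N -> 0 < complex.Im z ->
  hecke p (hecke n f) z = hecke (p * n) f z
    + (if (p %| n)%N then p%:R * hecke (n %/ p) f z else 0).
Proof.
move=> p_pr n_gt0 z_gt0.
have p_gt0 := prime_gt0 p_pr.
have pC_neq0 : (p%:R : C) != 0 by rewrite pnatr_eq0 -lt0n.
have neq0 (e : nat) : (0 < e)%N -> (e%:R : C) != 0 by rewrite pnatr_eq0 -lt0n.
have heckeS k w : hecke k f w = \sum_(e <- divisors k) S (k %/ e) e w by [].
have divs k e : (0 < k)%N -> e \in divisors k -> [/\ (0 < e)%N, (0 < k %/ e)%N & (e %| k)%N].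
  move=> k_gt0; rewrite -dvdn_divisors // => e_dvd; split=> //.
    exact: dvdn_gt0 e_dvd.
  by rewrite divn_gt0; [exact: dvdn_leq|exact: dvdn_gt0 e_dvd].
rewrite {1}/hecke (perm_big _ (divisors_prime p_pr)) /=.
rewrite big_cons big_seq1 big_ord1 divn1 divnn p_gt0 divr1 addr0.
rewrite !heckeS.
have S_mul a e : S a e (p%:R * z) = S (p * a) e z.
  by apply: eq_bigr => b _; rewrite mulrA natrM [a%:R * _]mulrC.
have S_coprime a e : (0 < a)%N -> (0 < e)%N -> ~~ (p %| a)%N ->
    \sum_(c < p) S a e ((1%:R * z + c%:R) / p%:R) = S a (p * e) z.
  move=> a_gt0 e_gt0 p_a; rewrite /S -(@sum_residues _ (fun x => f ((a%:R * z + x%:R) / (p * e)%:R)) p a e) //.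
    apply: eq_bigr => c _; apply: eq_bigr => b _; congr f; rewrite natrD !natrM mul1r.
    by field; rewrite pC_neq0 neq0.
  by move=> x; apply: f_shift; rewrite ?muln_gt0 ?p_gt0.
have S_dvd a e : (0 < a)%N -> (0 < e)%N ->
    \sum_(c < p) S (p * a) e ((1%:R * z + c%:R) / p%:R) = p%:R * S a e z.
  move=> a_gt0 e_gt0; rewrite -[p in RHS]card_ord -sumr_const mulr_suml.
  apply: eq_bigr => c _; rewrite mul1r /S.
  rewrite -[RHS](@sum_periodic_shift _ (fun x => f ((a%:R * z + x%:R) / e%:R)) e (a * c)); last first.
    by move=> b; exact: f_shift.
  apply: eq_bigr => b _; congr f; rewrite natrD !natrM.
  by field; rewrite pC_neq0 neq0.
transitivity (\sum_(e <- divisors n) (S (p * (n %/ e)) e z +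
   ((if ~~ (p %| n %/ e)%N then S (n %/ e) (p * e) z else 0) +
    (if (p %| n %/ e)%N then p%:R * S (n %/ e %/ p) e z else 0)))).
  rewrite exchange_big /= -big_split big_seq [RHS]big_seq; apply: eq_bigr => e e_n.
  have [e_gt0 a_gt0 _] := divs n e n_gt0 e_n.
  rewrite S_mul; congr (_ + _); case: (boolP (p %| _)%N) => [/dvdnP[a aE]|p_a].
    rewrite add0r; rewrite aE mulnC in a_gt0 *; rewrite mulKn // S_dvd //.
    by move: a_gt0; rewrite muln_gt0 => /andP[].
  by rewrite addr0 S_coprime.
rewrite !big_split /= addrA; congr (_ + _).
  rewrite (perm_big _ (divisors_primeM p_pr n_gt0)) big_cat big_map big_filter /=; congr (_ + _).
    rewrite big_seq [RHS]big_seq; apply: eq_bigr => e e_n.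
    by have [_ _ e_dvd] := divs n e n_gt0 e_n; rewrite muln_divA.
  rewrite [RHS]big_mkcond; apply: eq_bigr => e _; rewrite divnMl //.
rewrite -big_mkcond /=; case: ifP => p_n; last first.
  rewrite big_seq_cond big1 // => e /andP[e_n p_e]; have [_ _ e_dvd] := divs n e n_gt0 e_n.
  by move: p_n; rewrite (dvdn_trans p_e) // dvdn_div.
rewrite mulr_sumr -big_filter (perm_big (divisors (n %/ p))) /=.
  by apply: eq_bigr => e _; rewrite -!divnMA mulnC.
apply: uniq_perm; rewrite ?filter_uniq ?divisors_uniq // => e.
have np_gt0 : (0 < n %/ p)%N by rewrite divn_gt0 //; exact: dvdn_leq.
rewrite mem_filter -!dvdn_divisors //.
have [e0|e_gt0] := posnP e.
  by rewrite e0 !dvd0n (gtn_eqF n_gt0) andbF gtn_eqF.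
rewrite (dvdn_divRL e p_n); apply/andP/idP => [[p_e e_n]|ep_n].
  by rewrite mulnC -(dvdn_divRL p e_n).
have e_n : (e %| n)%N := dvdn_trans (dvdn_mulr p (dvdnn e)) ep_n.
by rewrite (dvdn_divRL p e_n) mulnC.
Qed.

End HeckeRelation.

(** * Counting sublattices of prime index *)

Lemma sum_Fp (p : nat) (F : nat -> nat) : prime p ->
  (\sum_(x < p) F x = \sum_(x : 'F_p) F x)%N.
Proof.
move=> p_pr; transitivity (\sum_(0 <= x < p) F x)%N; first by rewrite big_mkord.
by rewrite -{1}(Fp_cast p_pr) big_mkord.
Qed.

Lemma sum_pred_card (T : finType) (P : pred T) : (\sum_(x : T) P x = #|P|)%N.
Proof. by rewrite -sum1_card [RHS]big_mkcond; apply: eq_bigr => x _; rewrite unfold_in; case: (P x). Qed.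

Lemma count_Fp (p : nat) (P : pred nat) (Q : pred 'F_p) : prime p ->
  (forall x : 'F_p, P x = Q x) -> (\sum_(x < p) P x = #|Q|)%N.
Proof.
by move=> p_pr PQ; rewrite (sum_Fp P p_pr) -sum_pred_card; apply: eq_bigr => x _; rewrite PQ.
Qed.

Lemma count_linear_root (p : nat) (u v : int) : prime p -> ~~ (p%:Z %| u)%Z ->
  (\sum_(x < p) (p%:Z %| (u * x%:Z + v)%R)%Z = 1)%N.
Proof.
move=> p_pr p_u; have charF := pchar_Fp p_pr.
have u_neq0 : (u%:~R : 'F_p) != 0 by rewrite -(dvdz_pcharf charF).
rewrite (@count_Fp p (fun x : nat => p%:Z %| (u * x%:Z + v)%R)%Z (pred1 (- v%:~R / u%:~R : 'F_p))) ?card1 // => x.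
rewrite (dvdz_pcharf charF) rmorphD rmorphM /= -pmulrn natr_Zp /= addr_eq0.
apply/eqP/eqP => [ux|->]; first by rewrite -ux mulrC mulKf.
by rewrite mulrC divfK.
Qed.

Lemma count_square_root (p : nat) (e : int) : prime p -> odd p ->
  (#|[pred x : 'F_p | x ^+ 2 == e%:~R]|)%N%:Z = 1 + kronecker_prime e p.
Proof.
move=> p_pr p_odd; have charF := pchar_Fp p_pr.
have p_gt2 : (2 < p)%N by case: p p_pr p_odd {charF} => [|[|[|]]].
rewrite /kronecker_prime (gtn_eqF p_gt2) (dvdz_pcharf charF).
have [->|e_neq0] := eqVneq (e%:~R : 'F_p) 0.
  rewrite addr0; congr Posz; transitivity #|pred1 (0 : 'F_p)|; last by rewrite card1.
  by apply: eq_card => x; rewrite !inE sqrf_eq0.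
case: ifP => [/existsP[y /eqP eE]|nsq].
  have {eE} eE : e%:~R = ((y : nat)%:R : 'F_p) ^+ 2.
    apply/eqP; rewrite -subr_eq0 -natrX pmulrn -rmorphB -(dvdz_pcharf charF) /=.
    by rewrite -eqz_mod_dvd; apply/eqP.
  have y_neq0 : ((y : nat)%:R : 'F_p) != 0 by apply: contra_neq e_neq0; rewrite eE => ->; rewrite expr0n.
  transitivity (#|pred2 ((y : nat)%:R : 'F_p) (- (y : nat)%:R)|%:Z).
    by congr Posz; apply: eq_card => x; rewrite !inE eE eqf_sqr.
  rewrite card2; suff -> : ((y : nat)%:R : 'F_p) != - (y : nat)%:R by [].
  rewrite -addr_eq0 (_ : _ + _ = 2 * (y : nat)%:R); last by ring.
  rewrite mulf_eq0 negb_or y_neq0 andbT.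
  by rewrite -(dvdn_pcharf charF) gtnNdvd.
rewrite subrr; congr Posz; apply: eq_card0 => x; rewrite !inE.
apply/negP => /eqP xE; move/negbT/negP: nsq; case; apply/existsP.
have x_lt : (x < p)%N by rewrite -[X in (_ < X)%N](Fp_cast p_pr) ltn_ord.
exists (Ordinal x_lt); rewrite eqz_mod_dvd (dvdz_pcharf charF) rmorphB /= -xE.
by rewrite -pmulrn natrX natr_Zp subrr.
Qed.

Definition dvd3 (k a b c : int) : bool := [&& (k %| a)%Z, (k %| b)%Z & (k %| c)%Z].

Lemma dvdzNr (d m : int) : (d %| - m)%Z = (d %| m)%Z.
Proof. by rewrite !dvdzE abszN. Qed.

(** The first summand is the point at infinity of the projective line over
the field with p elements.  For odd p not dividing a, completing the square turns
the affine roots into square roots of the discriminant. *)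
Lemma count_projective_roots (p : nat) (a b c : int) : prime p ->
  ((p%:Z %| a)%Z + \sum_(x < p) (p%:Z %| (a * x%:Z ^+ 2 - b * x%:Z + c)%R)%Z)%N%:Z =
  1 + kronecker_prime (b ^+ 2 - 4 * a * c) p + (if dvd3 p%:Z a b c then p%:Z else 0).
Proof.
move=> p_pr; have [->|p_odd] := even_prime p_pr.
  rewrite !big_ord_recl big_ord0 /dvd3 /=.
  have -> : (2 %| (a * 0%N%:Z ^+ 2 - b * 0%N%:Z + c)%R)%Z = (2 %| c)%Z.
    by rewrite expr0n !mulr0 subr0 add0r.
  have -> : (2 %| (a * (bump 0 0)%:Z ^+ 2 - b * (bump 0 0)%:Z + c)%R)%Z = (2 %| a - b + c)%Z.
    by rewrite /bump expr1n !mulr1.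
  have -> : kronecker_prime (b ^+ 2 - 4 * a * c) 2 =
      if (2 %| b)%Z then 0 else if (2 %| a)%Z || (2 %| c)%Z then 1 else -1.
    have := Euclidz_dvdM a c (isT : prime 2); have := Euclidz_dvdM b b (isT : prime 2).
    have : (2 %| b)%Z || ((b * b) %% 8 == 1)%Z.
      rewrite -modzMm; have : (2 %| b)%Z = (2 %| (b %% 8)%Z)%Z by apply/idP/idP; lia.
      move=> ->; have : 0 <= (b %% 8)%Z < 8 by lia.
      by case: (b %% 8)%Z => [[|[|[|[|[|[|[|[|]]]]]]]]|].
    rewrite expr2 -mulrA orbb /kronecker_prime /=; move: (a * c) (b * b) => w b2 b28 dvdb2 <-.
    rewrite !inE; case: ifP => d1; case: ifP => d2; do ?case: ifP => ?; lia.
  case: (boolP (2 %| a)%Z); case: (boolP (2 %| b)%Z); case: (boolP (2 %| c)%Z) => c2 b2 a2 /=;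
    case: (boolP (2 %| a - b + c)%Z) => abc2 //; lia.
have charF := pchar_Fp p_pr.
have p_gt2 : (2 < p)%N by case: p p_pr p_odd {charF} => [|[|[|]]].
have [p_a|p_a] /= := boolP (p%:Z %| a)%Z.
  have -> : kronecker_prime (b ^+ 2 - 4 * a * c) p = kronecker_prime (b ^+ 2) p.
    apply: kronecker_prime_mod => //; rewrite addrC addKr dvdzNr.
    by apply/dvdz_mulr/dvdz_mull.
  have val x : (p%:Z %| a * x%:Z ^+ 2 - b * x%:Z + c)%Z = (p%:Z %| (- b) * x%:Z + c)%Z.
    by rewrite -addrA mulNr; apply: rpredDl; rewrite dvdz_mulr.
  under eq_bigr do rewrite val.
  rewrite /dvd3 p_a /=.
  have [p_b|p_b] /= := boolP (p%:Z %| b)%Z; last first.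
    rewrite count_linear_root // ?kronecker_prime_sqr //.
    by rewrite dvdzNr.
  have -> : kronecker_prime (b ^+ 2) p = 0 by apply/eqP; rewrite kronecker_prime_eq0 expr2 dvdz_mulr.
  have val' x : (p%:Z %| - b * x%:Z + c)%Z = (p%:Z %| c)%Z.
    by apply: rpredDl; rewrite mulNr dvdzNr dvdz_mulr.
  under eq_bigr do rewrite val'.
  by rewrite sum_nat_const card_ord; case: (_ %| c)%Z; rewrite ?muln1 ?muln0 addr0 //.
rewrite /dvd3 (negPf p_a) /= add0n addr0 -(count_square_root _ p_pr p_odd).
have a_neq0 : (a%:~R : 'F_p) != 0 by rewrite -(dvdz_pcharf charF).
have two_neq0 : (2 : 'F_p) != 0 by rewrite -(dvdn_pcharf charF) gtnNdvd.
have aa_neq0 : 2 * a%:~R != 0 :> 'F_p by rewrite mulf_neq0.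
pose h (x : 'F_p) : 'F_p := 2 * a%:~R * x - b%:~R.
have h_inj : injective h by move=> x y /addIr /(mulfI aa_neq0).
congr Posz; rewrite (@count_Fp p (fun x : nat => p%:Z %| (a * x%:Z ^+ 2 - b * x%:Z + c)%R)%Z (preim h [pred y | y ^+ 2 == (b ^+ 2 - 4 * a * c)%:~R])) //.
  rewrite (card_preim h_inj); apply: eq_card => y; rewrite !inE.
  suff -> : y \in codom h by [].
  apply/codomP; exists ((y + b%:~R) / (2 * a%:~R)).
  by rewrite /h mulrC divfK // addrK.
move=> x; rewrite (dvdz_pcharf charF) /h inE /=.
have -> : ((a * (x : nat)%:Z ^+ 2 - b * (x : nat)%:Z + c)%:~R : 'F_p) =
    a%:~R * x ^+ 2 - b%:~R * x + c%:~R.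
  by rewrite rmorphD rmorphB !rmorphM /= -pmulrn natr_Zp.
have -> : ((b ^+ 2 - 4 * a * c)%:~R : 'F_p) = b%:~R ^+ 2 - 2 * 2 * a%:~R * c%:~R.
  by rewrite rmorphB rmorphXn !rmorphM /= (_ : 4%:~R = 2 * 2) // -natrM.
rewrite -[RHS]subr_eq0.
have -> : (2 * a%:~R * x - b%:~R) ^+ 2 - (b%:~R ^+ 2 - 2 * 2 * a%:~R * c%:~R) =
   (2 * 2 * a%:~R) * (a%:~R * x ^+ 2 - b%:~R * x + c%:~R) :> 'F_p by ring.
by rewrite !mulf_eq0 (negPf two_neq0) (negPf a_neq0).
Qed.

(** The sublattices of index p are the one at infinity and those indexed by
x < p; the summands test whether p ^ 2 divides the form on them.  If p divides the
form, divide by p: what is counted are the projective roots of the quotient.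
Otherwise the form is modulo p a unit times the square of a linear form, whose zero
is the only candidate, and the shape of the discriminant forces divisibility by
p ^ 2 there. *)
Lemma count_sublattices (p : nat) (a b c e : int) : prime p ->
  b ^+ 2 - 4 * a * c = p%:Z ^+ 2 * e -> is_discriminant e ->
  ((p%:Z ^+ 2 %| a)%Z && (p%:Z %| b)%Z +
   \sum_(x < p) ((p%:Z %| (b - 2 * a * x%:Z)%R)%Z &&
     (p%:Z ^+ 2 %| (a * x%:Z ^+ 2 - b * x%:Z + c)%R)%Z))%N%:Z =
  1 + (if dvd3 p%:Z a b c then kronecker_prime e p else 0)
    + (if dvd3 (p%:Z ^+ 2) a b c then p%:Z else 0).
Proof.
move=> p_pr disc e_disc.
have p_neq0 : p%:Z != 0 by rewrite eqz_nat -lt0n prime_gt0.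
have [|] := boolP (dvd3 p%:Z a b c).
  case/and3P => /dvdzP[a' aE] /dvdzP[b' bE] /dvdzP[c' cE].
  have dvdpp x : (p%:Z ^+ 2 %| x * p%:Z)%Z = (p%:Z %| x)%Z by rewrite expr2 dvdz_mul2r.
  have eE : e = b' ^+ 2 - 4 * a' * c'.
    by apply: (mulfI (expf_neq0 2 p_neq0)); rewrite -disc aE bE cE; ring.
  rewrite eE [X in _ + X](_ : _ = if dvd3 p%:Z a' b' c' then p%:Z else 0); last first.
    by rewrite /dvd3 aE bE cE !dvdpp.
  rewrite -count_projective_roots // aE bE cE dvdpp dvdz_mull ?dvdzz // andbT.
  congr (Posz (_ + _)%N); apply: eq_bigr => x _; congr nat_of_bool.
  rewrite (_ : _ - 2 * _ * _ = (b' - 2 * a' * x%:Z) * p%:Z); last by ring.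
  rewrite (_ : _ * p%:Z * _ - _ + _ = (a' * x%:Z ^+ 2 - b' * x%:Z + c') * p%:Z); last by ring.
  by rewrite dvdpp dvdz_mull.
move=> not_p.
have not_pp : dvd3 (p%:Z ^+ 2) a b c = false.
  apply: contraNF not_p => /and3P[pa pb pc].
  have pp : (p%:Z %| p%:Z ^+ 2)%Z by rewrite expr2 dvdz_mulr.
  by rewrite /dvd3 !(dvdz_trans pp).
rewrite not_pp !addr0.
have pp : (p%:Z %| p%:Z ^+ 2)%Z by rewrite expr2 dvdz_mulr.
have p_b2 : (p%:Z %| a)%Z -> (p%:Z %| b)%Z.
  move=> pa; rewrite -(Euclidz_dvdX _ p_pr (isT : 0 < 2)%N).
  rewrite -[b ^+ 2](subrK (4 * a * c)) disc; apply: rpredD; first exact: dvdz_mulr.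
  by apply/dvdz_mulr/dvdz_mull.
have odd_coprime k : odd p -> ~~ (p%:Z %| k)%Z -> coprimez (p%:Z ^+ 2) (4 * k).
  move=> p_odd; rewrite dvdzE => p_k; rewrite coprimezXl // coprimezE /= prime_coprime //.
  rewrite abszM Euclid_dvdM // negb_or p_k andbT.
  have p_gt2 : (2 < p)%N by case: (p) p_pr p_odd => [|[|[|]]].
  by rewrite (_ : absz 4 = 2 * 2)%N // Euclid_dvdM // orbb gtnNdvd.
have e4 : (e %% 4)%Z = 0 \/ (e %% 4)%Z = 1 by move: e_disc; rewrite /is_discriminant !inE; lia.
have [p_a|p_a] := boolP (p%:Z %| a)%Z.
  have p_b := p_b2 p_a.
  have p_c : ~~ (p%:Z %| c)%Z by move: not_p; rewrite /dvd3 p_a p_b.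
  rewrite p_b andbT big1 ?addn0 => [|x _]; last first.
    rewrite [X in _ && X](_ : _ = false) ?andbF //; apply: contraNF p_c => /(dvdz_trans pp).
    have -> // : (p%:Z %| a * x%:Z ^+ 2 - b * x%:Z + c)%Z = (p%:Z %| c)%Z.
    by apply: rpredDl; apply: rpredB; exact: dvdz_mulr.
  suff -> : (p%:Z ^+ 2 %| a)%Z by [].
  have [p2|p_odd] := even_prime p_pr; last first.
    rewrite -(@Gauss_dvdzr _ (4 * c)); last exact: odd_coprime.
    rewrite (_ : 4 * c * a = b ^+ 2 - p%:Z ^+ 2 * e); last by rewrite -disc; ring.
    by apply: rpredB; [rewrite dvdz_exp2r|exact: dvdz_mulr].
  move: p_a p_b p_c disc; rewrite p2 => /dvdzP[a1 aE] /dvdzP[b1 bE] c_odd.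
  rewrite aE bE => disc.
  have : e = b1 * b1 - 2 * (a1 * c) by lia.
  have := Euclidz_dvdM a1 c (isT : prime 2); rewrite (negPf c_odd) orbF.
  have : ((b1 * b1) %% 4)%Z = 0 \/ ((b1 * b1) %% 4)%Z = 1.
    rewrite -modzMm; have : 0 <= (b1 %% 4)%Z < 4 by lia.
    by case: (b1 %% 4)%Z => [[|[|[|[|]]]]|] // _; auto.
  move: (b1 * b1) (a1 * c) => s w s4 wE eE; clear -s4 wE eE e4; lia.
have -> : (p%:Z ^+ 2 %| a)%Z = false by apply: contraNF p_a; exact: dvdz_trans.
rewrite add0n.
have [p2|p_odd] := even_prime p_pr.
  move: p_a disc; rewrite p2 !big_ord_recl big_ord0 => a_odd disc.
  have [b1 bE] : exists b1, b = 2 * b1.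
    have : (2 %| b ^+ 2)%Z by rewrite (_ : b ^+ 2 = 2 * (2 * a * c + 2 * e)) ?dvdz_mulr //; lia.
    by rewrite (@Euclidz_dvdX 2) // => /dvdzP[b1 ->]; exists b1; rewrite mulrC.
  have eE : e = b1 * b1 - a * c by move: disc; rewrite bE; lia.
  clear disc; rewrite /= /bump /= !mulr0 subr0 add0r expr1n !mulr1.
  have -> : (2 %| b)%Z by rewrite bE dvdz_mulr.
  have -> : (2 %| b - 2 * a)%Z by rewrite bE -mulrBr dvdz_mulr.
  rewrite /= addn0; congr Posz.
  have -> : (2 ^+ 2 %| c)%Z = ((c %% 4)%Z == 0) by apply/idP/idP; lia.
  have -> : (2 ^+ 2 %| a - b + c)%Z = (((a %% 4)%Z - 2 * (b1 %% 4)%Z + (c %% 4)%Z) %% 4 == 0)%Z.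
    by rewrite bE; apply/idP/idP; lia.
  have : (e %% 4)%Z = (((b1 %% 4)%Z * (b1 %% 4)%Z - (a %% 4)%Z * (c %% 4)%Z)%R %% 4)%Z.
    by rewrite eE -modzDm -modzNm -[RHS]modzDm -[in RHS]modzNm !modzMm.
  have : (a %% 4)%Z = 1 \/ (a %% 4)%Z = 3 by lia.
  have : 0 <= (b1 %% 4)%Z < 4 by lia.
  have : 0 <= (c %% 4)%Z < 4 by lia.
  case: (c %% 4)%Z => [[|[|[|[|]]]]|] // _; case: (b1 %% 4)%Z => [[|[|[|[|]]]]|] // _;
    by case=> ->; case: e4 => ->.
have two_a : ~~ (p%:Z %| 2 * a)%Z.
  rewrite Euclidz_dvdM // negb_or p_a andbT dvdzE /= gtnNdvd //.
  by case: (p) p_pr p_odd => [|[|[|]]].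
transitivity (Posz (\sum_(x < p) (p%:Z %| (2 * a * x%:Z + - b)%R)%Z)%N); last first.
  by rewrite count_linear_root.
congr Posz; apply: eq_bigr => x _; congr nat_of_bool.
rewrite -[in RHS]dvdzNr opprD opprK [in RHS]addrC.
have [p_lin|//] := boolP (p%:Z %| _)%Z.
rewrite -(@Gauss_dvdzr _ (4 * a)); last exact: odd_coprime.
rewrite (_ : 4 * a * _ = (b - 2 * a * x%:Z) ^+ 2 - p%:Z ^+ 2 * e); last by rewrite -disc; ring.
by apply: rpredB; [rewrite dvdz_exp2r|exact: dvdz_mulr].
Qed.

(** * Traces as sums over representatives *)

Lemma forms_class (D : int) (d : nat) (Q Q' : bqf) : forms D d Q -> bqf_class Q Q' -> forms D d Q'.
Proof.
move=> FQ [g Gg <-]; rewrite -[d]mul1n.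
by apply: (@forms_act D d Q g 1).
Qed.

Lemma class_repP (Q : bqf) : bqf_class Q (xget (BQF 1 0 1) (bqf_class Q)).
Proof. by apply: (@xgetPex _ (BQF 1 0 1) (bqf_class Q)); exists Q; exact: bqf_class_refl. Qed.

Lemma bqf_transversal_filter (Y Y' : set bqf) (s : seq bqf) :
  Y' `<=` Y -> (forall Q Q', Y' Q -> bqf_class Q Q' -> Y' Q') -> bqf_transversal Y s ->
  bqf_transversal Y' [seq Q <- s | `[< Y' Q >]].
Proof.
move=> sub cl [s_sub s_uniq s_inj s_surj]; split.
- by move=> Q; rewrite mem_filter => /andP[/asboolP].
- exact: filter_uniq.
- by move=> Q Q'; rewrite !mem_filter => /andP[_ Qs] /andP[_ Q's]; exact: s_inj.
- move=> Q Y'Q; have [Q' Q's QQ'] := s_surj Q (sub _ Y'Q); exists Q' => //.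
  by rewrite mem_filter Q's andbT; apply/asboolP; exact: cl QQ'.
Qed.

Lemma scale_forms_class (D k : int) (d : nat) (Q Q' : bqf) :
  (bqf_scale k @` forms D d) Q -> bqf_class Q Q' -> (bqf_scale k @` forms D d) Q'.
Proof.
move=> [Q0 FQ0 <-] [g Gg <-]; exists (bqf_act Q0 g); last by rewrite bqf_act_scale.
by apply: forms_class FQ0 _; exists g.
Qed.

Lemma dvd3P (k : int) (Q : bqf) :
  reflect (exists Q', Q = bqf_scale k Q') (dvd3 k (qa Q) (qb Q) (qc Q)).
Proof.
apply: (iffP and3P) => [[/dvdzP[a aE] /dvdzP[b bE] /dvdzP[c cE]]|[Q' ->]].
  by exists (BQF a b c); apply: bqfP; rewrite /= mulrC.
by rewrite /= !dvdz_mulr.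
Qed.

Lemma scale_formsP (D : int) (k d : nat) (Q : bqf) : (0 < k)%N -> forms D (k ^ 2 * d) Q ->
  (bqf_scale k @` forms D d) Q <-> dvd3 k (qa Q) (qb Q) (qc Q).
Proof.
move=> k_gt0 [posQ discQ]; split=> [[Q' FQ' <-]|/dvd3P[Q' QE]]; first by apply/dvd3P; exists Q'.
exists Q' => //; split; first by apply/(@posdef_scale k); rewrite -?QE.
apply: (@mulfI _ (k%:Z ^+ 2)); first by rewrite expf_neq0 //; lia.
by rewrite -bqf_disc_scale -QE discQ PoszM Posz_sqr !mulrN mulrA.
Qed.

Section Traces.
Variables (R : realType) (D : int).
Hypotheses (hD : fundamental_discriminant D) (hD1 : 1 < D).
Local Notation C := R[i].

Let D_gt0 : 0 < D. Proof. exact: lt_trans hD1. Qed.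

(** The representatives are those used in the definition of Tr. *)
Definition class_reps (d : nat) : seq bqf :=
  [seq xget (BQF 1 0 1) X | X <- fset_set [set bqf_class Q | Q in forms D d]].

Lemma class_reps_transversal (d : nat) : (0 < d)%N -> bqf_transversal (forms D d) (class_reps d).
Proof.
move=> d_gt0; have fin := finite_classes D_gt0 d_gt0.
have memP X : X \in fset_set [set bqf_class Q | Q in forms D d] ->
    exists2 Q, forms D d Q & X = bqf_class Q.
  by rewrite in_fset_set // inE => -[Q FQ <-]; exists Q.
have rep_class X : X \in fset_set [set bqf_class Q | Q in forms D d] ->
    X = bqf_class (xget (BQF 1 0 1) X).
  by move=> /memP[Q FQ ->]; apply: bqf_class_eq; exact: class_repP.
split.
- move=> _ /mapP[X /memP[Q FQ ->] ->]; exact: forms_class FQ (class_repP Q).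
- rewrite map_inj_in_uniq ?fset_uniq // => X Y XF YF XY.
  by rewrite (rep_class X) // (rep_class Y) // XY.
- move=> _ _ /mapP[X XF ->] /mapP[Y YF ->] XY; congr xget.
  by rewrite (rep_class X) // (rep_class Y) //; apply: bqf_class_eq.
- move=> Q FQ; exists (xget (BQF 1 0 1) (bqf_class Q)); last exact: class_repP.
  by apply: map_f; rewrite in_fset_set // inE; exists Q.
Qed.

(** The factor 2 accounts for stabilizers being counted in SL2(Z). *)
Definition trace_term (f : C -> C) (Q : bqf) : C :=
  (chi D Q)%:~R * (2 / (aut_count Q)%:R) * f (alpha R Q).

Lemma Tr_class_reps (d : nat) (f : C -> C) : (0 < d)%N ->
  Tr D d f = \sum_(Q <- class_reps d) trace_term f Q.
Proof.
move=> d_gt0; have fin := finite_classes D_gt0 d_gt0.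
rewrite /Tr fsbig_finite // big_map big_seq [RHS]big_seq; apply: eq_bigr => X.
rewrite in_fset_set // inE => -[Q FQ <-] /=; have := class_repP Q; set Q' := xget _ _ => QQ'.
have FQ' := forms_class FQ QQ'.
have two_neq0 : (2 : C) != 0 by rewrite pnatr_eq0.
by rewrite /trace_term (aut_count_stab FQ'.1) natrM invfM [2 * _]mulrA divff // mul1r.
Qed.

Lemma alpha_class (f : C -> C) (Q Q' : bqf) : sl2_invariant f -> posdef Q ->
  bqf_class Q Q' -> f (alpha R Q') = f (alpha R Q).
Proof.
move=> f_inv posQ [g Gg <-]; rewrite alpha_act ?(Gg : \det g = 1) //.
by apply: f_inv; [exact: SL2Z_adj|case: (alphaP R posQ)].
Qed.

Lemma trace_term_class (d : nat) (f : C -> C) : sl2_invariant f ->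
  class_invariant (forms D d) (trace_term f).
Proof.
move=> f_inv Q Q' FQ QQ'; rewrite /trace_term (aut_count_class FQ.1 QQ') (alpha_class f_inv FQ.1 QQ').
congr (_%:~R * _ * _); have [d_disc|nd] := boolP (is_discriminant (- d%:Z)).
  move: QQ' => [g Gg <-]; apply/esym/(chi_act hD hD1 d_disc (isT : 0 < 1)%N _ Gg FQ).
  by rewrite coprimezE coprime1n.
by rewrite !(chi_not_discriminant hD1 nd) //; exact: forms_class QQ'.
Qed.

Lemma Tr_not_discriminant (d : nat) (f : C -> C) : (0 < d)%N ->
  ~~ is_discriminant (- d%:Z) -> Tr D d f = 0.
Proof.
move=> d_gt0 nd; rewrite Tr_class_reps // big_seq big1 // => Q Qs.
have FQ := bqf_transversal_sub (class_reps_transversal d_gt0) Qs.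
by rewrite /trace_term (chi_not_discriminant hD1 nd FQ) !mul0r.
Qed.

End Traces.

(** * The trace of a Hecke transform *)

(** If Q g = Q' and det g = n, then Q' composed with the adjugate of g is
n ^ 2 Q, and conversely. *)
Lemma hom_count_adj (n : nat) (Q Q' : bqf) : (0 < n)%N -> posdef Q' ->
  hom_count (det_eq n) Q' (bqf_scale (n%:Z ^+ 2) Q) = hom_count (det_eq n) Q Q'.
Proof.
move=> n_gt0 posQ'; have n2_neq0 : n%:Z ^+ 2 != 0 by rewrite expf_neq0 //; lia.
rewrite {2}/hom_count (_ : [set g | _] =
  adj2 @` [set g | det_eq n g /\ bqf_act Q' g = bqf_scale (n%:Z ^+ 2) Q]).
  rewrite card_fset_set_image //; first exact: finite_homM.
  exact: can_inj adj2K.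
apply/seteqP; split=> g /= [].
  move=> detg gQ; exists (adj2 g); last exact: adj2K.
  split; first by rewrite /det_eq /= det_adj2.
  by rewrite -gQ bqf_actM mul_mx_adj2 (detg : \det g = n%:Z) bqf_act_scalar.
move=> h [deth hQ'] <-; split; first by rewrite /det_eq /= det_adj2.
apply: (bqf_scale_inj n2_neq0).
by rewrite -bqf_act_scale -hQ' bqf_actM mul_mx_adj2 (deth : \det h = n%:Z) bqf_act_scalar.
Qed.

Lemma hom_count_exists (M : set 'M[int]_2) (Q Q' : bqf) :
  hom_count M Q Q' != 0%N -> exists2 g, M g & bqf_act Q g = Q'.
Proof.
apply: contra_neqP => no_g; rewrite /hom_count (_ : [set g | _] = set0).
  by rewrite fset_set0 cardfs0.
by apply/seteqP; split=> // g [Mg gQ]; apply: no_g; exists g.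
Qed.

Lemma sum_hecke_reps_prime (V : nmodType) (p : nat) (F : 'M[int]_2 -> V) : prime p ->
  \sum_(m <- hecke_reps p) F m =
  F (mx2 1 0 0 p%:Z) + \sum_(x < p) F (mx2 p%:Z (- x%:Z) 0 1).
Proof.
move=> p_pr; have p_gt0 := prime_gt0 p_pr.
rewrite /hecke_reps big_allpairs_dep (perm_big _ (divisors_prime p_pr)) /=.
rewrite big_cons !big_seq1 divn1 divnn p_gt0 oppr0; congr (_ + _).
by rewrite (_ : iota 0 p = index_iota 0 p) ?big_mkord // /index_iota subn0.
Qed.

(** For odd p this holds because p ^ 2 = 1 modulo 4.  For p = 2 it comes
from the form Q: its discriminant - d D is 0 or 1 modulo 4, and D = 1 modulo 4. *)
Lemma discriminant_of_forms (D : int) (p d : nat) (Q : bqf) :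
  fundamental_discriminant D -> prime p -> ~~ (p%:Z %| D)%Z ->
  is_discriminant (- (p ^ 2 * d)%N%:Z) -> forms D d Q -> is_discriminant (- d%:Z).
Proof.
move=> fD p_pr p_D pd_disc [_ discQ].
have [p2|p_odd] := even_prime p_pr.
  have D1 : (D %% 4)%Z = 1.
    by case: fD => [[]//|[D0 DE _]]; move: p_D; rewrite p2 DE; lia.
  have := discQ; rewrite /bqf_disc /is_discriminant.
  have : ((qb Q ^+ 2) %% 4)%Z = 0 \/ ((qb Q ^+ 2) %% 4)%Z = 1.
    rewrite expr2 -modzMm; have : 0 <= (qb Q %% 4)%Z < 4 by lia.
    by case: (qb Q %% 4)%Z => [[|[|[|[|]]]]|] // _; auto.
  have -> : - (d%:Z * D) = - d%:Z * D by rewrite mulNr.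
  rewrite -mulrA; move: (qb Q ^+ 2) (qa Q * qc Q) => s w s4 sw.
  have : ((- d%:Z * D) %% 4)%Z = ((- d%:Z) %% 4)%Z by rewrite -modzMmr D1 mulr1.
  by rewrite -sw !inE; move=> <-; clear -s4; lia.
move: pd_disc; rewrite /is_discriminant PoszM Posz_sqr -mulrN -modzMml.
have -> : (p%:Z ^+ 2 %% 4)%Z = 1; last by rewrite mul1r.
rewrite expr2 -modzMm; have : 0 <= (p%:Z %% 4)%Z < 4 by lia.
have : (p%:Z %% 4)%Z = 1 \/ (p%:Z %% 4)%Z = 3 by lia.
by case=> ->.
Qed.

Section TraceHecke.
Variables (R : realType) (D : int) (p : nat).
Hypotheses (hD : fundamental_discriminant D) (hD1 : 1 < D).
Hypotheses (p_pr : prime p) (p_D : ~~ (p%:Z %| D)%Z).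
Local Notation C := R[i].

Let p_gt0 : (0 < p)%N. Proof. exact: prime_gt0. Qed.
Let p_neq0 : p%:Z != 0. Proof. by rewrite eqz_nat -lt0n prime_gt0. Qed.
Let coprime_pD : coprimez p D.
Proof. by rewrite coprimezE prime_coprime // -dvdzE. Qed.

Lemma count_hecke_reps (d : nat) (Q : bqf) : is_discriminant (- d%:Z) ->
  forms D (p ^ 2 * d) Q ->
  \sum_(m <- hecke_reps p)
     (if `[< (bqf_scale (p%:Z ^+ 2) @` forms D d) (bqf_act Q m) >] then 1 else 0 : C) =
  1 + (if dvd3 p (qa Q) (qb Q) (qc Q) then (kronecker_prime (- (d%:Z * D)) p)%:~R else 0)
    + (if dvd3 (p%:Z ^+ 2) (qa Q) (qb Q) (qc Q) then p%:R else 0).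
Proof.
move=> d_disc FQ.
have disc_disc : is_discriminant (- (d%:Z * D)).
  rewrite /is_discriminant -mulNr -modzMm.
  have D4 : (D %% 4)%Z = 0 \/ (D %% 4)%Z = 1.
    by case: hD => [[]|[D0 ->]]; [right|left; rewrite mulrC modzMl].
  move: d_disc; rewrite /is_discriminant !inE => /orP[/eqP->|/eqP->]; case: D4 => -> //.
have act_p m : \det m = p%:Z -> forms D ((p ^ 2) ^ 2 * d) (bqf_act Q m).
  by move=> detm; rewrite -[((p ^ 2) ^ 2)%N]/(p ^ 2 * p ^ 2)%N -mulnA; exact: forms_act FQ.
have p2_gt0 : (0 < p ^ 2)%N by rewrite expn_gt0 p_gt0.
have mem m : \det m = p%:Z -> `[< (bqf_scale (p%:Z ^+ 2) @` forms D d) (bqf_act Q m) >] =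
    dvd3 (p%:Z ^+ 2) (qa (bqf_act Q m)) (qb (bqf_act Q m)) (qc (bqf_act Q m)).
  move=> detm; apply/asboolP/idP; rewrite -Posz_sqr; by move/(scale_formsP p2_gt0 (act_p m detm)).
have discE : qb Q ^+ 2 - 4 * qa Q * qc Q = p%:Z ^+ 2 * (- (d%:Z * D)).
  by rewrite -[LHS]/(bqf_disc Q) FQ.2 PoszM Posz_sqr mulrN mulrA.
(* the matrices of hecke_reps p realize the sublattices counted there *)
have := count_sublattices p_pr discE disc_disc.
set lhs := (_ + _)%N => count_eq.
transitivity (lhs%:R : C); last first.
  rewrite pmulrn count_eq !rmorphD /= rmorph1.
  by congr (_ + _ + _); case: ifP => // _; rewrite -pmulrn.
rewrite sum_hecke_reps_prime // natrD natr_sum; congr (_ + _).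
  rewrite mem; last by rewrite det_mx2 !mx2E; ring.
  have -> : dvd3 (p%:Z ^+ 2) (qa (bqf_act Q (mx2 1 0 0 p%:Z))) (qb (bqf_act Q (mx2 1 0 0 p%:Z)))
     (qc (bqf_act Q (mx2 1 0 0 p%:Z))) = (p%:Z ^+ 2 %| qa Q)%Z && (p%:Z %| qb Q)%Z.
    rewrite /dvd3 /bqf_act /bqf_eval /= !mx2E; congr andb; first by congr (dvdz _ _); ring.
    rewrite (_ : _ + _ = p%:Z * qb Q); last by ring.
    rewrite (_ : _ + _ = p%:Z ^+ 2 * qc Q); last by ring.
    by rewrite (dvdz_mulr (qc Q) (dvdzz (p%:Z ^+ 2))) andbT expr2 dvdz_mul2l.
  by case: (_ && _).
apply: eq_bigr => x _; rewrite mem; last by rewrite det_mx2 !mx2E; ring.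
set m := mx2 _ _ _ _.
have -> : dvd3 (p%:Z ^+ 2) (qa (bqf_act Q m)) (qb (bqf_act Q m)) (qc (bqf_act Q m)) =
    (p%:Z %| qb Q - 2 * qa Q * x%:Z)%Z &&
    (p%:Z ^+ 2 %| qa Q * x%:Z ^+ 2 - qb Q * x%:Z + qc Q)%Z.
  rewrite /dvd3 /bqf_act /bqf_eval /= !mx2E.
  rewrite (_ : qa Q * p%:Z ^+ 2 + _ + _ = p%:Z ^+ 2 * qa Q); last by ring.
  rewrite (_ : _ + 2 * qc Q * 0 * 1 = p%:Z * (qb Q - 2 * qa Q * x%:Z)); last by ring.
  rewrite (_ : _ + qc Q * 1 ^+ 2 = qa Q * x%:Z ^+ 2 - qb Q * x%:Z + qc Q); last by ring.
  by rewrite dvdz_mulr //= expr2 dvdz_mul2l.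
by case: (_ && _).
Qed.

Lemma trace_term_scale (d k : nat) (f : C -> C) (Q : bqf) :
  is_discriminant (- d%:Z) -> (0 < k)%N -> coprimez k D -> forms D d Q ->
  trace_term D f (bqf_scale k Q) = (kronecker D k)%:~R * trace_term D f Q.
Proof.
move=> d_disc k_gt0 co_k FQ; rewrite /trace_term (chi_scale hD hD1 d_disc) //.
rewrite aut_count_scale; last by lia.
by rewrite alpha_scale //; [rewrite rmorphM /= -!mulrA|case: FQ].
Qed.

Lemma sum_scaled_forms (d k : nat) (f : C -> C) (x : C) : (0 < k)%N -> (0 < d)%N ->
  sl2_invariant f ->
  \sum_(Q <- class_reps D (k ^ 2 * d)) trace_term D f Q *
    (if dvd3 k (qa Q) (qb Q) (qc Q) then x else 0) =
  x * \sum_(Q <- class_reps D d) trace_term D f (bqf_scale k Q).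
Proof.
move=> k_gt0 d_gt0 f_inv; set Y := bqf_scale k @` forms D d.
have kd_gt0 : (0 < k ^ 2 * d)%N by rewrite muln_gt0 expn_gt0 k_gt0.
have tS := class_reps_transversal hD1 kd_gt0; set S := class_reps D _ in tS *.
have ts := class_reps_transversal hD1 d_gt0; set s := class_reps D d in ts *.
have k_neq0 : k%:Z != 0 by rewrite eqz_nat -lt0n.
have YF : Y `<=` forms D (k ^ 2 * d).
  move=> _ [Q FQ <-]; split; first by apply/posdef_scale; [lia|case: FQ].
  by rewrite bqf_disc_scale FQ.2 PoszM Posz_sqr !mulrN mulrA.
have Y_class Q Q' : Y Q -> bqf_class Q Q' -> Y Q' by exact: scale_forms_class.
have tSY := bqf_transversal_filter YF Y_class tS.
have tY := bqf_transversal_scale k_neq0 ts.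
transitivity (x * \sum_(Q <- [seq Q <- S | `[< Y Q >]]) trace_term D f Q).
  rewrite big_filter [in RHS]big_mkcond mulr_sumr big_seq [RHS]big_seq.
  apply: eq_bigr => Q QS; have FQ := bqf_transversal_sub tS QS.
  have -> : `[< Y Q >] = dvd3 k (qa Q) (qb Q) (qc Q).
    by apply/asboolP/idP => /(scale_formsP k_gt0 FQ).
  by case: ifP => _; [rewrite mulrC|rewrite !mulr0].
congr (_ * _); rewrite -[RHS](big_map (bqf_scale k) xpredT (trace_term D f)).
apply: bqf_transversal_sum_eq tSY tY _ => Q Q' YQ.
by apply: (@trace_term_class R D hD hD1 (k ^ 2 * d)) => //; exact: YF.
Qed.

Lemma kronecker_prime_sqr1 : kronecker_prime D p ^+ 2 = 1.
Proof. by rewrite expr2 -kronecker_primeM // -expr2 kronecker_prime_sqr. Qed.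

(** In the proof N Q' is the number of cosets of matrices of determinant p that
carry Q' to p ^ 2 times a form of discriminant - d D; its three terms give the three
traces. *)
Theorem Tr_hecke (d : nat) (f : C -> C) : (0 < d)%N -> is_discriminant (- d%:Z) ->
  sl2_invariant f ->
  Tr D d (hecke p f) = Tr D (p ^ 2 * d)%N f + (kronecker_prime (- d%:Z) p)%:~R * Tr D d f
    + (if (p ^ 2 %| d)%N then p%:R * Tr D (d %/ p ^ 2)%N f else 0).
Proof.
move=> d_gt0 d_disc f_inv.
have p2d_gt0 : (0 < p ^ 2 * d)%N by rewrite muln_gt0 expn_gt0 p_gt0.
have tS := class_reps_transversal hD1 p2d_gt0; set S := class_reps D _ in tS.
have ts := class_reps_transversal hD1 d_gt0; set s := class_reps D d in ts.
have hsM := hecke_reps_coset p_gt0.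
have f_class d' : class_invariant (forms D d') (fun Q => f (alpha R Q)).
  by move=> Q Q' FQ QQ'; rewrite (alpha_class f_inv FQ.1 QQ').
have fclass d' Q Q' : forms D d' Q -> bqf_class Q Q' -> forms D d' Q' by exact: forms_class.
have fpos d' Q : forms D d' Q -> posdef Q by case.
pose N Q' := \sum_(Q <- s) (hom_count (det_eq p) Q Q')%:R / (aut_count Q)%:R : C.
have -> : Tr D d (hecke p f) = \sum_(Q' <- S) trace_term D f Q' * N Q'.
  rewrite Tr_class_reps // -/s.
  transitivity (\sum_(Q <- s) \sum_(Q' <- S) (chi D Q)%:~R * (2 / (aut_count Q)%:R) *
      ((hom_count (det_eq p) Q Q')%:R / (aut_count Q')%:R * f (alpha R Q'))).
    rewrite big_seq [RHS]big_seq; apply: eq_bigr => Q Qs.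
    have FQ := bqf_transversal_sub ts Qs.
    rewrite /trace_term hecke_alpha //; last exact: fpos FQ.
    rewrite -[RHS]mulr_sumr; congr (_ * _).
    rewrite -(coset_sum hsM tS (fclass _) (fpos _) (f_class _) (fpos d Q FQ)).
    rewrite big_seq [RHS]big_seq; apply: eq_bigr => m mp; rewrite asboolT //.
    by apply: forms_act FQ => //; exact: (coset_reps_sub hsM).
  rewrite exchange_big /= big_seq [RHS]big_seq; apply: eq_bigr => Q' Q'S.
  rewrite mulr_sumr big_seq [RHS]big_seq; apply: eq_bigr => Q Qs.
  have FQ := bqf_transversal_sub ts Qs.
  have [->|/hom_count_exists[g detg gQ]] := eqVneq (hom_count (det_eq p) Q Q') 0%N.
    by rewrite !mul0r !mulr0.
  have <- : chi D Q' = chi D Q by rewrite -gQ (chi_act hD hD1 d_disc p_gt0).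
  by rewrite /trace_term; ring.
have N_val Q' : Q' \in S -> N Q' =
  1 + (if dvd3 p (qa Q') (qb Q') (qc Q') then (kronecker_prime (- (d%:Z * D)) p)%:~R else 0)
    + (if dvd3 (p%:Z ^+ 2) (qa Q') (qb Q') (qc Q') then p%:R else 0).
  move=> Q'S; have FQ' := bqf_transversal_sub tS Q'S.
  rewrite -count_hecke_reps //.
  have p2_neq0 : p%:Z ^+ 2 != 0 by rewrite expf_neq0.
  have tY := bqf_transversal_scale p2_neq0 ts.
  have := @coset_sum C _ _ _ _ (fun=> 1) Q' hsM tY.
  move=> -> //; last first.
  - exact: fpos FQ'.
  - by move=> Q [Q0 FQ0 <-]; apply/posdef_scale; [rewrite exprn_gt0|exact: fpos FQ0].
  - by move=> Q Q''; exact: scale_forms_class.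
  rewrite big_map; apply: eq_bigr => Q _.
  by rewrite mulr1 hom_count_adj // ?aut_count_scale //; exact: fpos FQ'.
rewrite big_seq (eq_bigr _ (fun Q' h => congr1 _ (N_val Q' h))) -big_seq.
under eq_bigr do rewrite !mulrDr mulr1.
rewrite !big_split /=; congr (_ + _ + _).
- by rewrite Tr_class_reps.
- rewrite (sum_scaled_forms (k := p) _ p_gt0 d_gt0 f_inv) //.
  under eq_big_seq => Q Qs.
    rewrite (trace_term_scale f d_disc p_gt0 coprime_pD (bqf_transversal_sub ts Qs)).
    over.
  rewrite -mulr_sumr -Tr_class_reps // mulrA; congr (_ * _).
  rewrite -rmorphM kronecker_primeE // -mulNr kronecker_primeM // -mulrA -expr2.
  by rewrite kronecker_prime_sqr1 // mulr1.
- case: ifP => [p2_d|p2_d].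
    set d2 := (d %/ p ^ 2)%N; have dE : (p ^ 2 * d2 = d)%N by rewrite mulnC divnK.
    have d2_gt0 : (0 < d2)%N by move: d_gt0; rewrite -dE muln_gt0 => /andP[].
    have p2_gt0 : (0 < p ^ 2)%N by rewrite expn_gt0 p_gt0.
    transitivity (p%:R * \sum_(Q <- class_reps D d2) trace_term D f (bqf_scale (p ^ 2)%N Q)).
      rewrite -(sum_scaled_forms (k := (p ^ 2)%N) p%:R p2_gt0 d2_gt0 f_inv).
      by rewrite -[((p ^ 2) ^ 2)%N]/(p ^ 2 * p ^ 2)%N -mulnA dE -/S Posz_sqr.
    rewrite Tr_class_reps //; congr (_ * _); rewrite big_seq [RHS]big_seq.
    apply: eq_bigr => Q Qs; have FQ := bqf_transversal_sub (class_reps_transversal hD1 d2_gt0) Qs.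
    have d2_disc : is_discriminant (- d2%:Z).
      by apply: (discriminant_of_forms hD p_pr p_D _ FQ); rewrite dE.
    rewrite (trace_term_scale f d2_disc p2_gt0 _ FQ); last by rewrite Posz_sqr coprimezXl.
    rewrite -[(p ^ 2)%N]/(p * p)%N kroneckerMr // kronecker_primeE // -expr2.
    by rewrite kronecker_prime_sqr1 mul1r.
  rewrite big_seq big1 // => Q QS; case: ifP => [/dvd3P[Q' QE]|_]; last by rewrite mulr0.
  have FQ := bqf_transversal_sub tS QS.
  have : p%:Z ^+ 2 * bqf_disc Q' = - (d%:Z * D).
    apply: (mulfI (expf_neq0 2 p_neq0)); rewrite mulrA -exprD.
    move: FQ.2; rewrite QE bqf_disc_scale PoszM Posz_sqr -exprM => ->.
    by rewrite mulrN mulrA.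
  move=> discE; have : (p%:Z ^+ 2 %| d%:Z * D)%Z by rewrite -[_ * D]opprK -discE dvdzNr dvdz_mulr.
  rewrite mulrC Gauss_dvdzr; last by rewrite coprimezXl.
  by rewrite -Posz_sqr dvdzE /= p2_d.
Qed.

End TraceHecke.

(** * Invariance of j *)

Section Modularity.
Variable R : realType.
Local Notation C := R[i].

Lemma pointC : (point : C^o) = 0.
Proof. done. Qed.

(** If the sums of F converge this is continuity; if not, those of k * F do not
converge either, and both limits take the default value 0. *)
Lemma sum_scale (I : choiceType) (k : C) (F : I -> C^o) : k != 0 ->
  summability.sum (fun i => k * F i : C^o) = k * summability.sum F.
Proof.
move=> k_neq0; have totallyF := @summability.totally_filter I.
rewrite /summability.sum.
have -> : summability.partial_sum (fun i => k * F i : C^o) = k \*: summability.partial_sum F.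
  by apply/funext => A; rewrite /summability.partial_sum /= scaler_sumr.
have [cvgF|dvgF] := pselect (cvg (summability.partial_sum F @ summability.totally)).
  exact: (cvg_lim (@norm_hausdorff _ C^o) (cvgZl_tmp (k := k) cvgF)).
have dvgkF : ~ cvg ((k \*: summability.partial_sum F) x @[x --> summability.totally]).
  by rewrite is_cvgZlE.
by rewrite (dvgP dvgF) (dvgP dvgkF) pointC mulr0.
Qed.

(** A bijection of the index set preserves the filter of large finite
subsets. *)
Lemma sum_reindex (I : choiceType) (phi psi : I -> I) (F : I -> C^o) :
  cancel phi psi -> cancel psi phi ->
  summability.sum (F \o phi) = summability.sum F.
Proof.
move=> phiK psiK; have phi_inj := can_inj phiK.
rewrite /summability.sum.
have -> : summability.partial_sum (F \o phi) = summability.partial_sum F \o (fun A : {fset I} => (phi @` A)%fset).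
  apply/funext => A; rewrite /summability.partial_sum /=.
  rewrite -(big_seq_fsetE _ A xpredT (F \o phi)) -(big_seq_fsetE _ (phi @` A)%fset xpredT F) /=.
  by rewrite big_imfset //= => ? ? _ _; exact: phi_inj.
congr (lim _); apply/seteqP; split=> P /= [A _ AP].
  exists (phi @` A)%fset => // B /= AB.
  have := AP (psi @` B)%fset; rewrite /=.
  have -> : (phi @` (psi @` B) = B)%fset.
    by rewrite -imfset_comp; apply/fsetP => x; apply/imfsetP/idP => /= [[y yB ->]|xB];
      rewrite ?psiK //; exists x; rewrite ?psiK.
  apply; apply/fsubsetP => x xA; apply/imfsetP; exists (phi x); rewrite ?phiK //=.
  by apply: (fsubsetP AB); apply/imfsetP; exists x.
exists (psi @` A)%fset => // B /= AB; apply: AP => /=.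
apply/fsubsetP => x xA; apply/imfsetP; exists (psi x); rewrite ?psiK //=.
by apply: (fsubsetP AB); apply/imfsetP; exists x.
Qed.

(** Right multiplication by g permutes the lattice points (c, d). *)
Lemma eisenstein_modular (k : nat) (g : 'M[int]_2) (z : C) :
  SL2Z g -> 0 < complex.Im z ->
  eisenstein k (mobius g z) = ((g 1 0)%:~R * z + (g 1 1)%:~R) ^+ k * eisenstein k z.
Proof.
move=> Gg z_gt0; have den_neq0 : (g 1 0)%:~R * z + (g 1 1)%:~R != 0 :> C.
  by apply: mobius_den_neq0; rewrite ?(Gg : \det g = 1).
set J := _ + _ in den_neq0 *.
pose row (h : 'M[int]_2) (cd : int * int) : int * int :=
  (cd.1 * h 0 0 + cd.2 * h 1 0, cd.1 * h 0 1 + cd.2 * h 1 1).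
have rowM h h' cd : row h (row h' cd) = row (h' *m h) cd.
  by rewrite /row !mulmx2E /=; congr pair; ring.
have row1 cd : row 1%:M cd = cd by case: cd => c d; rewrite /row !mxE /=; congr pair; ring.
have rowK : cancel (row g) (row (adj2 g)) by move=> cd; rewrite rowM SL2Z_Kadj.
have rowK' : cancel (row (adj2 g)) (row g) by move=> cd; rewrite rowM SL2Z_adjK.
pose G (cd : int * int) : C^o := (cd.1%:~R * z + cd.2%:~R) ^- k.
rewrite /eisenstein -(sum_reindex G rowK rowK') -sum_scale ?expf_neq0 //.
apply: (congr1 (@summability.sum (int * int)%type C C^o)); apply/funext => -[c d] /=; rewrite /G /row /=.
rewrite !rmorphD !rmorphM /=.
rewrite -exprVn -[RHS]mulr1. 
have -> : c%:~R * mobius g z + d%:~R = (((c%:~R * (g 0 0)%:~R + d%:~R * (g 1 0)%:~R) * z + (c%:~R * (g 0 1)%:~R + d%:~R * (g 1 1)%:~R))) / J :> C.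
  by rewrite /mobius /J; field.
by rewrite mulr1 exprVn expr_div_n invf_div mulrC.
Qed.

Lemma jinv_modular : sl2_invariant (@jinv R).
Proof.
move=> g z Gg z_gt0; rewrite /jinv !eisenstein_modular //.
have : (g 1 0)%:~R * z + (g 1 1)%:~R != 0 :> C.
  by apply: mobius_den_neq0; rewrite ?(Gg : \det g = 1).
set J := _ + _ => J_neq0; move: (eisenstein 4 z) (eisenstein 6 z) => e4 e6.
have -> : (60 * (J ^+ 4 * e4)) ^+ 3 = J ^+ 12 * (60 * e4) ^+ 3 by ring.
have -> : (140 * (J ^+ 6 * e6)) ^+ 2 = J ^+ 12 * (140 * e6) ^+ 2 by ring.
rewrite !(mulrCA _ (J ^+ 12)) -mulrBr invfM.
by rewrite mulrACA divff ?mul1r // expf_neq0.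
Qed.

Lemma J_invariant (n : nat) : (0 < n)%N -> sl2_invariant (@J R n).
Proof.
move=> n_gt0; apply: hecke_invariant => // g z Gg z_gt0.
by rewrite jinv_modular.
Qed.
End Modularity.

(** * Solving the recursion *)

Section Recursion.
Variable K : comNzRingType.
Variables (p : K).

(** The left-hand side will be the expansion of T(p ^ m.+1) T(p ^ s.+1); splitting
off its first term leaves p times the expansion with both exponents lowered. *)
Lemma hecke_sum_rec (h : nat -> K) (m s : nat) :
  \sum_(t < (minn s.+1 m.+1).+1) p ^+ t * h (m.+1 + s.+1 - 2 * t)%N =
  h (m.+1 + s.+1)%N + p * \sum_(t < (minn s m).+1) p ^+ t * h (m + s - 2 * t)%N.
Proof.
rewrite minnSS big_ord_recl expr0 mul1r muln0 subn0; congr (_ + _).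
rewrite mulr_sumr; apply: eq_bigr => t _; rewrite /= exprS mulrA (_ : bump 0 t = t.+1) //.
by congr (_ * h _); lia.
Qed.

(** The right-hand side of the trace identity, a t standing for the trace at
p ^ (2 t) d' and isd for the fact that - d' is a discriminant. *)
Definition trace_rhs (a : nat -> K) (eps : K) (isd : bool) (m u : nat) : K :=
  if (m < u)%N then \sum_(t < m.+1) p ^+ (m - t) * a (u - m + 2 * t)%N
  else (if isd then \sum_(t < (m - u).+1) eps ^+ (m - u - t) * p ^+ u * a t else 0)
       + \sum_(1 <= t < u.+1) p ^+ (u - t) * a (m - u + 2 * t)%N.

Lemma trace_rhs0m (a : nat -> K) (eps : K) (isd : bool) (m : nat) :
  trace_rhs a eps isd m 0 = if isd then \sum_(t < m.+1) eps ^+ (m - t) * a t else 0.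
Proof.
rewrite /trace_rhs ltn0 big_geq // addr0 subn0; case: isd => //.
by apply: eq_bigr => t _; rewrite expr0 mulr1.
Qed.

Lemma trace_rhs0 (a : nat -> K) (eps : K) (isd : bool) (u : nat) : (~~ isd -> a 0%N = 0) ->
  trace_rhs a eps isd 0 u = a u.
Proof.
case: u => [|u] a0; last by rewrite /trace_rhs /= big_ord1 expr0 mul1r subn0 addn0.
by rewrite trace_rhs0m; case: isd a0 => [_|->//]; rewrite big_ord1 expr0 mul1r.
Qed.

Lemma trace_rhsS (a : nat -> K) (eps : K) (isd : bool) (m u : nat) :
  trace_rhs a eps isd m.+1 u.+1 = p * trace_rhs a eps isd m u + a (m + u + 2)%N.
Proof.
rewrite /trace_rhs ltnS subSS; case: ltnP => [m_lt_u|u_le_m].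
  rewrite big_ord_recr /= subnn expr0 mul1r mulr_sumr; congr (_ + a _); last by lia.
  by apply: eq_bigr => t _; rewrite mulrA -exprS; congr (p ^+ _ * a _); have := ltn_ord t; lia.
rewrite big_nat_recr //= subnn expr0 mul1r addrA mulrDr; congr (_ + _ + a _); last by lia.
  case: isd; rewrite ?mulr0 // mulr_sumr subSS; apply: eq_bigr => t _.
  by rewrite exprS; ring.
rewrite mulr_sumr big_nat [RHS]big_nat; apply: eq_bigr => t t_le; rewrite mulrA -exprS.
by congr (p ^+ _ * a _); lia.
Qed.

(** Induction on m, for all k at once and carrying two consecutive values
of m. *)
Lemma trace_rhs_unique (A : nat -> nat -> K) (a : nat -> K) (eps : K) (isd : bool) :
  (forall k, A 0%N k = a k) -> (~~ isd -> forall m, A m 0%N = 0) ->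
  (isd -> A 1%N 0%N = a 1%N + eps * a 0%N) ->
  (isd -> forall m, A m.+2 0%N + p * A m 0%N = A m.+1 1%N + eps * A m.+1 0%N) ->
  (forall k, A 1%N k.+1 = a k.+2 + p * a k) ->
  (forall m k, A m.+2 k.+1 + p * A m k.+1 = A m.+1 k.+2 + p * A m.+1 k) ->
  forall m k, A m k = trace_rhs a eps isd m k.
Proof.
move=> A0 nisd isd1 isdS A1 AS.
have a0 : ~~ isd -> a 0%N = 0 by move=> /nisd nA; rewrite -A0.
have main m : (forall k, A m k = trace_rhs a eps isd m k) /\
   (forall k, A m.+1 k = trace_rhs a eps isd m.+1 k).
  elim: m => [|m [IHm IHm1]].
    split=> [k|[|k]]; first by rewrite A0 trace_rhs0.
      rewrite trace_rhs0m; case: ifPn => [isdT|/nisd->//]; rewrite isd1 //.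
      by rewrite !big_ord_recl big_ord0 /= /bump /= expr0 expr1; ring.
    by rewrite A1 trace_rhsS trace_rhs0 // add0n addn2 addrC.
  split=> // -[|k].
    have [isdE|isdF] := boolP isd; last by rewrite nisd // trace_rhs0m.
    apply: (addIr (p * A m 0%N)); rewrite isdS // !IHm1 !IHm isdE.
    rewrite trace_rhsS !trace_rhs0m /=.
    have -> : \sum_(t < m.+3) eps ^+ (m.+2 - t) * a t =
        eps * \sum_(t < m.+2) eps ^+ (m.+1 - t) * a t + a m.+2.
      rewrite big_ord_recr /= subnn expr0 mul1r; congr (_ + _); rewrite mulr_sumr.
      by apply: eq_bigr => t _; rewrite subSn ?exprS ?mulrA // -ltnS.
    by rewrite addn0 addn2; ring.
  apply: (addIr (p * A m k.+1)); rewrite AS !IHm1 !IHm !trace_rhsS; 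
  rewrite (_ : (m.+1 + k + 2 = m + k.+1 + 2)%N); last by lia.
  ring.
by move=> m; case: (main m).
Qed.

End Recursion.

(** * The trace identity *)

Section Final.
Variable R : realType.
Local Notation C := R[i].

Lemma hecke_linear (k : nat) (x : C) (f g : C -> C) (z : C) :
  hecke k (fun w => f w + x * g w) z = hecke k f z + x * hecke k g z.
Proof. by rewrite !heckeE mulr_sumr -big_split. Qed.

(** If h i is f | T(p ^ i) this is f | T(p ^ m) T(p ^ s), expanded. *)
Definition hecke_comb (x : C) (h : nat -> C -> C) (m s : nat) (z : C) : C :=
  \sum_(t < (minn s m).+1) x ^+ t * h (m + s - 2 * t)%N z.

Lemma hecke_combS (x : C) (h : nat -> C -> C) (m s : nat) :
  hecke_comb x h m.+1 s.+1 = fun z => h (m.+1 + s.+1)%N z + x * hecke_comb x h m s z.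
Proof. by apply/funext => z; exact: (hecke_sum_rec x (fun i => h i z)). Qed.

Lemma hecke_combm0 (x : C) (h : nat -> C -> C) (m : nat) : hecke_comb x h m 0 = h m.
Proof.
by apply/funext => z; rewrite /hecke_comb min0n big_ord1 expr0 mul1r muln0 subn0 addn0.
Qed.

Lemma hecke_comb0s (x : C) (h : nat -> C -> C) (s : nat) : hecke_comb x h 0 s = h s.
Proof. by apply/funext => z; rewrite /hecke_comb minn0 big_ord1 expr0 mul1r muln0 subn0. Qed.

Lemma hecke_comb_rec (p : nat) (h : nat -> C -> C) (z : C) :
  hecke p (h 0%N) z = h 1%N z ->
  (forall i, hecke p (h i.+1) z = h i.+2 z + p%:R * h i z) ->
  forall s, hecke p (hecke_comb p%:R h 0 s) z = hecke_comb p%:R h 1 s z /\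
    forall m, hecke p (hecke_comb p%:R h m.+1 s) z =
      hecke_comb p%:R h m.+2 s z + p%:R * hecke_comb p%:R h m s z.
Proof.
move=> h0 hS; elim=> [|s [IH0 IHS]].
  by rewrite !hecke_combm0; split=> // m; rewrite !hecke_combm0.
split; first by rewrite hecke_combS !hecke_comb0s hS add1n.
case=> [|m]; rewrite !hecke_combS hecke_linear addSn addnS.
  by rewrite hS IH0 hecke_comb0s; ring.
rewrite hS IHS !addSn !addnS; ring.
Qed.

(** The roots of definite forms lie in the upper half-plane. *)
Lemma Tr_ext (D : int) (d : nat) (f g : C -> C) : 1 < D -> (0 < d)%N ->
  (forall z, 0 < complex.Im z -> f z = g z) -> Tr D d f = Tr D d g.
Proof.
move=> hD1 d_gt0 fg; rewrite !Tr_class_reps // big_seq [RHS]big_seq.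
apply: eq_bigr => Q Qs; have FQ := bqf_transversal_sub (class_reps_transversal hD1 d_gt0) Qs.
by rewrite /trace_term fg //; case: (alphaP R FQ.1).
Qed.

Lemma Tr_sum (D : int) (d k : nat) (x : 'I_k -> C) (f : 'I_k -> C -> C) : 1 < D -> (0 < d)%N ->
  Tr D d (fun z => \sum_(t < k) x t * f t z) = \sum_(t < k) x t * Tr D d (f t).
Proof.
move=> hD1 d_gt0; under [RHS]eq_bigr do rewrite Tr_class_reps // mulr_sumr.
rewrite exchange_big Tr_class_reps //; apply: eq_bigr => Q _.
by rewrite /trace_term mulr_sumr; apply: eq_bigr => t _; ring.
Qed.

Lemma Tr_linear (D : int) (d : nat) (x : C) (f g : C -> C) : 1 < D -> (0 < d)%N ->
  Tr D d (fun z => f z + x * g z) = Tr D d f + x * Tr D d g.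
Proof.
move=> hD1 d_gt0; rewrite !Tr_class_reps // mulr_sumr -big_split; apply: eq_bigr => Q _.
by rewrite /trace_term /=; ring.
Qed.

Lemma J_hecke (p i n' : nat) (z : C) : prime p -> ~~ (p %| n')%N -> (0 < n')%N ->
  0 < complex.Im z ->
  hecke p (J (p ^ i * n')) z = J (p ^ i.+1 * n') z +
    (if i is i'.+1 then p%:R * J (p ^ i' * n') z else 0).
Proof.
move=> p_pr p_n' n'_gt0 z_gt0; have p_gt0 := prime_gt0 p_pr.
rewrite /J hecke_relation ?muln_gt0 ?expn_gt0 ?p_gt0 //; last first.
  move=> w w_gt0; have <- : mobius (mx2 1 1 0 1) w = w + 1.
    by rewrite /mobius !mx2E mul1r mul0r add0r divr1.
  by rewrite jinv_modular // /SL2Z /= det_mx2 !mx2E.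
rewrite expnS mulnA; congr (_ + _); case: i => [|i]; first by rewrite expn0 mul1n (negPf p_n').
by rewrite expnS -mulnA (dvdn_mulr _ (dvdnn p)) (mulKn _ p_gt0).
Qed.

End Final.

(** For odd p an even power of p is 1 modulo 4, and - d' is a discriminant;
for p = 2 the number is divisible by 4 as soon as k > 0. *)
Lemma discriminant_p_power (p u k d' : nat) : prime p ->
  is_discriminant (- (p ^ (2 * u) * d')%N%:Z) ->
  (0 < k)%N || is_discriminant (- d'%:Z) -> is_discriminant (- (p ^ (2 * k) * d')%N%:Z).
Proof.
have sqrE x : (p ^ (2 * x) * d')%N%:Z = (p ^ x)%N%:Z ^+ 2 * d'%:Z.
  by rewrite PoszM -Posz_sqr -expnM mulnC.
move=> p_pr; rewrite !sqrE -!mulrN => u_disc /orP[k_gt0|d'_disc]; last exact: is_discriminant_sqr.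
have [p2|p_odd] := even_prime p_pr.
  case: k k_gt0 => // k _; rewrite p2 expnS PoszM exprMn -mulrA.
  by rewrite /is_discriminant (_ : 2%N%:Z ^+ 2 = 4) // modzMr.
apply: is_discriminant_sqr; move: u_disc; rewrite /is_discriminant -modzMml.
have -> : ((p ^ u)%N%:Z ^+ 2 %% 4)%Z = 1; last by rewrite mul1r.
have : odd (p ^ u) by rewrite oddX p_odd orbT.
move: (p ^ u)%N => q q_odd; rewrite expr2 -modzMm.
have : (q%:Z %% 4)%Z = 1 \/ (q%:Z %% 4)%Z = 3 by lia.
by case=> ->.
Qed.

Theorem theorem4p1 (R : realType) (D : int) (p m n d u d' : nat)
    (hD : fundamental_discriminant D) (hD1 : 1 < D)
    (hp : prime p) (hpD : ~~ (p%:Z %| D)%Z)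
    (hn : (0 < n)%N)
    (hd0 : (0 < d)%N) (hd : is_discriminant (- d%:Z))
    (hdd' : d = (p ^ (2 * u) * d')%N) (hd' : ~~ (p ^ 2 %| d')%N) :
  \sum_(t < (minn (logn p n) m).+1)
     p%:R ^+ t * Tr D d (@J R (p ^ m * n %/ p ^ (2 * t))%N)
  = if (m < u)%N then
      \sum_(t < m.+1)
         p%:R ^+ (m - t)
         * Tr D (p ^ (2 * u - 2 * m + 4 * t) * d')%N (@J R n)
    else
      (if is_discriminant (- d'%:Z) then
         \sum_(t < (m - u).+1)
            (kronecker (- d'%:Z) p%:Z)%:~R ^+ (m - u - t) * p%:R ^+ u
            * Tr D (p ^ (2 * t) * d')%N (@J R n)
       else 0)
      + \sum_(1 <= t < u.+1)
           p%:R ^+ (u - t)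
           * Tr D (p ^ (2 * m - 2 * u + 4 * t) * d')%N (@J R n).
Proof.
have p_gt0 := prime_gt0 hp.
have d'_gt0 : (0 < d')%N by move: hd0; rewrite hdd' muln_gt0 => /andP[].
set s := logn p n; have [n' p_n' nE] := pfactor_coprime hp hn.
rewrite prime_coprime // in p_n'; rewrite -/s mulnC in nE.
have n'_gt0 : (0 < n')%N by move: hn; rewrite nE muln_gt0 => /andP[].
pose h i : R[i] -> R[i] := J (p ^ i * n').
(* n is p ^ s * n', so that h s is J n, and L k is J n transformed by T(p ^ k) *)
pose L k := hecke_comb p%:R h k s.
pose dk k := (p ^ (2 * k) * d')%N.
have dk_gt0 k : (0 < dk k)%N by rewrite muln_gt0 expn_gt0 p_gt0.
pose A k l := Tr D (dk l) (L k).
pose a l := Tr D (dk l) (@J R n).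
set isd := is_discriminant (- d'%:Z).
set eps : R[i] := (kronecker (- d'%:Z) p%:Z)%:~R.
have dk_disc k : (0 < k)%N || isd -> is_discriminant (- (dk k)%:Z).
  by move=> k_cond; apply: (discriminant_p_power (u := u) hp) => //; rewrite -hdd'.
have L0 : L 0%N = J n by rewrite /L hecke_comb0s /h -nE.
have h_inv i : sl2_invariant (h i) by apply: J_invariant; rewrite muln_gt0 expn_gt0 p_gt0.
have L_inv k : sl2_invariant (L k).
  by move=> g z Gg z_gt0; apply: eq_bigr => t _; rewrite h_inv.
have h_hecke z : 0 < complex.Im z -> hecke p (L 0%N) z = L 1%N z /\
    forall k, hecke p (L k.+1) z = L k.+2 z + p%:R * L k z.
  move=> z_gt0; apply: hecke_comb_rec => [|i]; rewrite J_hecke // addr0 //.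
have trace0 l : Tr D (dk l) (hecke p (L 0%N)) = A 1%N l.
  by apply: Tr_ext => // z /h_hecke[].
have traceS k l : Tr D (dk l) (hecke p (L k.+1)) = A k.+2 l + p%:R * A k l.
  rewrite -Tr_linear //; apply: Tr_ext => // z /h_hecke[_]; exact.
(* d' is not divisible by p ^ 2, so that the third term of the trace formula is absent *)
have hecke_at0 f : isd -> sl2_invariant f ->
    Tr D (dk 0) (hecke p f) = Tr D (dk 1) f + eps * Tr D (dk 0) f.
  move=> isdT f_inv; rewrite Tr_hecke //; last by apply: dk_disc; rewrite isdT orbT.
  have dk0 : dk 0%N = d' by rewrite /dk muln0 expn0 mul1n.
  by rewrite dk0 (negPf hd') addr0 /eps kronecker_primeE // /dk muln1.
(* p divides dk l.+1, so that the symbol in the trace formula vanishes *)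
have hecke_atS f l : sl2_invariant f ->
    Tr D (dk l.+1) (hecke p f) = Tr D (dk l.+2) f + p%:R * Tr D (dk l) f.
  move=> f_inv; rewrite Tr_hecke //; last exact: dk_disc.
  have dkS k : dk k.+1 = (p ^ 2 * dk k)%N by rewrite /dk mulnS expnD mulnA.
  rewrite -dkS (_ : kronecker_prime _ _ = 0) ?mul0r ?addr0; last first.
    apply/eqP; rewrite kronecker_prime_eq0 dvdzNr dvdzE /= dkS.
    by rewrite -mulnn -mulnA dvdn_mulr.
  by rewrite (dkS l) dvdn_mulr // mulKn // expn_gt0 p_gt0.
have main := @trace_rhs_unique R[i] p%:R A a eps isd.
transitivity (trace_rhs p%:R a eps isd m u).
  rewrite -main; last 1 first.
  - by move=> k l; rewrite -traceS hecke_atS.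
  - have -> : A m u = \sum_(t < (minn s m).+1) p%:R ^+ t * Tr D (dk u) (h (m + s - 2 * t)%N).
      exact: (@Tr_sum _ D (dk u) _ (fun t => p%:R ^+ t) (fun t => h (m + s - 2 * t)%N)).
    apply: eq_bigr => t _; rewrite hdd' /h; congr (_ * Tr _ _ (J _)).
    have t_le : (2 * t <= m + s)%N by have := ltn_ord t; rewrite -/s; lia.
    by rewrite nE mulnA -expnD -{1}(subnK t_le) expnD mulnAC mulnK // expn_gt0 p_gt0.
  - by move=> k; rewrite /A L0.
  - by move=> nd k; rewrite /A Tr_not_discriminant // /dk muln0 expn0 mul1n.
  - by move=> isdT; rewrite -trace0 hecke_at0 // /a L0.
  - by move=> isdT k; rewrite -traceS hecke_at0.
  - by move=> k; rewrite -trace0 hecke_atS // /a L0.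
rewrite /trace_rhs; case: ifP => m_u.
  apply: eq_bigr => t _; rewrite /a /dk.
  by have -> : (2 * u - 2 * m + 4 * t = 2 * (u - m + 2 * t))%N by lia.
congr (_ + _); apply: eq_bigr => t _; rewrite /a /dk.
by have -> : (2 * m - 2 * u + 4 * t = 2 * (m - u + 2 * t))%N by lia.
Qed.
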